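(* Let $(\Pi,\underline\mu)$ be a Baker--Akhieser weighted line arrangement, $A=A(\Pi,\underline\mu)$, and let $\vec\xi=(\rho_0\cos\varphi_0,\rho_0\sin\varphi_0)$ with $\rho_0\in\mathbb C^\ast$, $\varphi_0\in\mathbb C$, such that $\sin(2(\alpha-\varphi_0))\neq 0$ for all $\alpha\in\Pi$. Let $W\subset R$ be the spectral module defined below. Then $W\cong P(-\xi_1z_1-\xi_2z_2):=\{f\in R:\exp(-\xi_1z_1-\xi_2z_2)f\text{ is }(\Pi,\underline\mu)\text{-quasi-invariant}\}$ as $A$-modules. In particular $W$ is a projective $A$-module.
   Context: $R=\mathbb C[z_1,z_2]$, polar coordinates $z_1=\rho\cos\varphi$, $z_2=\rho\sin\varphi$, $g^{(k)}_\alpha=\partial^kg/\partial\varphi^k|_{\varphi=\alpha}$. A weighted line arrangement: $\Pi\subset\mathbb C$ finite, $\alpha-\beta\notin\pi\mathbb Z$ for $\alpha\ne\beta$, $\underline\mu:\Pi\to\mathbb N_0$; $l_\alpha=-\sin(\alpha)z_1+\cos(\alpha)z_2$, $s_\alpha$ the involution of $R$ induced by the reflection fixing $\{l_\alpha=0\}$, $A(\Pi,\underline\mu)=\{f\in R:l_\alpha^{2\mu_\alpha+1}\mid f-s_\alpha(f)\ \forall\alpha\}$. An analytic function $g$ is $(\Pi,\underline\mu)$-quasi-invariant if $g^{(2l-1)}_\alpha=0$ for all $\alpha\in\Pi$, $1\le l\le\mu_\alpha$. With $e(\alpha)=\exp(2i\alpha)$, $(\Pi,\underline\mu)$ is Baker--Akhieser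 if for all $\alpha\in\Pi$ and $1\le k\le\mu_\alpha$: $\sum_{\beta\ne\alpha}\mu_\beta\frac{(e(\beta)+e(\alpha))^{2k-1}}{(e(\beta)-e(\alpha))^{2k-1}}=0$ and $\sum_{\beta\ne\alpha}\mu_\beta(\mu_\beta+1)\frac{e(\beta)(e(\beta)+e(\alpha))^{2k-1}}{(e(\beta)-e(\alpha))^{2k+1}}=0$. Let $\mu=\sum_\alpha\mu_\alpha$, $\delta(z_1,z_2)=\prod_\alpha l_\alpha^{\mu_\alpha}$, $H=\partial_{x_1}^2+\partial_{x_2}^2-\sum_{\alpha\in\Pi}\frac{\mu_\alpha(\mu_\alpha+1)}{l_\alpha^2(\vec x-\vec\xi)}$, and $\Psi(\vec x;\vec z;\vec\xi)=\frac{1}{2^\mu\mu!}(H-z_1^2-z_2^2)^\mu\big(\delta(x_1-\xi_1,x_2-\xi_2)\exp(x_1z_1+x_2z_2)\big)$ (operators acting in $\vec x$). For $(p_1,p_2)\in\mathbb N_0^2$, $w_{(p_1,p_2)}=\frac{\partial^{p_1+p_2}\Psi}{\partial x_1^{p_1}\partial x_2^{p_2}}\big|_{\vec x=0}$; these are polynomials in $z_1,z_2$, and $W=\langle w_{(p_1,p_2)}:(p_1,p_2)\in\mathbb N_0^2\rangle_{\mathbb C}\subset R$ is an $A$-module under multiplication. *)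

(* Defs.v *)
From HB Require Import structures.
From mathcomp Require Import all_boot all_order all_algebra.
From mathcomp Require Import all_classical all_reals all_analysis.
From mathcomp Require Import complex.

Set Implicit Arguments.
Unset Strict Implicit.
Unset Printing Implicit Defensive.

Import Order.TTheory GRing.Theory Num.Theory.
Local Open Scope ring_scope.
Local Open Scope complex_scope.

Definition cexp {R : realType} (z : R[i]) : R[i] :=
  (expR (complex.Re z))%:C * (cos (complex.Im z) +i* sin (complex.Im z)).

Definition ccos {R : realType} (z : R[i]) : R[i] :=
  (cexp ('i * z) + cexp (- ('i * z))) / 2.

Definition csin {R : realType} (z : R[i]) : R[i] :=
  (cexp ('i * z) - cexp (- ('i * z))) / (2 * 'i).

Definition ee {R : realType} (a : R[i]) : R[i] := cexp (2 * 'i * a).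

(* R = C[z1,z2], realised as {poly {poly C}}: the inner variable is z1, *)
(* the outer variable is z2; the coefficient of z1^i z2^j in f is       *)
(* f`_j`_i.                                                              *)

Definition bpoly (R : realType) := {poly {poly R[i]}}.

Definition cC {R : realType} (c : R[i]) : bpoly R := c%:P%:P.
Definition Z1 (R : realType) : bpoly R := ('X)%:P.
Definition Z2 (R : realType) : bpoly R := 'X.

Definition bcoef {R : realType} (f : bpoly R) (i j : nat) : R[i] := f`_j`_i.

Definition bsubst {R : realType} (f : bpoly R) (u v : bpoly R) : bpoly R :=
  \sum_(j < size f) \sum_(i < size f`_j) cC (f`_j`_i) * u ^+ i * v ^+ j.

Definition bdvd {R : realType} (g f : bpoly R) : Prop := exists h, f = g * h.

Definition lform {R : realType} (a : R[i]) : bpoly R :=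
  - (cC (csin a) * Z1 R) + cC (ccos a) * Z2 R.

(* s_alpha : the involution f |-> f o s_alpha of R, where s_alpha is the   *)
(* reflection of C^2 fixing the line {l_alpha = 0}:                        *)
(* s_alpha(z1,z2) = (cos 2a z1 + sin 2a z2, sin 2a z1 - cos 2a z2).        *)
Definition srefl {R : realType} (a : R[i]) (f : bpoly R) : bpoly R :=
  bsubst f (cC (ccos (2 * a)) * Z1 R + cC (csin (2 * a)) * Z2 R)
           (cC (csin (2 * a)) * Z1 R - cC (ccos (2 * a)) * Z2 R).

Definition inA {R : realType} (Pi : seq R[i]) (mu : R[i] -> nat) (f : bpoly R) : Prop :=
  forall a, a \in Pi -> bdvd (lform a ^+ (2 * mu a).+1) (f - srefl a f).

Definition line_arrangement {R : realType} (Pi : seq R[i]) : Prop :=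
  uniq Pi /\
  forall a b, a \in Pi -> b \in Pi -> a != b ->
    forall k : int, a - b != ((pi : R) * k%:~R)%:C.

Definition baker_akhieser {R : realType} (Pi : seq R[i]) (mu : R[i] -> nat) : Prop :=
  forall a, a \in Pi -> forall k : nat, (1 <= k <= mu a)%N ->
    \sum_(b <- Pi | b != a)
        (mu b)%:R * (ee b + ee a) ^+ (2 * k - 1) / (ee b - ee a) ^+ (2 * k - 1) = 0
    /\
    \sum_(b <- Pi | b != a)
        (mu b * (mu b).+1)%:R * ee b * (ee b + ee a) ^+ (2 * k - 1)
          / (ee b - ee a) ^+ (2 * k + 1) = 0.

(* Formal power series in two variables over a ring K:                 *)
(* F i j is the coefficient of t1^i t2^j.  They are used as Taylor      *)
(* series (at the origin) of analytic functions.                        *)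

Definition fps (K : Type) := nat -> nat -> K.

Definition fps_c {K : nzRingType} (c : K) : fps K :=
  fun i j => if (i == 0%N) && (j == 0%N) then c else 0.
Definition fps_X1 {K : nzRingType} : fps K :=
  fun i j => if (i == 1%N) && (j == 0%N) then 1 else 0.
Definition fps_X2 {K : nzRingType} : fps K :=
  fun i j => if (i == 0%N) && (j == 1%N) then 1 else 0.
Definition fps_add {K : nzRingType} (f g : fps K) : fps K := fun i j => f i j + g i j.
Definition fps_opp {K : nzRingType} (f : fps K) : fps K := fun i j => - f i j.
Definition fps_scal {K : nzRingType} (c : K) (f : fps K) : fps K := fun i j => c * f i j.
Definition fps_mul {K : nzRingType} (f g : fps K) : fps K :=
  fun i j => \sum_(a < i.+1) \sum_(b < j.+1) f a b * g (i - a)%N (j - b)%N.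
Definition fps_pow {K : nzRingType} (f : fps K) (n : nat) : fps K :=
  iter n (fps_mul f) (fps_c 1).
Definition fps_d1 {K : nzRingType} (f : fps K) : fps K := fun i j => f i.+1 j *+ i.+1.
Definition fps_d2 {K : nzRingType} (f : fps K) : fps K := fun i j => f i j.+1 *+ j.+1.

(* multiplicative inverse of a series with invertible constant term c:  *)
(* 1/(c + u) = sum_n (-u)^n / c^(n+1)  (u without constant term)        *)
Definition fps_inv {K : fieldType} (f : fps K) : fps K :=
  fun i j => \sum_(n < (i + j).+1)
     fps_pow (fps_opp (fps_add f (fps_c (- f 0%N 0%N)))) n i j / (f 0%N 0%N) ^+ n.+1.

Definition fps_exp {K : fieldType} (a b : K) : fps K :=
  fun i j => a ^+ i * b ^+ j / (i`! * j`!)%:R.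

Definition fps_of_bpoly {R : realType} (f : bpoly R) : fps R[i] := bcoef f.

Definition fps_embed {R : realType} (f : fps R[i]) : fps (bpoly R) :=
  fun i j => cC (f i j).

(* Quasi-invariance.  For g analytic in (z1,z2) (given by its Taylor     *)
(* series), d/dphi of g(rho cos phi, rho sin phi) is (D g)(rho cos phi,  *)
(* rho sin phi) with D = z1 d/dz2 - z2 d/dz1.  Hence g^(k)_alpha = 0     *)
(* (as a function of rho) iff every Taylor coefficient in rho of         *)
(* (D^k g)(rho cos alpha, rho sin alpha) vanishes.                       *)

Definition fps_ang {K : nzRingType} (g : fps K) : fps K :=
  fps_add (fps_mul fps_X1 (fps_d2 g)) (fps_opp (fps_mul fps_X2 (fps_d1 g))).

Definition phi_deriv_vanishes {R : realType} (g : fps R[i]) (k : nat) (a : R[i]) : Prop :=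
  forall n : nat,
    \sum_(i < n.+1) iter k fps_ang g i (n - i)%N * ccos a ^+ i * csin a ^+ (n - i) = 0.

Definition quasi_invariant {R : realType} (Pi : seq R[i]) (mu : R[i] -> nat)
    (g : fps R[i]) : Prop :=
  forall a, a \in Pi -> forall l : nat, (1 <= l <= mu a)%N ->
    phi_deriv_vanishes g (2 * l - 1) a.

Definition Pmod {R : realType} (Pi : seq R[i]) (mu : R[i] -> nat) (xi1 xi2 : R[i])
    (f : bpoly R) : Prop :=
  quasi_invariant Pi mu (fps_mul (fps_exp (- xi1) (- xi2)) (fps_of_bpoly f)).

(* The Baker--Akhieser function Psi and the spectral module W.          *)
(* Psi is analytic in x near x = 0 (as l_alpha(-xi) <> 0); we work with *)
(* its Taylor series in x = (x1,x2) at 0, with coefficients in R.        *)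

(* Taylor series in x of l_alpha(x - xi) = -sin a (x1 - xi1) + cos a (x2 - xi2) *)
Definition lin_shift {R : realType} (a xi1 xi2 : R[i]) : fps R[i] :=
  fps_add (fps_c (csin a * xi1 - ccos a * xi2))
    (fps_add (fps_scal (- csin a) fps_X1) (fps_scal (ccos a) fps_X2)).

Definition delta_ser {R : realType} (Pi : seq R[i]) (mu : R[i] -> nat) (xi1 xi2 : R[i])
  : fps R[i] :=
  foldr (fun a acc => fps_mul (fps_pow (lin_shift a xi1 xi2) (mu a)) acc) (fps_c 1) Pi.

Definition pot_ser {R : realType} (Pi : seq R[i]) (mu : R[i] -> nat) (xi1 xi2 : R[i])
  : fps R[i] :=
  foldr (fun a acc =>
           fps_add (fps_scal (mu a * (mu a).+1)%:R
                       (fps_pow (fps_inv (lin_shift a xi1 xi2)) 2)) acc)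
        (fun _ _ => 0) Pi.

Definition exp_xz (R : realType) : fps (bpoly R) :=
  fun i j => cC ((i`! * j`!)%:R^-1) * Z1 R ^+ i * Z2 R ^+ j.

Definition Hop {R : realType} (Pi : seq R[i]) (mu : R[i] -> nat) (xi1 xi2 : R[i])
    (F : fps (bpoly R)) : fps (bpoly R) :=
  fps_add (fps_add (fps_d1 (fps_d1 F)) (fps_d2 (fps_d2 F)))
    (fps_opp (fps_add (fps_mul (fps_embed (pot_ser Pi mu xi1 xi2)) F)
                      (fps_scal (Z1 R ^+ 2 + Z2 R ^+ 2) F))).

Definition mu_tot {R : realType} (Pi : seq R[i]) (mu : R[i] -> nat) : nat :=
  (\sum_(a <- Pi) mu a)%N.

Definition Psi_ser {R : realType} (Pi : seq R[i]) (mu : R[i] -> nat) (xi1 xi2 : R[i])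
  : fps (bpoly R) :=
  fps_scal (cC ((2 ^ mu_tot Pi mu * (mu_tot Pi mu)`!)%:R^-1))
    (iter (mu_tot Pi mu) (Hop Pi mu xi1 xi2)
       (fps_mul (fps_embed (delta_ser Pi mu xi1 xi2)) (exp_xz R))).

Definition wgen {R : realType} (Pi : seq R[i]) (mu : R[i] -> nat) (xi1 xi2 : R[i])
    (p1 p2 : nat) : bpoly R :=
  iter p1 fps_d1 (iter p2 fps_d2 (Psi_ser Pi mu xi1 xi2)) 0%N 0%N.

Definition inW {R : realType} (Pi : seq R[i]) (mu : R[i] -> nat) (xi1 xi2 : R[i])
    (f : bpoly R) : Prop :=
  exists s : seq ((nat * nat) * R[i]),
    f = \sum_(t <- s) cC t.2 * wgen Pi mu xi1 xi2 t.1.1 t.1.2.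

Definition A_submodule {R : realType} (A M : bpoly R -> Prop) : Prop :=
  M 0 /\ (forall f g, M f -> M g -> M (f + g)) /\ (forall a f, A a -> M f -> M (a * f)).

Definition A_iso {R : realType} (A M N : bpoly R -> Prop) : Prop :=
  exists phi : bpoly R -> bpoly R,
    (forall f, M f -> N (phi f)) /\
    (forall f g, M f -> M g -> phi (f + g) = phi f + phi g) /\
    (forall a f, A a -> M f -> phi (a * f) = a * phi f) /\
    (forall f g, M f -> M g -> phi f = phi g -> f = g) /\
    (forall g, N g -> exists2 f, M f & phi f = g).

Definition free_elt {R : realType} (A : bpoly R -> Prop) (s : nat -> bpoly R) : Prop :=
  (forall k, A (s k)) /\ exists N, forall k, (N <= k)%N -> s k = 0.

Definition A_projective {R : realType} (A M : bpoly R -> Prop) : Prop :=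
  exists (i : bpoly R -> nat -> bpoly R) (p : (nat -> bpoly R) -> bpoly R),
    (forall f, M f -> free_elt A (i f)) /\
    (forall f g, M f -> M g -> i (f + g) = (fun k => i f k + i g k)) /\
    (forall a f, A a -> M f -> i (a * f) = (fun k => a * i f k)) /\
    (forall s, free_elt A s -> M (p s)) /\
    (forall s t, free_elt A s -> free_elt A t -> p (fun k => s k + t k) = p s + p t) /\
    (forall a s, A a -> free_elt A s -> p (fun k => a * s k) = a * p s) /\
    (forall f, M f -> p (i f) = f).

(* Main.v *)
(** In the rotated coordinates where [l_alpha] is [t], a polynomial [p] satisfies the quasi-invariance
    condition at [alpha] for the weight [exp (e.x)] iff the coefficients of [t^j] in [p exp (e.x)]
    vanish for odd [j < 2 mu_alpha].  By the first Baker-Akhieser identity, conjugating [H - z.z] by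
    [exp (x.z) / delta (x)] gives an operator which preserves this condition (for [e = z]).  Iterating it
    [mu] times on [delta^2] yields, up to a factor, [Phi (x, z) = delta (x) delta (z) + lower terms],
    and [Psi = Phi (x - xi, z) exp (x.z) / delta (x - xi)].  A polynomial of degree less than [mu] in [x]
    which is quasi-invariant, or killed by the operator, is zero; this forces the operator to kill [Phi]
    and, through an sl_2 argument, [Phi] to be symmetric in [x] and [z].  Symmetry turns
    quasi-invariance in [x] into quasi-invariance in [z], so that [W] is contained in [P (- xi.z)].  The
    leading term of [w_(p1,p2)] in [z] is a multiple of [delta (z) z1^p1 z2^p2], while [delta] divides
    the leading term of every element of [P (- xi.z)]; descending on the degree, [W = P (- xi.z)].

    For projectivity it is enough that [1] is a sum of products [f_k g_k] with [f_k] in [P (- xi.z)] and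
    [g_k] in [P (xi.z)], for then the [f_k] and the multiplications by the [g_k] form a dual basis.  Such a sum
    is assembled from elements supported near one line, [e_alpha exp (+- xi.z)] truncated
    transversally to that line, from an element with value 1 at the origin, and from the ideal generated by
    [prod l_alpha^(2 mu_alpha + 1)], which is contained in every module involved. *)

Require Import Defs.
From HB Require Import structures.
From mathcomp Require Import all_boot all_order all_algebra.
From mathcomp Require Import all_classical all_reals all_analysis.
From mathcomp Require Import complex.
From mathcomp Require Import ring lra zify.
Set Implicit Arguments.
Unset Strict Implicit.
Unset Printing Implicit Defensive.
Import Order.TTheory GRing.Theory Num.Theory.
Local Open Scope ring_scope.

(** * Double power series *)

(** The theory of quasi-invariants is used twice: with the generic weight [e = z], over the ring of
    polynomials in [z], to construct the Baker-Akhieser polynomial, and over the base field with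
    weight [- xi], to compare [W] with its target. It is therefore developed over a commutative
    ring: inverses of integers are data ([nv]), and nonvanishing becomes regularity. The multiplier
    [co a * e2 - si a * e1] is [l_a (e)]: the linear form in [z] in the first use, [- l_a (xi)] in
    the second, nonzero by the hypothesis on [xi].

    The delicate point is the symmetry of [Phi]. The uniqueness argument works only in [x]-degree
    less than [mu], while the operator with [x] and [z] exchanged raises the [x]-degree by one. So
    the two highest layers of [Phi] must be known exactly: the top one is [delta (x) delta (z)], and
    the next is forced by the equation in [x] to be an explicit expression that is symmetric in [x]
    and [z]. On these two layers the exchanged equation can then be verified directly. *)

(* [sc f i j] is the coefficient of [x1^i x2^j]; in [{poly {poly K}}] it is [p`_j`_i]. *)
Record ser (K : Type) := Ser { sc :> nat -> nat -> K }.

Lemma serP (K : Type) (f g : ser K) : (forall i j, f i j = g i j) -> f = g.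
Proof.
case: f g => [f] [g] /= fg; congr Ser.
by apply/funext => i; apply/funext => j.
Qed.

HB.instance Definition _ (K : Type) := gen_eqMixin (ser K).
HB.instance Definition _ (K : Type) := gen_choiceMixin (ser K).

Section SerRing.
Variable K : comNzRingType.
Implicit Types f g h : ser K.

Definition ser_tr n (f : fps K) : {poly {poly K}} := \poly_(j < n) \poly_(i < n) f i j.

Lemma coef_ser_tr n f a b : (a < n)%N -> (b < n)%N -> (ser_tr n f)`_b`_a = f a b.
Proof. by move=> an bn; rewrite coef_poly bn coef_poly an. Qed.

(** A coefficient of a product involves only smaller indices, so [F] and [G] need only agree with
    the series up to there. Ring laws and Leibniz rules for series are inherited from polynomials in
    this way. *)
Lemma fps_mul_poly (f g : fps K) (F G : {poly {poly K}}) i j :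
  (forall a b, (a <= i)%N -> (b <= j)%N -> F`_b`_a = f a b) ->
  (forall a b, (a <= i)%N -> (b <= j)%N -> G`_b`_a = g a b) ->
  fps_mul f g i j = (F * G)`_j`_i.
Proof.
move=> Ff Gg; rewrite coefM coef_sum /fps_mul exchange_big /=.
apply: eq_bigr => b _; rewrite coefM; apply: eq_bigr => a _.
by rewrite Ff ?Gg ?leq_subr ?leq_ord.
Qed.

Lemma fps_mul_tr n (f g : fps K) i j : (i < n)%N -> (j < n)%N ->
  fps_mul f g i j = (ser_tr n f * ser_tr n g)`_j`_i.
Proof.
move=> ni nj; apply: fps_mul_poly => a b ai bj.
  by rewrite (coef_ser_tr (Ser f)) ?(leq_ltn_trans ai) ?(leq_ltn_trans bj).
by rewrite (coef_ser_tr (Ser g)) ?(leq_ltn_trans ai) ?(leq_ltn_trans bj).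
Qed.

Definition ser_add f g := Ser (fps_add f g).
Definition ser_opp f := Ser (fps_opp f).
Definition ser_mul f g := Ser (fps_mul f g).
Definition ser0 : ser K := Ser (fun _ _ => 0).
Definition ser1 : ser K := Ser (fps_c 1).

Fact ser_addA : associative ser_add.
Proof. by move=> f g h; apply: serP => i j; rewrite /= /fps_add addrA. Qed.
Fact ser_addC : commutative ser_add.
Proof. by move=> f g; apply: serP => i j; rewrite /= /fps_add addrC. Qed.
Fact ser_add0 : left_id ser0 ser_add.
Proof. by move=> f; apply: serP => i j; rewrite /= /fps_add add0r. Qed.
Fact ser_addN : left_inverse ser0 ser_opp ser_add.
Proof. by move=> f; apply: serP => i j; rewrite /= /fps_add addNr. Qed.
HB.instance Definition _ := GRing.isZmodule.Build (ser K) ser_addA ser_addC ser_add0 ser_addN.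

Fact ser_mulA : associative ser_mul.
Proof.
move=> f g h; apply: serP => i j /=; set n := (i + j).+1.
have [ni nj] : (i < n)%N /\ (j < n)%N by rewrite /n; lia.
rewrite (@fps_mul_poly f (fps_mul g h) (ser_tr n f) (ser_tr n g * ser_tr n h)); first last.
- by move=> a b ai bj; rewrite -fps_mul_tr //; lia.
- by move=> a b ai bj; rewrite coef_ser_tr //; lia.
rewrite (@fps_mul_poly (fps_mul f g) h (ser_tr n f * ser_tr n g) (ser_tr n h)) ?mulrA //.
- by move=> a b ai bj; rewrite -fps_mul_tr //; lia.
- by move=> a b ai bj; rewrite coef_ser_tr //; lia.
Qed.
Fact ser_mulC : commutative ser_mul.
Proof.
move=> f g; apply: serP => i j /=; set n := (i + j).+1.
have [ni nj] : (i < n)%N /\ (j < n)%N by rewrite /n; lia.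
by rewrite !(@fps_mul_tr n) // mulrC.
Qed.
Fact ser_mulDl : left_distributive ser_mul ser_add.
Proof.
move=> f g h; apply: serP => i j /=; rewrite /fps_add /fps_mul -big_split /=.
apply: eq_bigr => a _; rewrite -big_split /=; apply: eq_bigr => b _.
by rewrite mulrDl.
Qed.
Fact ser_mul1 : left_id ser1 ser_mul.
Proof.
move=> f; apply: serP => i j /=.
rewrite /fps_mul big_ord_recl big_ord_recl /= /fps_c /= mul1r !subn0.
rewrite big1 ?addr0; last by move=> b _; rewrite mul0r.
rewrite big1 ?addr0 // => a _; rewrite big1 // => b _; by rewrite mul0r.
Qed.
Fact ser_oner_neq0 : ser1 != ser0.
Proof.
apply/eqP => e; have := congr1 (fun f : ser K => f 0%N 0%N) e.
by move/eqP; rewrite /= /fps_c /= oner_eq0.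
Qed.
HB.instance Definition _ := GRing.Zmodule_isComNzRing.Build (ser K)
  ser_mulA ser_mulC ser_mul1 ser_mulDl ser_oner_neq0.

Lemma scD f g i j : (f + g) i j = f i j + g i j. Proof. by []. Qed.
Lemma scN f i j : (- f) i j = - f i j. Proof. by []. Qed.
Lemma scB f g i j : (f - g) i j = f i j - g i j. Proof. by []. Qed.
Lemma sc0 i j : (0 : ser K) i j = 0. Proof. by []. Qed.
Lemma scM f g i j :
  (f * g) i j = \sum_(a < i.+1) \sum_(b < j.+1) f a b * g (i - a)%N (j - b)%N.
Proof. by []. Qed.
Lemma scMn f n i j : (f *+ n) i j = f i j *+ n.
Proof. by elim: n => [|n IH]; rewrite ?mulr0n // !mulrS -IH. Qed.
Lemma sc_sum I (r : seq I) P (F : I -> ser K) i j :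
  (\sum_(k <- r | P k) F k) i j = \sum_(k <- r | P k) F k i j.
Proof. by elim/big_rec2: _ => //= k x y Pk <-. Qed.

Lemma scM_poly f g (F G : {poly {poly K}}) i j :
  (forall a b, (a <= i)%N -> (b <= j)%N -> F`_b`_a = f a b) ->
  (forall a b, (a <= i)%N -> (b <= j)%N -> G`_b`_a = g a b) ->
  (f * g) i j = (F * G)`_j`_i.
Proof. exact: fps_mul_poly. Qed.

Definition pin (p : {poly {poly K}}) : ser K := Ser (fun i j => p`_j`_i).

Fact pin_is_additive : zmod_morphism pin.
Proof. by move=> p q; apply: serP => i j; rewrite scB /= !coefB. Qed.
Fact pin_is_multiplicative : monoid_morphism pin.
Proof.
split; last by move=> p q; apply: serP => i j; rewrite (@scM_poly _ _ p q).
by apply: serP => i j; rewrite /= /fps_c coef1; case: j => [|j]; rewrite ?coef1 ?coef0 ?andbF ?andbT //; case: i.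
Qed.
HB.instance Definition _ := GRing.isZmodMorphism.Build _ _ pin pin_is_additive.
HB.instance Definition _ := GRing.isMonoidMorphism.Build _ _ pin pin_is_multiplicative.

Lemma pin_inj : injective pin.
Proof.
move=> p q e; apply/polyP => j; apply/polyP => i.
exact: (congr1 (fun f : ser K => f i j) e).
Qed.

Definition Y1 : ser K := Ser fps_X1.
Definition Y2 : ser K := Ser fps_X2.
Definition kc (c : K) : ser K := Ser (fps_c c).

Fact kc_is_additive : zmod_morphism kc.
Proof.
by move=> p q; apply: serP => i j; rewrite scB /= /fps_c; case: ifP => // _; rewrite subr0.
Qed.
Lemma scCM c f i j : (kc c * f) i j = c * f i j.
Proof.
rewrite scM big_ord_recl big_ord_recl /= /fps_c /= !subn0.
rewrite big1 ?addr0; last by move=> b _; rewrite mul0r.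
rewrite big1 ?addr0 // => a _; rewrite big1 // => b _; by rewrite mul0r.
Qed.
Fact kc_is_multiplicative : monoid_morphism kc.
Proof.
split=> // p q; apply: serP => i j; rewrite scCM /= /fps_c.
by case: ifP => // _; rewrite mulr0.
Qed.
HB.instance Definition _ := GRing.isZmodMorphism.Build _ _ kc kc_is_additive.
HB.instance Definition _ := GRing.isMonoidMorphism.Build _ _ kc kc_is_multiplicative.

Lemma pinC (c : K) : pin c%:P%:P = kc c.
Proof.
apply: serP => i j; rewrite /= /fps_c coefC; case: j => [|j]; last by rewrite coef0 andbF.
by rewrite andbT coefC.
Qed.
Lemma pinX1 : pin ('X)%:P = Y1.
Proof.
apply: serP => i j; rewrite /= /fps_X1 coefC; case: j => [|j] /=; last by rewrite coef0 andbF.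
by rewrite andbT coefX; case: eqP.
Qed.
Lemma pinX2 : pin 'X = Y2.
Proof.
apply: serP => i j; rewrite /= /fps_X2 coefX; case: (j == 1%N); last by rewrite coef0 andbF.
by rewrite andbT coef1; case: eqP.
Qed.

Lemma scY1M f i j : (Y1 * f) i j = if i is i'.+1 then f i' j else 0.
Proof.
rewrite scM; case: i => [|i].
  by rewrite big1 // => a _; rewrite big1 // => b _; rewrite /= /fps_X1 (ord1 a) /= mul0r.
rewrite big_ord_recl big1 ?add0r; last by move=> b _; rewrite /= /fps_X1 mul0r.
rewrite big_ord_recl big_ord_recl /= /fps_X1 /= mul1r subSS !subn0.
rewrite big1 ?addr0; last by move=> b _; rewrite mul0r.
rewrite big1 ?addr0 // => a _; rewrite big1 // => b _; by rewrite mul0r.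
Qed.
Lemma scY2M f i j : (Y2 * f) i j = if j is j'.+1 then f i j' else 0.
Proof.
rewrite scM big_ord_recl [X in _ + X]big1 ?addr0; last first.
  by move=> a _; rewrite big1 // => b _; rewrite /= /fps_X2 /= mul0r.
case: j => [|j]; first by rewrite big_ord_recl big_ord0 /= /fps_X2 /= mul0r addr0.
rewrite big_ord_recl big_ord_recl /= /fps_X2 /= mul0r add0r mul1r subSS !subn0.
by rewrite big1 ?addr0 // => b _; rewrite mul0r.
Qed.

Definition d1 f : ser K := Ser (fps_d1 f).
Definition d2 f : ser K := Ser (fps_d2 f).

Fact d1_is_additive : zmod_morphism d1.
Proof. by move=> f g; apply: serP => i j; exact: mulrnBl. Qed.
Fact d2_is_additive : zmod_morphism d2.
Proof. by move=> f g; apply: serP => i j; exact: mulrnBl. Qed.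
HB.instance Definition _ := GRing.isZmodMorphism.Build _ _ d1 d1_is_additive.
HB.instance Definition _ := GRing.isZmodMorphism.Build _ _ d2 d2_is_additive.

Lemma d2M f g : d2 (f * g) = d2 f * g + f * d2 g.
Proof.
apply: serP => i j; rewrite scD -[LHS]/((f * g) i j.+1 *+ j.+1).
set n := (i + j).+2; pose F := ser_tr n f; pose G := ser_tr n g.
have FE a b : (a < n)%N -> (b < n)%N -> F`_b`_a = f a b by apply: coef_ser_tr.
have GE a b : (a < n)%N -> (b < n)%N -> G`_b`_a = g a b by apply: coef_ser_tr.
rewrite (@scM_poly f g F G) => [||]; try by move=> a b ai bj; rewrite ?FE ?GE //; lia.
rewrite (@scM_poly (d2 f) g F^`() G); first last.
- by move=> a b ai bj; rewrite GE //; lia.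
- by move=> a b ai bj; rewrite coef_deriv coefMn FE //; lia.
rewrite (@scM_poly f (d2 g) F G^`()); first last.
- by move=> a b ai bj; rewrite coef_deriv coefMn GE //; lia.
- by move=> a b ai bj; rewrite FE //; lia.
by rewrite -coefD -coefD -derivM coef_deriv coefMn.
Qed.

Lemma d1M f g : d1 (f * g) = d1 f * g + f * d1 g.
Proof.
apply: serP => i j; rewrite scD -[LHS]/((f * g) i.+1 j *+ i.+1).
set n := (i + j).+2; pose F := ser_tr n f; pose G := ser_tr n g.
have FE a b : (a < n)%N -> (b < n)%N -> F`_b`_a = f a b by apply: coef_ser_tr.
have GE a b : (a < n)%N -> (b < n)%N -> G`_b`_a = g a b by apply: coef_ser_tr.
have cd (p : {poly {poly K}}) b : (map_poly deriv p)`_b = (p`_b)^`() by rewrite coef_map.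
rewrite (@scM_poly f g F G) => [||]; try by move=> a b ai bj; rewrite ?FE ?GE //; lia.
rewrite (@scM_poly (d1 f) g (map_poly deriv F) G); first last.
- by move=> a b ai bj; rewrite GE //; lia.
- by move=> a b ai bj; rewrite cd coef_deriv FE //; lia.
rewrite (@scM_poly f (d1 g) F (map_poly deriv G)); first last.
- by move=> a b ai bj; rewrite cd coef_deriv GE //; lia.
- by move=> a b ai bj; rewrite FE //; lia.
rewrite -coefD !coefM -big_split /= -coef_deriv raddf_sum; congr ((polyseq _)`_i).
by apply: eq_bigr => b _; rewrite /= derivM !cd.
Qed.

Lemma d1d2 f : d1 (d2 f) = d2 (d1 f).
Proof. by apply: serP => i j; rewrite /= /fps_d1 /fps_d2 /= -!mulrnA mulnC. Qed.
Lemma d1C c : d1 (kc c) = 0.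
Proof. by apply: serP => i j; rewrite /= /fps_d1 /= mul0rn. Qed.
Lemma d2C c : d2 (kc c) = 0.
Proof. by apply: serP => i j; rewrite /= /fps_d2 /fps_c andbF mul0rn. Qed.
Lemma d1Y1 : d1 Y1 = 1.
Proof. by apply: serP => -[|i] [|j]; rewrite /= /fps_d1 /fps_X1 /fps_c /= ?mul0rn. Qed.
Lemma d2Y2 : d2 Y2 = 1.
Proof. by apply: serP => -[|i] [|j]; rewrite /= /fps_d2 /fps_X2 /fps_c /= ?andbF ?mulr1n ?mul0rn. Qed.
Lemma d1Y2 : d1 Y2 = 0.
Proof. by apply: serP => -[|i] [|j]; rewrite /= /fps_d1 /fps_X2 /fps_c /= ?andbF ?mulr1n ?mul0rn. Qed.
Lemma d2Y1 : d2 Y1 = 0.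
Proof. by apply: serP => -[|i] [|j]; rewrite /= /fps_d2 /fps_X1 /fps_c /= ?andbF ?mulr1n ?mul0rn. Qed.

Lemma scX f n : Ser (fps_pow f n) = f ^+ n.
Proof. by elim: n => [|n IH] //; rewrite exprS -IH. Qed.
End SerRing.

(** * Polynomials in two variables: derivatives and substitution *)

Section BPoly.
Variable K : comNzRingType.
Local Notation B := {poly {poly K}}.
Implicit Types p q : B.

Definition pX1 : B := ('X)%:P.
Definition pX2 : B := 'X.
Definition pc (c : K) : B := c%:P%:P.
HB.instance Definition _ := GRing.RMorphism.copy pc ((@polyC {poly K}) \o (@polyC K)).

Lemma bpoly_ind (P : B -> Prop) :
  (forall c, P (pc c)) -> (forall p q, P p -> P q -> P (p + q)) ->
  (forall p, P p -> P (pX1 * p)) -> (forall p, P p -> P (pX2 * p)) -> forall p, P p.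
Proof.
move=> Pc PD P1 P2; elim/poly_ind => [|p c Pp]; first exact: (Pc 0).
apply: (PD (p * _)); first by rewrite mulrC; apply: P2.
elim/poly_ind: c {Pp} => [|c d Pcc]; first exact: (Pc 0).
rewrite polyCD; apply: (PD (c * 'X)%:P); last exact: Pc.
by rewrite polyCM mulrC; apply: P1.
Qed.

Lemma pinD p q : pin (p + q) = pin p + pin q. Proof. exact: rmorphD. Qed.
Lemma pinB p q : pin (p - q) = pin p - pin q.
Proof. by apply: serP => i j; rewrite scB /= !coefB. Qed.
Lemma pinM p q : pin (p * q) = pin p * pin q. Proof. exact: rmorphM. Qed.
Lemma pin0 : pin (0 : B) = 0. Proof. exact: rmorph0. Qed.
Lemma pin1 : pin (1 : B) = 1. Proof. exact: rmorph1. Qed.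

Definition pder1 p : B := map_poly deriv p.
Definition pder2 p : B := p^`().

Lemma pin_pder1 p : pin (pder1 p) = d1 (pin p).
Proof. by apply: serP => i j; rewrite /= coef_map /= coef_deriv. Qed.
Lemma pin_pder2 p : pin (pder2 p) = d2 (pin p).
Proof. by apply: serP => i j; rewrite /= coef_deriv coefMn. Qed.

Fact pder1_is_additive : zmod_morphism pder1.
Proof. by move=> p q; apply/polyP => j; rewrite coefB !coef_map /= coefB derivB. Qed.
Fact pder2_is_additive : zmod_morphism pder2.
Proof. by move=> p q; rewrite /pder2 derivB. Qed.
HB.instance Definition _ := GRing.isZmodMorphism.Build _ _ pder1 pder1_is_additive.
HB.instance Definition _ := GRing.isZmodMorphism.Build _ _ pder2 pder2_is_additive.

Lemma pder1D p q : pder1 (p + q) = pder1 p + pder1 q. Proof. exact: raddfD. Qed.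
Lemma pder2D p q : pder2 (p + q) = pder2 p + pder2 q. Proof. exact: raddfD. Qed.
Lemma pder1B p q : pder1 (p - q) = pder1 p - pder1 q. Proof. exact: raddfB. Qed.
Lemma pder2B p q : pder2 (p - q) = pder2 p - pder2 q. Proof. exact: raddfB. Qed.
Lemma pder10 : pder1 0 = 0. Proof. exact: raddf0. Qed.
Lemma pder20 : pder2 0 = 0. Proof. exact: raddf0. Qed.
Lemma pder1M p q : pder1 (p * q) = pder1 p * q + p * pder1 q.
Proof. by apply: pin_inj; rewrite pinD pin_pder1 !pinM !pin_pder1 d1M. Qed.
Lemma pder2M p q : pder2 (p * q) = pder2 p * q + p * pder2 q.
Proof. by apply: pin_inj; rewrite pinD pin_pder2 !pinM !pin_pder2 d2M. Qed.
Lemma pder12 p : pder1 (pder2 p) = pder2 (pder1 p).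
Proof. by apply: pin_inj; rewrite !(pin_pder1, pin_pder2) d1d2. Qed.
Lemma pder1C c : pder1 (pc c) = 0.
Proof. by apply: pin_inj; rewrite pin_pder1 pinC d1C pin0. Qed.
Lemma pder2C c : pder2 (pc c) = 0.
Proof. by apply: pin_inj; rewrite pin_pder2 pinC d2C pin0. Qed.
Lemma pder1X1 : pder1 pX1 = 1.
Proof. by apply: pin_inj; rewrite pin_pder1 pinX1 d1Y1 pin1. Qed.
Lemma pder1X2 : pder1 pX2 = 0.
Proof. by apply: pin_inj; rewrite pin_pder1 pinX2 d1Y2 pin0. Qed.
Lemma pder2X1 : pder2 pX1 = 0.
Proof. by apply: pin_inj; rewrite pin_pder2 pinX1 d2Y1 pin0. Qed.
Lemma pder2X2 : pder2 pX2 = 1.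
Proof. by apply: pin_inj; rewrite pin_pder2 pinX2 d2Y2 pin1. Qed.

Lemma bcoefD p q i j : (p + q)`_j`_i = p`_j`_i + q`_j`_i.
Proof. by rewrite !coefD. Qed.
Lemma bcoefN p i j : (- p)`_j`_i = - p`_j`_i.
Proof. by rewrite !coefN. Qed.
Lemma bcoefB p q i j : (p - q)`_j`_i = p`_j`_i - q`_j`_i.
Proof. by rewrite !coefB. Qed.
Lemma bcoefCM c p i j : (pc c * p)`_j`_i = c * p`_j`_i.
Proof. by rewrite !coefCM. Qed.
Lemma bcoef1 p i j : (pder1 p)`_j`_i = p`_j`_i.+1 *+ i.+1.
Proof. by rewrite coef_map /= coef_deriv. Qed.
Lemma bcoef2 p i j : (pder2 p)`_j`_i = p`_j.+1`_i *+ j.+1.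
Proof. by rewrite coef_deriv coefMn. Qed.
Lemma bcoefX1M p i j : (pX1 * p)`_j`_i = if i is i'.+1 then p`_j`_i' else 0.
Proof. by rewrite coefCM coefXM; case: i. Qed.
Lemma bcoefX2M p i j : (pX2 * p)`_j`_i = if j is j'.+1 then p`_j'`_i else 0.
Proof. by rewrite coefXM; case: j => //=; rewrite coef0. Qed.
Lemma bpolyP p q : (forall i j, p`_j`_i = q`_j`_i) -> p = q.
Proof. by move=> e; apply/polyP => j; apply/polyP => i. Qed.

Variables (S : comNzRingType) (phi : {rmorphism K -> S}).
Definition bev (u v : S) p : S := (map_poly (horner_eval u \o map_poly phi) p).[v].
HB.instance Definition _ u v := GRing.RMorphism.copy (bev u v)
  (horner_eval v \o map_poly (horner_eval u \o map_poly phi)).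

Lemma bevC u v c : bev u v (pc c) = phi c.
Proof. by rewrite /bev /pc map_polyC hornerC /= map_polyC horner_evalE hornerC. Qed.
Lemma bevX1 u v : bev u v pX1 = u.
Proof. by rewrite /bev /pX1 map_polyC hornerC /= map_polyX horner_evalE hornerX. Qed.
Lemma bevX2 u v : bev u v pX2 = v.
Proof. by rewrite /bev /pX2 map_polyX hornerX. Qed.
Lemma bevE u v p :
  bev u v p = \sum_(j < size p) \sum_(i < size p`_j) phi p`_j`_i * u ^+ i * v ^+ j.
Proof.
rewrite [in LHS](_ : p = \sum_(j < size p) (\sum_(i < size p`_j) p`_j`_i *: 'X^i)%:P * 'X^j).
  rewrite rmorph_sum /=; apply: eq_bigr => j _.
  rewrite rmorphM rmorphXn /= (bevX2 u v) /bev map_polyC hornerC /= horner_evalE; rewrite -mulr_suml; congr (_ * _).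
  rewrite rmorph_sum horner_sum /=; apply: eq_bigr => i _.
  by rewrite map_polyZ hornerZ rmorphXn /= map_polyX hornerXn.
rewrite -[LHS]coefK poly_def; apply: eq_bigr => j _.
rewrite [RHS]mul_polyC; congr (_ *: _); by rewrite -[LHS]coefK poly_def.
Qed.

Lemma bev_unique (f g : {rmorphism B -> S}) :
  (forall c, f (pc c) = g (pc c)) -> f pX1 = g pX1 -> f pX2 = g pX2 -> f =1 g.
Proof.
move=> ec e1 e2; apply: bpoly_ind => // [p q|p|p]; rewrite ?rmorphD ?rmorphM ?e1 ?e2.
- by move=> -> ->.
- by move=> ->.
- by move=> ->.
Qed.

(** The chain rules below, for rotations, for the exchange of variables and for Taylor expansion,
    are all instances: both sides are derivations along the same morphism [h], so generators
    suffice. *)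
Lemma derivation_unique (h : {rmorphism B -> S}) (D E : B -> S) :
  (forall p q, D (p + q) = D p + D q) -> (forall p q, E (p + q) = E p + E q) ->
  (forall p q, D (p * q) = D p * h q + h p * D q) ->
  (forall p q, E (p * q) = E p * h q + h p * E q) ->
  (forall c, D (pc c) = E (pc c)) -> D pX1 = E pX1 -> D pX2 = E pX2 -> D =1 E.
Proof.
move=> DD ED DM EM ec e1 e2; apply: bpoly_ind => // [p q ep eq|p ep|p ep].
- by rewrite DD ED ep eq.
- by rewrite DM EM ep e1.
- by rewrite DM EM ep e2.
Qed.
End BPoly.

(** * The exponential series *)

Section Exp.
Variable K : comNzRingType.
(* [nv n] plays the role of [1 / (n + 1)], which lets the coefficients be polynomials in [z]. *)
Variable nv : nat -> K.
Hypothesis nvK : forall n, nv n * n.+1%:R = 1.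

(** This is [1 / n!]. *)
Definition fv n := \prod_(i < n) nv i.

Lemma natI n : injective (fun x : K => x *+ n.+1).
Proof.
move=> x y /= e.
by rewrite -[x]mulr1 -[y]mulr1 -(nvK n) ![nv n * _]mulrC !mulrA !mulr_natr e.
Qed.

Definition Eser (a b : K) : ser K :=
  Ser (fun i j => a ^+ i * b ^+ j * (fv i * fv j)).

Lemma fvS n : fv n.+1 *+ n.+1 = fv n.
Proof. by rewrite /fv big_ord_recr /= -mulr_natr -mulrA nvK mulr1. Qed.

Lemma fvE n : fv n *+ n`! = 1.
Proof.
elim: n => [|n IH]; first by rewrite /fv big_ord0.
by rewrite factS mulrnA fvS.
Qed.

Lemma d1E a b : d1 (Eser a b) = kc a * Eser a b.
Proof.
apply: serP => i j; rewrite scCM -[LHS]/(Eser a b i.+1 j *+ i.+1) /=.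
rewrite -mulrnAr -mulrnAl fvS exprS; ring.
Qed.
Lemma d2E a b : d2 (Eser a b) = kc b * Eser a b.
Proof.
apply: serP => i j; rewrite scCM -[LHS]/(Eser a b i j.+1 *+ j.+1) /=.
rewrite -!mulrnAr fvS exprS; ring.
Qed.
Lemma E00 a b : Eser a b 0%N 0%N = 1.
Proof. by rewrite /= /fv !big_ord0 !expr0 !mul1r. Qed.

(** The differential equations are recursions on the coefficients, solvable because multiplication
    by [n + 1] is injective. Multiplicativity of the exponential follows by checking them on a
    product. *)
Lemma Eser_unique a b f : d1 f = kc a * f -> d2 f = kc b * f -> f 0%N 0%N = 1 -> f = Eser a b.
Proof.
move=> f1 f2 f0; apply: serP.
have s1 (g : ser K) i j : d1 g = kc a * g -> g i.+1 j *+ i.+1 = a * g i j.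
  by move=> e; have := congr1 (fun h : ser K => h i j) e; rewrite scCM.
have s2 (g : ser K) i j : d2 g = kc b * g -> g i j.+1 *+ j.+1 = b * g i j.
  by move=> e; have := congr1 (fun h : ser K => h i j) e; rewrite scCM.
elim=> [|i IH] j.
  elim: j => [|j IH]; first by rewrite f0 E00.
  by apply: (@natI j); rewrite /= (s2 _ _ _ f2) (s2 _ _ _ (d2E a b)) IH.
by apply: (@natI i); rewrite /= (s1 _ _ _ f1) (s1 _ _ _ (d1E a b)) IH.
Qed.

Lemma Eser_mul a b a' b' : Eser a b * Eser a' b' = Eser (a + a') (b + b').
Proof.
apply: Eser_unique.
- rewrite d1M !d1E rmorphD; ring.
- rewrite d2M !d2E rmorphD; ring.
- by rewrite scM !big_ord1 !E00 mulr1.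
Qed.

Lemma Eser0 : Eser 0 0 = 1.
Proof.
symmetry; apply: Eser_unique; rewrite ?rmorph0 ?mul0r //.
  by rewrite -(rmorph1 (@kc K)) d1C.
by rewrite -(rmorph1 (@kc K)) d2C.
Qed.

Lemma EserV a b : Eser a b * Eser (- a) (- b) = 1.
Proof. by rewrite Eser_mul !subrr Eser0. Qed.
End Exp.

(** * Parity in the second variable and angular derivatives *)

Section Parity.
Variable K : comNzRingType.
Implicit Types f g : ser K.

Definition vanish (b : bool) n f := forall i j, odd j = b -> (j < n)%N -> f i j = 0.

Lemma vanish0 b n : vanish b n 0. Proof. by []. Qed.
Lemma vanishD b n f g : vanish b n f -> vanish b n g -> vanish b n (f + g).
Proof. by move=> vf vg i j jb jn; rewrite scD vf ?vg ?addr0. Qed.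
Lemma vanishN b n f : vanish b n f -> vanish b n (- f).
Proof. by move=> vf i j jb jn; rewrite scN vf ?oppr0. Qed.
Lemma vanishB b n f g : vanish b n f -> vanish b n g -> vanish b n (f - g).
Proof. by move=> vf vg; apply: vanishD => //; apply: vanishN. Qed.
Lemma vanish_sum b n I (r : seq I) (P : pred I) (F : I -> ser K) :
  (forall k, P k -> vanish b n (F k)) -> vanish b n (\sum_(k <- r | P k) F k).
Proof. by move=> vF; elim/big_rec: _ => // k x Pk; apply: vanishD; apply: vF. Qed.
(** Below [n], [vanish b] says that only columns of parity [~~ b] occur; parities of supports add in
    a product. *)
Lemma vanishM b b' n f g :
  vanish b n f -> vanish b' n g -> vanish (~~ (b (+) b')) n (f * g).
Proof.
move=> vf vg i j jb jn; rewrite scM big1 // => a _; rewrite big1 // => -[k kj] _ /=.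
rewrite ltnS in kj; have [e|] := eqVneq (odd k) b.
  by rewrite vf ?mul0r // (leq_ltn_trans kj).
move=> ne; rewrite [g _ _]vg ?mulr0 ?(leq_ltn_trans (leq_subr _ _)) // oddB // jb.
by move: ne; case: (odd k); case: b {vf jb}; case: b' {vg}.
Qed.
Lemma vanish_kc n c : vanish true n (kc c).
Proof. by move=> i [|j] //; rewrite /= /fps_c andbF. Qed.
Lemma vanishCM b n c f : vanish b n f -> vanish b n (kc c * f).
Proof. by move=> vf i j jb jn; rewrite scCM vf ?mulr0. Qed.
Lemma vanish_Y1M b n f : vanish b n (Y1 K * f) <-> vanish b n f.
Proof.
split=> vf i j jb jn; first by have := vf i.+1 j jb jn; rewrite scY1M.
by rewrite scY1M; case: i => // i; apply: vf.
Qed.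
Lemma vanish_Y1X b n m f : vanish b n (Y1 K ^+ m * f) <-> vanish b n f.
Proof.
by elim: m => [|m IH]; rewrite ?mul1r // exprS -mulrA vanish_Y1M.
Qed.
Lemma vanish_d1 b n f : vanish b n f -> vanish b n (d1 f).
Proof. by move=> vf i j jb jn; rewrite /= /fps_d1 vf ?mul0rn. Qed.
Lemma vanish_d2 b n f : vanish b n.+1 f -> vanish (~~ b) n (d2 f).
Proof. by move=> vf i j jb jn; rewrite /= /fps_d2 vf ?mul0rn //= jb negbK. Qed.
Lemma vanish_leq b n m f : (m <= n)%N -> vanish b n f -> vanish b m f.
Proof. by move=> mn vf i j jb jm; apply: vf => //; apply: leq_trans mn. Qed.

Lemma scY2X n f i j : (Y2 K ^+ n * f) i j = if (j < n)%N then 0 else f i (j - n)%N.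
Proof.
elim: n j => [|n IH] j; first by rewrite mul1r subn0.
by rewrite exprS -mulrA scY2M; case: j => [|j] //; rewrite IH subSS.
Qed.
Lemma vanish_Y2X b n f : vanish b n (Y2 K ^+ n * f).
Proof. by move=> i j _ jn; rewrite scY2X jn. Qed.

Definition ang f := Y1 K * d2 f - Y2 K * d1 f.
Lemma scang f i j :
  ang f i j = (if i is i'.+1 then f i' j.+1 *+ j.+1 else 0)
            - (if j is j'.+1 then f i.+1 j' *+ i.+1 else 0).
Proof. by rewrite scB scY1M scY2M; case: i; case: j. Qed.

Lemma vanish_ang b n f : vanish b n.+1 f -> vanish (~~ b) n (ang f).
Proof.
move=> vf i j jb jn; rewrite scang.
have -> : (if i is i'.+1 then f i' j.+1 *+ j.+1 else 0) = 0.
  by case: i => // i; rewrite vf ?mul0rn //= jb negbK.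
case: j jb jn => [|j] jb jn; rewrite ?subr0 // vf ?mul0rn ?subr0 //; last by lia.
by move: jb => /=; case: b {vf}; case: (odd j).
Qed.

Lemma vanish_iter_ang b n k f : vanish b (n + k) f -> vanish (b (+) odd k) n (iter k ang f).
Proof.
elim: k n => [|k IH] n; first by rewrite addn0 addbF.
rewrite addnS -addSn => /IH /vanish_ang.
by rewrite /= addbN.
Qed.

(** Each [ang] moves column [j + 1] down with factor [j + 1] and column [j - 1] up. Terms involving
    an upward move start from columns below [m] of the parity of [m], where [f] vanishes. Only the
    straight descent from column [m] to 0 survives, with factor [m!]. *)
Lemma iter_ang_lead m f i : vanish (odd m) m f ->
  iter m ang f (i + m)%N 0%N = f i m *+ m`!.
Proof.
move=> vf; suff H k l : (k + l = m)%N -> iter k ang f (i + k)%N l = f i m *+ (m ^_ k).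
  by rewrite -ffactnn -(H m 0%N) ?addn0.
elim: k l => [|k IH] l kl; first by rewrite addn0 ffactn0 mulr1n -kl.
rewrite iterS scang addnS (IH l.+1) ?ffactnSr; last by lia.
have -> : (m - k = l.+1)%N by lia.
case: l kl => [|l] kl; rewrite ?subr0 ?mulrnA //.
have /= -> := @vanish_iter_ang (odd m) (m - k) k f _ (i + k).+2 l; rewrite ?mul0rn ?subr0 //.
- by rewrite subnK //; lia.
- by rewrite -kl addSn /= oddD /=; case: (odd k); case: (odd l).
- by lia.
Qed.
End Parity.

(** * Coordinates adapted to a line *)

Section Frame.
Variable K : comNzRingType.
Local Notation B := {poly {poly K}}.
Local Notation X1 := (pX1 K).
Local Notation X2 := (pX2 K).
Implicit Types (p q : B) (c s : K).

Definition rot c s : B -> B := bev (@pc K) (pc c * X1 - pc s * X2) (pc s * X1 + pc c * X2).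
HB.instance Definition _ c s := GRing.RMorphism.on (rot c s).

Definition lf c s : B := pc c * X2 - pc s * X1.

Lemma rotD c s p q : rot c s (p + q) = rot c s p + rot c s q. Proof. exact: rmorphD. Qed.
Lemma rotN c s p : rot c s (- p) = - rot c s p. Proof. exact: rmorphN. Qed.
Lemma rotB c s p q : rot c s (p - q) = rot c s p - rot c s q.
Proof. by rewrite rotD rotN. Qed.
Lemma rotM c s p q : rot c s (p * q) = rot c s p * rot c s q. Proof. exact: rmorphM. Qed.
Lemma rotC c s k : rot c s (pc k) = pc k. Proof. exact: bevC. Qed.
Lemma rotX1 c s : rot c s X1 = pc c * X1 - pc s * X2. Proof. exact: bevX1. Qed.
Lemma rotX2 c s : rot c s X2 = pc s * X1 + pc c * X2. Proof. exact: bevX2. Qed.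

Lemma pcD a b : pc (a + b) = pc a + pc b :> B. Proof. exact: rmorphD. Qed.
Lemma pcM a b : pc (a * b) = pc a * pc b :> B. Proof. exact: rmorphM. Qed.
Lemma pcN a : pc (- a) = - pc a :> B. Proof. exact: rmorphN. Qed.
Lemma pc0 : pc 0 = 0 :> B. Proof. exact: rmorph0. Qed.
Lemma pc1 : pc 1 = 1 :> B. Proof. exact: rmorph1. Qed.

Lemma rot_id c s : c ^+ 2 + s ^+ 2 = 1 -> cancel (rot c s) (rot c (- s)).
Proof.
move=> cs1 p.
have cs : pc c ^+ 2 + pc s ^+ 2 = 1 by rewrite !expr2 -!pcM -pcD -!expr2 cs1 pc1.
apply: (@bev_unique _ _ (rot c (- s) \o rot c s) idfun) => [k||] /=.
- by rewrite !rotC.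
- rewrite rotX1 rotB !rotM !rotC rotX1 rotX2 pcN.
  by rewrite -[RHS]mul1r -cs; ring.
- rewrite rotX2 rotD !rotM !rotC rotX1 rotX2 pcN.
  by rewrite -[RHS]mul1r -cs; ring.
Qed.

Lemma rot_idV c s : c ^+ 2 + s ^+ 2 = 1 -> cancel (rot c (- s)) (rot c s).
Proof.
move=> cs1; have := @rot_id c (- s); rewrite opprK; apply.
by rewrite sqrrN.
Qed.

Lemma rot_lf c s : c ^+ 2 + s ^+ 2 = 1 -> rot c s (lf c s) = X2.
Proof.
move=> cs1.
have cs : pc c ^+ 2 + pc s ^+ 2 = 1 by rewrite !expr2 -!pcM -pcD -!expr2 cs1 pc1.
rewrite /lf rotB !rotM !rotC rotX1 rotX2.
by rewrite -[RHS]mul1r -cs; ring.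
Qed.

Lemma pder1_rot c s p : pder1 (rot c s p) = rot c s (pc c * pder1 p + pc s * pder2 p).
Proof.
apply: (@derivation_unique _ _ (rot c s) (fun p => pder1 (rot c s p))
  (fun p => rot c s (pc c * pder1 p + pc s * pder2 p))) => {p} [p q|p q|p q|p q|k||].
- by rewrite rotD (pder1D, pder2D).
- by rewrite -rotD !pder1D !pder2D; congr (rot _ _ _); ring.
- by rewrite rotM pder1M.
- by rewrite -!rotM -rotD pder1M pder2M; congr (rot _ _ _); ring.
- by rewrite rotC !pder1C !pder2C !mulr0 addr0 rmorph0.
- rewrite rotX1 (pder1B, pder2B) !pder1M !pder1C pder1X1 pder1X2 pder2X1.
  by rewrite !mulr0 !mul0r !mulr1 addr0 add0r addr0 subr0 rotC.
- rewrite rotX2 (pder1D, pder2D) !pder1M !pder1C pder1X1 pder1X2 pder2X2.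
  by rewrite !mulr0 !mul0r !mulr1 !add0r addr0 rotC.
Qed.

Lemma pder2_rot c s p : pder2 (rot c s p) = rot c s (pc c * pder2 p - pc s * pder1 p).
Proof.
apply: (@derivation_unique _ _ (rot c s) (fun p => pder2 (rot c s p))
  (fun p => rot c s (pc c * pder2 p - pc s * pder1 p))) => {p} [p q|p q|p q|p q|k||].
- by rewrite rotD (pder1D, pder2D).
- by rewrite -rotD !pder1D !pder2D; congr (rot _ _ _); ring.
- by rewrite rotM pder2M.
- by rewrite -!rotM -rotD pder1M pder2M; congr (rot _ _ _); ring.
- by rewrite rotC !pder1C !pder2C !mulr0 subr0 rmorph0.
- rewrite rotX1 (pder1B, pder2B) !pder2M !pder2C pder1X1 pder2X2 pder2X1.
  by rewrite !mulr0 !mul0r !mulr1 !add0r -!pcN rotC.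
- rewrite rotX2 (pder1D, pder2D) !pder2M !pder2C pder2X1 pder1X2 pder2X2.
  by rewrite !mulr0 !mul0r !mulr1 !add0r subr0 rotC.
Qed.

Variable nv : nat -> K.
Hypothesis nvK : forall n, nv n * n.+1%:R = 1.

(** Partial derivatives conjugated by [exp (e1 x1 + e2 x2)]. *)
Definition td1 e1 p := pder1 p + pc e1 * p.
Definition td2 e2 p := pder2 p + pc e2 * p.

Lemma kcD a b : kc (a + b) = kc a + kc b :> ser K. Proof. exact: rmorphD. Qed.
Lemma kcB a b : kc (a - b) = kc a - kc b :> ser K. Proof. exact: rmorphB. Qed.
Lemma kcM a b : kc (a * b) = kc a * kc b :> ser K. Proof. exact: rmorphM. Qed.

(* [p exp (e1 x1 + e2 x2)] in the coordinates in which the line [lf c s = 0] is [X2 = 0]. *)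
Definition Erot c s e1 e2 : ser K := Eser nv (c * e1 + s * e2) (c * e2 - s * e1).
Definition qs c s e1 e2 p : ser K := pin (rot c s p) * Erot c s e1 e2.

Lemma qsD c s e1 e2 p q : qs c s e1 e2 (p + q) = qs c s e1 e2 p + qs c s e1 e2 q.
Proof. by rewrite /qs rotD pinD mulrDl. Qed.
Lemma qsM c s e1 e2 p q : qs c s e1 e2 (p * q) = pin (rot c s p) * qs c s e1 e2 q.
Proof. by rewrite /qs rotM pinM mulrA. Qed.
Lemma qsCM c s e1 e2 k q : qs c s e1 e2 (pc k * q) = kc k * qs c s e1 e2 q.
Proof. by rewrite qsM rotC pinC. Qed.
Lemma qsN c s e1 e2 p : qs c s e1 e2 (- p) = - qs c s e1 e2 p.
Proof. by rewrite -mulN1r -pc1 -pcN qsCM (rmorphN1 (@kc K)) mulN1r. Qed.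
Lemma qsB c s e1 e2 p q : qs c s e1 e2 (p - q) = qs c s e1 e2 p - qs c s e1 e2 q.
Proof. by rewrite qsD qsN. Qed.
Lemma qs0 c s e1 e2 : qs c s e1 e2 0 = 0.
Proof. by rewrite -[0 in LHS](mul0r 1) -pc0 qsCM (rmorph0 (@kc K)) mul0r. Qed.
Lemma qs_sum c s e1 e2 I (r : seq I) (P : pred I) (F : I -> B) :
  qs c s e1 e2 (\sum_(i <- r | P i) F i) = \sum_(i <- r | P i) qs c s e1 e2 (F i).
Proof. exact: (big_morph _ (@qsD c s e1 e2) (@qs0 c s e1 e2)). Qed.

Lemma d1_qs c s e1 e2 p :
  d1 (qs c s e1 e2 p) = qs c s e1 e2 (pc c * td1 e1 p + pc s * td2 e2 p).
Proof.
rewrite {1}/qs d1M -pin_pder1 pder1_rot (d1E nvK) -/(Erot c s e1 e2).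
rewrite /td1 /td2 !qsD !qsCM !qsD !qsCM /qs !rotD !rotM !rotC !pinD !pinM !pinC kcD !kcM; ring.
Qed.

Lemma d2_qs c s e1 e2 p :
  d2 (qs c s e1 e2 p) = qs c s e1 e2 (pc c * td2 e2 p - pc s * td1 e1 p).
Proof.
rewrite {1}/qs d2M -pin_pder2 pder2_rot (d2E nvK) -/(Erot c s e1 e2).
rewrite /td1 /td2 qsB !qsCM !qsD !qsCM /qs rotB !rotM !rotC pinB !pinM !pinC kcB !kcM; ring.
Qed.

(** The angular derivative, conjugated in the same way. It is independent of [c] and [s] because
    rotations commute with it, as [ang_qs] records. *)
Definition aD e1 e2 p := X1 * td2 e2 p - X2 * td1 e1 p.

Lemma ang_qs c s e1 e2 p : ang (qs c s e1 e2 p) = qs c s e1 e2 (aD e1 e2 p).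
Proof.
rewrite /ang d1_qs d2_qs /aD; move: (td1 e1 p) (td2 e2 p) => u v.
rewrite !qsB qsD !qsM !rotC rotX1 rotX2 pinB pinD !pinM !pinC pinX1 pinX2.
by move: (qs c s e1 e2 u) (qs c s e1 e2 v) => {u v} u v; ring.
Qed.
End Frame.

(** * Total degree and order of vanishing at the origin *)

Section Degree.
Variable K : comNzRingType.
Local Notation B := {poly {poly K}}.
Implicit Types (p q : B) (c s : K) (m n d : nat).

(** The strict bound makes [dlt 0] mean zero, so descents on the degree need no convention for the
    zero polynomial. *)
Definition dlt n p := forall i j, (n <= i + j)%N -> p`_j`_i = 0.
Definition dge n p := forall i j, (i + j < n)%N -> p`_j`_i = 0.

Lemma dlt_exists p : exists n, dlt n p.
Proof.
exists (size p + \max_(j < size p) size (p`_j)%R)%N => i j ij.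
have [jp|jp] := leqP (size p) j; first by rewrite (nth_default 0 jp) coef0.
move: ij; set M := (X in (_ + X <= _)%N) => ij.
have H : (size (p`_j)%R <= M)%N := @leq_bigmax _ (fun k : 'I_(size p) => size p`_k) (Ordinal jp).
clearbody M; apply: nth_default; apply: leq_trans H _; lia.
Qed.
Lemma dlt0 p : dlt 0 p -> p = 0.
Proof. by move=> dp; apply: bpolyP => i j; rewrite dp // !coef0. Qed.
Lemma dlt_0 n : dlt n 0. Proof. by move=> i j _; rewrite !coef0. Qed.
Lemma dltD n p q : dlt n p -> dlt n q -> dlt n (p + q).
Proof. by move=> dp dq i j ij; rewrite bcoefD dp ?dq ?addr0. Qed.
Lemma dltN n p : dlt n p -> dlt n (- p).
Proof. by move=> dp i j ij; rewrite bcoefN dp ?oppr0. Qed.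
Lemma dltB n p q : dlt n p -> dlt n q -> dlt n (p - q).
Proof. by move=> dp dq i j ij; rewrite bcoefB dp ?dq ?subr0. Qed.
Lemma dlt_sum n I (r : seq I) (P : pred I) (F : I -> B) :
  (forall k, P k -> dlt n (F k)) -> dlt n (\sum_(k <- r | P k) F k).
Proof.
by move=> dF; elim/big_rec: _ => [|k x Pk]; [apply: dlt_0 | apply: dltD; apply: dF].
Qed.
Lemma dlt_leq m n p : (m <= n)%N -> dlt m p -> dlt n p.
Proof. by move=> mn dp i j ij; apply: dp; apply: leq_trans ij. Qed.
Lemma bcoefM p q i j : (p * q)`_j`_i =
  \sum_(b < j.+1) \sum_(a < i.+1) p`_b`_a * q`_(j - b)`_(i - a).
Proof. by rewrite coefM coef_sum; apply: eq_bigr => b _; rewrite coefM. Qed.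
Lemma dltM m n p q : dlt m p -> dlt n q -> dlt (m + n).-1 (p * q).
Proof.
move=> dp dq i j ij; rewrite bcoefM big1 // => -[b bj] _; rewrite big1 // => -[a ai] _ /=.
have [ab|ab] := leqP m (a + b); first by rewrite dp ?mul0r.
by rewrite (dq (i - a)%N (j - b)%N) ?mulr0 //; lia.
Qed.
Lemma dltC c : dlt 1 (pc c).
Proof. by move=> i j ij; rewrite coefC; case: j ij => [|j] ij; rewrite ?coef0 // coefC; case: i ij. Qed.
Lemma dltX1 : dlt 2 (pX1 K).
Proof.
move=> i j ij; rewrite coefC; case: j ij => [|j] ij; rewrite ?coef0 // coefX.
by case: i ij => [|[|i]].
Qed.
Lemma dltX2 : dlt 2 (pX2 K).
Proof.
move=> i j ij; rewrite coefX; case: eqP ij => [->|_ _]; rewrite ?coef0 // coef1.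
by case: i.
Qed.
Lemma dltCM c n p : dlt n p -> dlt n (pc c * p).
Proof. by move=> dp i j ij; rewrite bcoefCM dp ?mulr0. Qed.
Lemma dlt_pder1 n p : dlt n p -> dlt n.-1 (pder1 p).
Proof. by move=> dp i j ij; rewrite bcoef1 dp ?mul0rn //; lia. Qed.
Lemma dlt_pder2 n p : dlt n p -> dlt n.-1 (pder2 p).
Proof. by move=> dp i j ij; rewrite bcoef2 dp ?mul0rn //; lia. Qed.

Lemma dge0 p : dge 0 p. Proof. by []. Qed.
Lemma dge_0 n : dge n 0. Proof. by move=> i j _; rewrite !coef0. Qed.
Lemma dgeD n p q : dge n p -> dge n q -> dge n (p + q).
Proof. by move=> dp dq i j ij; rewrite bcoefD dp ?dq ?addr0. Qed.

Lemma dgeB n p q : dge n p -> dge n q -> dge n (p - q).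
Proof. by move=> dp dq i j ij; rewrite bcoefB dp ?dq ?subr0. Qed.
Lemma dge_sum n I (r : seq I) (P : pred I) (F : I -> B) :
  (forall k, P k -> dge n (F k)) -> dge n (\sum_(k <- r | P k) F k).
Proof.
by move=> dF; elim/big_rec: _ => [|k x Pk]; [apply: dge_0 | apply: dgeD; apply: dF].
Qed.
Lemma dge_leq m n p : (m <= n)%N -> dge n p -> dge m p.
Proof. by move=> mn dp i j ij; apply: dp; apply: leq_trans mn. Qed.
Lemma dgeM m n p q : dge m p -> dge n q -> dge (m + n) (p * q).
Proof.
move=> dp dq i j ij; rewrite bcoefM big1 // => -[b bj] _; rewrite big1 // => -[a ai] _ /=.
have [ab|ab] := ltnP (a + b) m; first by rewrite dp ?mul0r.
by rewrite (dq (i - a)%N (j - b)%N) ?mulr0 //; lia.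
Qed.
Lemma dgeX1 : dge 1 (pX1 K).
Proof. by move=> [|i] [|j] //= _; rewrite coefC /= coefX. Qed.
Lemma dgeX2 : dge 1 (pX2 K).
Proof. by move=> [|i] [|j] //= _; rewrite coefX /= coef0. Qed.
Lemma dgeCM c n p : dge n p -> dge n (pc c * p).
Proof. by move=> dp i j ij; rewrite bcoefCM dp ?mulr0. Qed.
Lemma dge_pder1 n p : dge n p -> dge n.-1 (pder1 p).
Proof. by move=> dp i j ij; rewrite bcoef1 dp ?mul0rn //; lia. Qed.
Lemma dge_pder2 n p : dge n p -> dge n.-1 (pder2 p).
Proof. by move=> dp i j ij; rewrite bcoef2 dp ?mul0rn //; lia. Qed.
Lemma dlt_dge n p : dlt n p -> dge n p -> p = 0.
Proof.
move=> lp gp; apply: bpolyP => i j; rewrite !coef0.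
by have [?|?] := leqP n (i + j); [apply: lp | apply: gp].
Qed.

Lemma dltX m n p : dlt m.+1 p -> dlt (n * m).+1 (p ^+ n).
Proof.
move=> dp; elim: n => [|n IH]; first exact: (dltC 1).
by rewrite exprS; have := dltM dp IH; apply: dlt_leq; lia.
Qed.
Lemma dgeX m n p : dge m p -> dge (n * m) (p ^+ n).
Proof.
move=> dp; elim: n => [|n IH]; first exact: dge0.
by rewrite exprS mulSn; apply: dgeM.
Qed.

Lemma dlt_bev n p u v : dlt 2 u -> dlt 2 v -> dlt n p -> dlt n (bev (@pc K) u v p).
Proof.
move=> du dv dp; rewrite bevE; apply: dlt_sum => j _; apply: dlt_sum => i _.
have [ij|ij] := leqP n (i + j); first by rewrite dp // (rmorph0 (@pc K)) !mul0r; apply: dlt_0.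
rewrite -mulrA; apply: dltCM.
by apply: dlt_leq (dltM (dltX (n := i) du) (dltX (n := j) dv)); lia.
Qed.
Lemma dge_bev n p u v : dge 1 u -> dge 1 v -> dge n p -> dge n (bev (@pc K) u v p).
Proof.
move=> du dv dp; rewrite bevE; apply: dge_sum => j _; apply: dge_sum => i _.
have [ij|ij] := ltnP (i + j) n; first by rewrite dp // (rmorph0 (@pc K)) !mul0r; apply: dge_0.
rewrite -mulrA; apply: dgeCM.
by apply: dge_leq (dgeM (dgeX (n := i) du) (dgeX (n := j) dv)); lia.
Qed.

Lemma dlt_lf c s : dlt 2 (lf c s).
Proof. by apply: dltB; apply: dltCM; [apply: dltX2 | apply: dltX1]. Qed.
Lemma dge_lf c s : dge 1 (lf c s).
Proof. by apply: dgeB; apply: dgeCM; [apply: dgeX2 | apply: dgeX1]. Qed.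

Lemma dlt_rot n c s p : dlt n p -> dlt n (rot c s p).
Proof.
apply: dlt_bev.
  by apply: dltB; apply: dltCM; [apply: dltX1 | apply: dltX2].
by apply: dltD; apply: dltCM; [apply: dltX1 | apply: dltX2].
Qed.
Lemma dge_rot n c s p : dge n p -> dge n (rot c s p).
Proof.
apply: dge_bev.
  by apply: dgeB; apply: dgeCM; [apply: dgeX1 | apply: dgeX2].
by apply: dgeD; apply: dgeCM; [apply: dgeX1 | apply: dgeX2].
Qed.

Definition hpart d p : B := \poly_(j < d.+1) (p`_j`_(d - j) *: 'X^(d - j)).
Lemma hpartE d p i j : (hpart d p)`_j`_i = if (i + j == d)%N then p`_j`_i else 0.
Proof.
rewrite coef_poly ltnS; case: leqP => jd; last first.
  by rewrite coef0; case: eqP => //; lia.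
rewrite coefZ coefXn; case: eqP => e; first by rewrite mulr1 e; case: eqP => //; lia.
by rewrite mulr0; case: eqP => //; lia.
Qed.
Lemma dlt_hpart d p : dlt d.+1 (hpart d p).
Proof. by move=> i j ij; rewrite hpartE; case: eqP => //; lia. Qed.
Lemma dge_hpart d p : dge d (hpart d p).
Proof. by move=> i j ij; rewrite hpartE; case: eqP => //; lia. Qed.
Lemma hpart_rest d p : dlt d.+1 p -> dlt d (p - hpart d p).
Proof.
move=> dp i j ij; rewrite bcoefB hpartE; case: eqP => e; rewrite ?subrr // subr0.
by apply: dp; lia.
Qed.
End Degree.

(** * Divisibility by powers of a linear form *)

Section Divisibility.
Variable K : comNzRingType.
Local Notation B := {poly {poly K}}.
Variables (c s : K).
Hypothesis cs1 : c ^+ 2 + s ^+ 2 = 1.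
Implicit Types p q : B.
Local Notation l := (lf c s).

Lemma rot_inj : injective (rot c s).
Proof. exact: can_inj (rot_id cs1). Qed.

(** The rotation carries [l] to [X2], and divisibility by a power of [X2] is visible on
    coefficients. No factoriality of [K] enters. *)
Lemma lfX_dvdP n p :
  (exists h, p = l ^+ n * h) <-> (forall i j, (j < n)%N -> (rot c s p)`_j`_i = 0).
Proof.
split=> [[h ->] i j jn|H].
  rewrite rotM (rmorphXn (rot c s)) /= rot_lf // coefXnM jn coef0 //.
exists (rot c (- s) (drop_poly n (rot c s p))); apply: rot_inj.
rewrite rotM (rmorphXn (rot c s)) /= rot_lf // rot_idV //.
rewrite mulrC -[LHS](poly_take_drop n) [X in X + _](_ : _ = 0) ?add0r //.
apply/polyP => j; rewrite coef_take_poly coef0; case: ifP => // jn.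
by apply/polyP => i; rewrite H // coef0.
Qed.

Lemma lf_reg p : l * p = 0 -> p = 0.
Proof.
move=> /(congr1 (rot c s)); rewrite rotM rot_lf // (rmorph0 (rot c s)) => e.
apply: rot_inj; rewrite (rmorph0 (rot c s)); apply: bpolyP => i j.
have := congr1 (fun q : B => q`_j.+1`_i) e.
by rewrite bcoefX2M !coef0.
Qed.
Lemma lfI : injective ( *%R l).
Proof. by move=> p q /eqP; rewrite -subr_eq0 -mulrBr => /eqP/lf_reg/subr0_eq. Qed.
Lemma lfXI n : injective ( *%R (l ^+ n)).
Proof.
elim: n => [|n IH] p q; first by rewrite !mul1r.
by rewrite exprS -!mulrA => /lfI/IH.
Qed.
Lemma dlt_lfI n p : dlt n.+1 (l * p) -> dlt n p.
Proof.
move=> /(@dlt_rot _ _ c s); rewrite rotM rot_lf // => dp.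
rewrite -(rot_id cs1 p); apply: dlt_rot => i j ij.
by have := dp i j.+1; rewrite bcoefX2M; apply; lia.
Qed.
End Divisibility.

(** * Quasi-invariance along one line *)

Section Columns.
Variable K : comNzRingType.
Implicit Types f g : ser K.
Lemma col0M f g : (forall i, f i 0%N = 0) -> forall i, (f * g) i 0%N = 0.
Proof.
move=> f0 i; rewrite scM big1 // => a _; rewrite big1 // => b _.
by rewrite (ord1 b) f0 mul0r.
Qed.
End Columns.

Lemma sum_ord_trunc (V : nmodType) (G : nat -> V) m n : (forall j, (m <= j)%N -> G j = 0) ->
  (m <= n)%N -> \sum_(j < n) G j = \sum_(j < m) G j.
Proof.
move=> G0 mn; rewrite -!(big_mkord xpredT) (@big_cat_nat _ _ _ m) //=.
by rewrite [X in _ + X]big_nat_cond [X in _ + X]big1 ?addr0 // => j /andP[/andP[/G0]].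
Qed.

(* A sequence h is determined by the values at 1, 3, 5, ... of its Newton polynomial. *)
Definition newton_odd (K : comNzRingType) := forall (k : nat) (h : nat -> K),
  (forall l, (l <= k)%N -> \sum_(j < k.+1) h j *+ (l.*2.+1 ^_ j) = 0) ->
  forall j, (j <= k)%N -> h j = 0.

Section NewtonOdd.
Variable K : idomainType.
Hypothesis char0 : forall n, n.+1%:R != 0 :> K.

Lemma natr_inj : injective (fun n => n%:R : K).
Proof.
suff H m n : (m < n)%N -> m%:R <> n%:R :> K.
  move=> m n /= e; case: (ltngtP m n) => // mn; last by case: (H _ _ mn).
  by case: (H _ _ mn).
move=> mn /eqP; rewrite eq_sym -subr_eq0 -natrB ?(ltnW mn) //.
by rewrite -(subnSK mn); apply/negP/char0.
Qed.

(** The polynomial with Newton coefficients [h] has degree at most [k] and vanishes at the [k + 1]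
    points 1, 3, ..., 2k + 1, which characteristic zero keeps distinct. The Newton basis being monic
    of increasing degrees, [h] then vanishes from the top down. [pnewt] carries the property over to
    polynomial coefficients. *)
Lemma newton_oddP : newton_odd K.
Proof.
move=> k h H.
pose N j : {poly K} := \prod_(i < j) ('X - i%:R%:P).
have sN j : size (N j) = j.+1 by rewrite size_prod_XsubC /= /index_enum -enumT size_enum_ord.
have NE j x : (N j).[x%:R] = (x ^_ j)%:R.
  elim: j => [|j IH]; first by rewrite /N big_ord0 hornerC ffactn0.
  rewrite /N big_ord_recr /= hornerM -/(N j) IH hornerXsubC ffactnSr.
  have [jx|xj] := leqP j x; first by rewrite natrM natrB.
  by rewrite ffact_small // !mul0r.
pose Q := \sum_(j < k.+1) h j *: N j.
have Q0 : Q = 0.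
  apply/eqP/negPn/negP => Q0.
  have := @max_poly_roots _ Q [seq l.*2.+1%:R | l <- iota 0 k.+1] Q0.
  have -> : size [seq (l.*2.+1)%:R : K | l <- iota 0 k.+1] = k.+1 by rewrite size_map size_iota.
  have sQ : (size Q <= k.+1)%N.
    apply: (leq_trans (size_sum _ _ _)); apply/bigmax_leqP => j _.
    by apply: (leq_trans (size_scale_leq _ _)); rewrite sN.
  rewrite ltnNge sQ -[~~ true]/false => max_roots; suff /max_roots : all (root Q) [seq l.*2.+1%:R | l <- iota 0 k.+1].
    by rewrite map_inj_uniq ?iota_uniq => [/(_ isT)|a b /natr_inj [] /double_inj].
  apply/allP => x /mapP[l]; rewrite mem_iota add0n ltnS => lk ->.
  rewrite rootE /Q horner_sum -[X in _ == X](H l lk); apply/eqP/eq_bigr => j _.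
  by rewrite hornerZ NE mulr_natr.
have lead j : (N j)`_j = 1.
  have /monicP : N j \is monic by apply: monic_prod_XsubC.
  by rewrite /lead_coef sN.
suff HH n : (n <= k.+1)%N -> forall j, (k.+1 - n <= j)%N -> (j <= k)%N -> h j = 0.
  by move=> j jk; apply: (HH k.+1) => //; rewrite subnn.
elim: n => [|n IH] nk j jn jk; first by lia.
have [jn'|e] := leqP (k.+1 - n) j; first by apply: (IH _ j) => //; lia.
have jk1 : (j < k.+1)%N by lia.
have := congr1 (fun P : {poly K} => P`_j) Q0; rewrite coef0 /Q coef_sum.
rewrite (bigD1 (Ordinal jk1)) //= coefZ lead mulr1 big1 ?addr0 // => i ij.
rewrite coefZ; have [lt_ij|gt_ij|/eqP eij] := ltngtP i j.
- by rewrite nth_default ?mulr0 // sN.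
- by rewrite (IH _ i) ?mul0r //; have := ltn_ord i; lia.
- by case/eqP: ij; apply/val_inj/eqP.
Qed.
End NewtonOdd.

Section QuasiInv.
Variable K : comNzRingType.
Local Notation B := {poly {poly K}}.
Implicit Types (p q : B).
Variable nv : nat -> K.
Hypothesis nvK : forall n, nv n * n.+1%:R = 1.

Section OneLine.
Variables (c s : K).
Hypothesis cs1 : c ^+ 2 + s ^+ 2 = 1.
Variables (e1 e2 : K).
Local Notation qs := (qs nv c s e1 e2).
Local Notation l := (lf c s).

(* Odd normal derivatives replace the odd angular ones: see [QI_angP] and [QI_evs]. *)
Definition QI m p := vanish true m.*2 (qs p).

(** The exponential is a unit, so it does not affect the vanishing of column 0. *)
Lemma qs_col0 p : (forall i, qs p i 0%N = 0) <-> (exists h, p = l * h).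
Proof.
split=> [H|[h -> i]]; last first.
  by rewrite qsM rot_lf // pinX2 scY2M.
apply/(lfX_dvdP cs1 1) => i [|//] _.
rewrite -[LHS]/(pin (rot c s p) i 0%N).
have -> : pin (rot c s p) = qs p * Eser nv (- (c * e1 + s * e2)) (- (c * e2 - s * e1)).
  by rewrite -mulrA EserV // mulr1.
exact: col0M.
Qed.

Lemma iter_ang_qs k p : iter k (@ang K) (qs p) = qs (iter k (aD e1 e2) p).
Proof. by elim: k => //= k ->; rewrite ang_qs. Qed.

(** [ang] reverses parity at the cost of one order, which gives the direct implication. Conversely,
    once the odd columns below an odd [n] vanish, [iter_ang_lead] reads column [n] off the [n]-th
    angular derivative on the line. The angular form of the condition is the one that survives the
    exchange of [x] and [z]. *)
Lemma QI_angP m p :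
  QI m p <-> (forall k, odd k -> (k < m.*2)%N -> exists h, iter k (aD e1 e2) p = l * h).
Proof.
split=> [Qp k ok km|H].
  apply/qs_col0 => i; rewrite -iter_ang_qs.
  have /= -> := @vanish_iter_ang _ true 1 k (qs p) _ i 0%N; rewrite ?ok //.
  by apply: vanish_leq Qp; rewrite add1n.
suff V n : (n <= m.*2)%N -> vanish true n (qs p) by apply: V.
elim: n => [|n IH] nm // i j oj; rewrite ltnS leq_eqVlt => /orP[/eqP e|jn]; last first.
  by apply: IH => //; apply: ltnW.
have on : odd n by rewrite -e.
have := @iter_ang_lead _ n (qs p) i; rewrite on e => /(_ (IH (ltnW nm))).
rewrite iter_ang_qs (qs_col0 _).2; last by apply: H.
move=> E; have := fact_gt0 n; case: (n`!) E => // f E _.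
by apply: (@natI _ _ nvK f); rewrite /= -E mul0rn.
Qed.

Lemma QI_D m p q : QI m p -> QI m q -> QI m (p + q).
Proof. by move=> Qp Qq; rewrite /QI qsD; apply: vanishD. Qed.

Lemma QI_B m p q : QI m p -> QI m q -> QI m (p - q).
Proof. by move=> Qp Qq; rewrite /QI qsB; apply: vanishB. Qed.
Lemma QI_0 m : QI m 0.
Proof. by rewrite /QI qs0; apply: vanish0. Qed.
Lemma QI_CM m k p : QI m p -> QI m (pc k * p).
Proof. by move=> Qp; rewrite /QI qsCM; apply: vanishCM. Qed.
Lemma QI_sum m I (r : seq I) (P : pred I) (F : I -> B) :
  (forall i, P i -> QI m (F i)) -> QI m (\sum_(i <- r | P i) F i).
Proof. by move=> QF; rewrite /QI qs_sum; apply: vanish_sum. Qed.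
Lemma QI_lfX m p : QI m (l ^+ m.*2 * p).
Proof.
rewrite /QI qsM (rmorphXn (rot c s)) /= rot_lf // (rmorphXn (@pin K)) /= pinX2.
exact: vanish_Y2X.
Qed.

Lemma vanish_E0 n a : vanish true n (Eser nv a 0).
Proof. by move=> i [|j] // _ _; rewrite /= expr0n /= mulr0 mul0r. Qed.

(** In the adapted frame the tangential exponential is harmless, and the condition concerns
    [F exp (cc x2)] with [cc] the normal slope. The coefficients of [x1^(d - k) x2^M] for
    [M = 1, 3, ..., 2k + 1] vanish since [2k + 1 < 2m], and the degree bound leaves only the columns
    up to [k] of [F] as unknowns. Multiplied by [M!], the system becomes Newton interpolation at odd
    points, with zero as its only solution. *)
Lemma QI_top m d p k : newton_odd K ->
  (forall x, (c * e2 - s * e1) * x = 0 -> x = 0) ->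
  QI m p -> dlt d.+1 p -> (k < m)%N -> (k <= d)%N -> (rot c s p)`_k`_(d - k) = 0.
Proof.
move=> newt reg Qp /(@dlt_rot _ _ c s) dF km kd.
set b := c * e1 + s * e2; set cc := c * e2 - s * e1 in reg *.
set F := rot c s p in dF *.
have regX n x : cc ^+ n * x = 0 -> x = 0.
  by elim: n => [|n IH]; rewrite ?mul1r // exprS -mulrA => /reg/IH.
have V : vanish true m.*2 (pin F * Eser nv 0 cc).
  have -> : pin F * Eser nv 0 cc = qs p * Eser nv (- b) 0.
    by rewrite -mulrA Eser_mul // addr0 subrr.
  exact: (vanishM Qp (vanish_E0 (n := m.*2) (- b))).
have S l' : (l' <= k)%N -> \sum_(j < k.+1) (F`_j`_(d - k) * cc ^+ (k - j)) *+ (l'.*2.+1 ^_ j) = 0.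
  move=> lk; set M := l'.*2.+1.
  pose G j := F`_j`_(d - k) * cc ^+ (k + M - j) *+ (M ^_ j).
  have Gk j : (k < j)%N -> G j = 0 by move=> kj; rewrite /G dF ?mul0r ?mul0rn //; lia.
  have GM j : (M < j)%N -> G j = 0 by move=> Mj; rewrite /G ffact_small.
  (* The factor [cc ^ M] makes every exponent [k + M - j] a true difference, whichever of [k] and
     [M] is larger. The sum stops at [k] by degree and at [M] by the falling factorial. *)
  apply: (regX M); transitivity (\sum_(j < k.+1) G j).
    rewrite mulr_sumr; apply: eq_bigr => -[j /= jk] _.
    by rewrite mulrnAr mulrCA -exprD /G addnBA // addnC.
  rewrite -(sum_ord_trunc (n := (k + M).+1) Gk); last by rewrite ltnS leq_addr.
  rewrite (sum_ord_trunc (m := M.+1) GM); last by rewrite ltnS leq_addl.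
  transitivity (cc ^+ k * ((pin F * Eser nv 0 cc) (d - k)%N M *+ M`!)); last first.
    by rewrite V ?mul0rn ?mulr0 // /M /= ?odd_double //; lia.
  rewrite scM [X in X *+ M`!]big_ord_recr /= [X in (X + _) *+ M`!]big1 ?add0r; last first.
    move=> [a /= ad] _; rewrite big1 // => b' _.
    by rewrite expr0n subn_eq0 leqNgt ad /= !(mul0r, mulr0).
  rewrite -sumrMnl mulr_sumr; apply: eq_bigr => -[j /= jM] _.
  rewrite subnn expr0 mul1r {1}/fv big_ord0 mul1r /G -(ffact_fact (n := M) (m := j)) //.
  have E : F`_j`_(d - k) * (cc ^+ (M - j) * fv nv (M - j)) *+ (M - j)`! = F`_j`_(d - k) * cc ^+ (M - j).
    by rewrite -!mulrnAr fvE // mulr1.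
  by rewrite mulnC mulrnA E mulrnAr mulrCA -exprD addnBA.
have := newt k (fun j => F`_j`_(d - k) * cc ^+ (k - j)) S k (leqnn k); by rewrite subnn expr0 mulr1.
Qed.
End OneLine.
End QuasiInv.

(** * Line arrangements *)

Section ProductRule.
Variables (S : comNzRingType) (D : S -> S) (I : eqType).
Hypothesis DD : forall p q, D (p + q) = D p + D q.
Hypothesis DM : forall p q, D (p * q) = D p * q + p * D q.

Lemma der0 : D 0 = 0.
Proof. by apply: (addrI (D 0)); rewrite -DD !addr0. Qed.
Lemma der1 : D 1 = 0.
Proof. by apply: (addrI (D 1)); have := DM 1 1; rewrite !mul1r mulr1 addr0 => <-. Qed.
Lemma derN p : D (- p) = - D p.
Proof. by apply: (addrI (D p)); rewrite -DD !subrr der0. Qed.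
Lemma derB p q : D (p - q) = D p - D q.
Proof. by rewrite DD derN. Qed.
Lemma derMn p n : D (p *+ n) = D p *+ n.
Proof. by elim: n => [|n IH]; rewrite ?der0 // !mulrS DD IH. Qed.
Lemma der_sum J (r : seq J) (P : pred J) (F : J -> S) :
  D (\sum_(i <- r | P i) F i) = \sum_(i <- r | P i) D (F i).
Proof. exact: (big_morph _ DD der0). Qed.
Lemma derX p n : D (p ^+ n) = (D p * p ^+ n.-1) *+ n.
Proof.
elim: n => [|n IH]; first by rewrite expr0 der1.
rewrite exprS DM IH mulrS; congr (_ + _).
by case: n {IH} => [|n] /=; rewrite ?mulr0n ?mulr0 // mulrnAr mulrCA -exprS.
Qed.

Lemma der_prod (r : seq I) (F : I -> S) : uniq r ->
  D (\prod_(a <- r) F a) = \sum_(a <- r) D (F a) * \prod_(b <- r | b != a) F b.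
Proof.
elim: r => [|x r IH] /=; first by rewrite !big_nil der1.
case/andP => xr ur; rewrite !big_cons DM IH // eqxx /=; congr (_ + _).
  congr (_ * _); rewrite [LHS]big_seq [RHS]big_seq_cond; apply: eq_bigl => b.
  by case br: (b \in r) => //=; apply/esym/eqP => e; rewrite -e br in xr.
rewrite mulr_sumr [LHS]big_seq [RHS]big_seq; apply: eq_bigr => a ar.
have xa : x != a by apply: contraNneq xr => ->.
by rewrite big_cons xa [LHS]mulrCA.
Qed.
End ProductRule.

Section Arrangement.
Variable K : comNzRingType.
Local Notation B := {poly {poly K}}.
Local Notation X1 := (pX1 K).
Local Notation X2 := (pX2 K).
Implicit Types (p q : B).
Variables (I : eqType) (Pi : seq I) (mu : I -> nat) (co si : I -> K) (kap : I -> I -> K).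
Hypothesis uPi : uniq Pi.
Hypothesis cs1 : forall a, co a ^+ 2 + si a ^+ 2 = 1.
(** Sine and cosine of the angle from line [a] to line [b]; accordingly [kap a b] is its
    cotangent. *)
Definition sd a b := co a * si b - si a * co b.
Definition cd a b := co a * co b + si a * si b.
Hypothesis sd_reg : forall a b, a \in Pi -> b \in Pi -> a != b -> forall x, sd a b * x = 0 -> x = 0.
Hypothesis kapE : forall a b, a \in Pi -> b \in Pi -> a != b -> cd a b = kap a b * sd a b.
Hypothesis kapN : forall a b, kap a b = - kap b a.

Definition L a := lf (co a) (si a).
Definition del := locked (\prod_(a <- Pi) L a ^+ mu a).
(** Stands for [del / L a]. For [mu a = 0] the truncated predecessor breaks this reading, so the
    formulas carry a multiplicity divisible by [mu a], as in [mdelE]. *)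
Definition dh a := locked (L a ^+ (mu a).-1 * \prod_(b <- Pi | b != a) L b ^+ mu b).
Definition mtot := (\sum_(a <- Pi) mu a)%N.

Lemma delE a : a \in Pi -> (0 < mu a)%N -> del = L a * dh a.
Proof.
by move=> aP ma; rewrite /del -lock (bigD1_seq a) //= /dh -lock mulrA -exprS prednK.
Qed.
Lemma mdelE a : a \in Pi -> del *+ mu a = (L a * dh a) *+ mu a.
Proof. by move=> aP; case: (posnP (mu a)) => [->|/(delE aP) ->]. Qed.

Lemma delI : injective ( *%R del).
Proof.
rewrite /del -lock; elim: Pi => [|a r IH] p q; first by rewrite big_nil !mul1r.
by rewrite big_cons -!mulrA => /(lfXI (cs1 a))/IH.
Qed.

Lemma dlt_del : dlt mtot.+1 del.
Proof.
rewrite /del -lock /mtot; elim: Pi => [|a r IH]; first by rewrite !big_nil; apply: (@dltC _ 1).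
rewrite !big_cons; apply: dlt_leq (dltM (dltX (n := mu a) (@dlt_lf _ (co a) (si a))) IH).
by rewrite muln1; lia.
Qed.
Lemma dge_del : dge mtot del.
Proof.
rewrite /del -lock /mtot; elim: Pi => [|a r IH]; first by rewrite !big_nil; apply: dge0.
by rewrite !big_cons; have := dgeM (dgeX (n := mu a) (@dge_lf _ (co a) (si a))) IH; rewrite muln1.
Qed.
Lemma dlt_delI n p : dlt (n + mtot) (del * p) -> dlt n p.
Proof.
rewrite /del -lock /mtot; elim: Pi n => [|a r IH] n; first by rewrite !big_nil mul1r addn0.
rewrite !big_cons -mulrA addnCA addnC => H; apply: IH; elim: (mu a) H => [|m IHm].
  by rewrite mul1r addn0.
by rewrite exprS -mulrA addnS => /(dlt_lfI (cs1 a)).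
Qed.

Lemma rot_L a b : rot (co a) (si a) (L b) = pc (cd a b) * X2 - pc (sd a b) * X1.
Proof.
rewrite /L /lf rotB !rotM !rotC rotX1 rotX2 /cd /sd.
by rewrite pcD pcD pcN !pcM; ring.
Qed.

(** In the frame of [a] the form [L b] is [cd X2 - sd X1] with [sd] regular, so it cannot kill the
    lowest column; columns are cleared one at a time. *)
Lemma lfX_coprime a b n p : a \in Pi -> b \in Pi -> a != b ->
  (exists h, L b * p = L a ^+ n * h) -> exists h, p = L a ^+ n * h.
Proof.
move=> aP bP ab /(lfX_dvdP (cs1 a)) H; apply/(lfX_dvdP (cs1 a)).
have reg := sd_reg aP bP ab.
suff S j : (j < n)%N -> forall i, (rot (co a) (si a) p)`_j`_i = 0 by move=> i j; move/S.
elim: j => [|j IH] jn i; apply: reg; have := H i.+1 _ jn.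
  rewrite rotM rot_L mulrBl -!mulrA bcoefB !bcoefCM bcoefX1M bcoefX2M mulr0 sub0r => /eqP.
  by rewrite oppr_eq0 => /eqP.
rewrite rotM rot_L mulrBl -!mulrA bcoefB !bcoefCM bcoefX1M bcoefX2M IH ?(ltnW jn) //.
by rewrite mulr0 sub0r => /eqP; rewrite oppr_eq0 => /eqP.
Qed.

Lemma prod_dvd (m : I -> nat) (r : seq I) p : uniq r -> {subset r <= Pi} ->
  (forall a, a \in r -> exists h, p = L a ^+ m a * h) ->
  exists h, p = \prod_(a <- r) L a ^+ m a * h.
Proof.
elim: r => [|x r IH] /= => [_ _ _|/andP[xr ur] rP H]; first by exists p; rewrite big_nil mul1r.
case: IH => // [y yr|a ar|h hE]; first by rewrite rP // inE yr orbT.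
  by apply: H; rewrite inE ar orbT.
have [g gE] : exists g, h = L x ^+ m x * g; last first.
  by exists g; rewrite hE gE big_cons; ring.
have := H x (mem_head _ _); rewrite hE {hE}.
elim: r xr ur rP {H} => [|y r IH] xr ur rP; first by rewrite big_nil mul1r.
rewrite big_cons -!mulrA => H; apply: IH.
- by move: xr; rewrite inE negb_or => /andP[].
- by case/andP: ur.
- by move=> z; rewrite inE => /orP[/eqP ->|zr]; apply: rP; rewrite !inE ?eqxx ?zr ?orbT.
have yP : y \in Pi by apply: rP; rewrite !inE eqxx orbT.
have xP : x \in Pi by apply: rP; rewrite !inE eqxx.
have xy : x != y by move: xr; rewrite inE negb_or => /andP[].
elim: (m y) H => [|n IHn]; first by rewrite mul1r.
by rewrite exprS -mulrA => /(lfX_coprime xP yP xy)/IHn.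
Qed.

Definition Dv (u v : K) p := pc u * pder1 p + pc v * pder2 p.
Lemma DvD u v p q : Dv u v (p + q) = Dv u v p + Dv u v q.
Proof. by rewrite /Dv pder1D pder2D; ring. Qed.
Lemma DvM u v p q : Dv u v (p * q) = Dv u v p * q + p * Dv u v q.
Proof. by rewrite /Dv pder1M pder2M; ring. Qed.
Lemma pder1_L a : pder1 (L a) = - pc (si a).
Proof.
by rewrite /L /lf pder1B !pder1M !pder1C pder1X1 pder1X2 !mul0r !mulr0 mulr1 !add0r.
Qed.
Lemma pder2_L a : pder2 (L a) = pc (co a).
Proof.
by rewrite /L /lf pder2B !pder2M !pder2C pder2X1 pder2X2 !mul0r !mulr0 mulr1 !add0r subr0.
Qed.
Lemma Dv_L u v a : Dv u v (L a) = pc (co a * v - si a * u).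
Proof. by rewrite /Dv pder1_L pder2_L pcD pcN !pcM; ring. Qed.

Lemma der_del (D : B -> B) : (forall p q, D (p + q) = D p + D q) ->
  (forall p q, D (p * q) = D p * q + p * D q) ->
  D del = \sum_(a <- Pi) (D (L a) * dh a) *+ mu a.
Proof.
move=> DD DM; rewrite /del -lock der_prod //; apply: eq_bigr => a _.
by rewrite derX // /dh -lock -mulrnAl -mulrA mulrnAl.
Qed.
Lemma pder1_del : pder1 del = \sum_(a <- Pi) (- pc (si a) * dh a) *+ mu a.
Proof.
by rewrite (der_del (@pder1D K) (@pder1M K)); apply: eq_bigr => a _; rewrite pder1_L.
Qed.
Lemma pder2_del : pder2 del = \sum_(a <- Pi) (pc (co a) * dh a) *+ mu a.
Proof.
by rewrite (der_del (@pder2D K) (@pder2M K)); apply: eq_bigr => a _; rewrite pder2_L.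
Qed.

Hypothesis BA1 : forall a, a \in Pi -> (0 < mu a)%N ->
  \sum_(b <- Pi | b != a) kap a b *+ mu b = 0.

Lemma rho2_reg p : (X1 ^+ 2 + X2 ^+ 2) * p = 0 -> p = 0.
Proof.
have mon : X1 ^+ 2 + X2 ^+ 2 \is monic.
  rewrite addrC /pX1 -polyC_exp monicE lead_coefDl ?lead_coefXn // size_polyXn.
  by rewrite (leq_ltn_trans (size_polyC_leq1 _)).
move=> e; have/lreg_lead reg : GRing.lreg (lead_coef (X1 ^+ 2 + X2 ^+ 2)).
  by rewrite (monicP mon); apply: lreg1.
by apply: reg; rewrite e mulr0.
Qed.

Lemma rho2_cd a b : a \in Pi -> b \in Pi -> a != b ->
  (X1 ^+ 2 + X2 ^+ 2) * pc (cd a b) = pc (kap a b) *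
    ((pc (co b) * X1 + pc (si b) * X2) * L a - (pc (co a) * X1 + pc (si a) * X2) * L b).
Proof.
move=> aP bP ab; rewrite kapE // pcM /L /lf /sd pcD pcN !pcM; ring.
Qed.

(** These are the mixed terms of [|grad del|^2]. After multiplication by [X1^2 + X2^2], which is
    regular, the partial fractions of [rho2_cd] split the term of each pair into two parts, in each
    of which one of [dh a], [dh b] is completed to [del]. Summing over the line so completed leaves
    a multiple of the cotangent sum [BA1]. *)
Lemma cross_sum :
  \sum_(a <- Pi) \sum_(b <- Pi | b != a) (pc (cd a b) * dh a * dh b) *+ (mu a * mu b) = 0.
Proof.
apply: rho2_reg; rewrite mulr_sumr.
pose y a := pc (co a) * X1 + pc (si a) * X2 : B.
pose M a b := (pc (kap a b) * y a * dh a * del) *+ (mu a * mu b).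
transitivity (\sum_(a <- Pi) \sum_(b <- Pi | b != a) (- M a b - M b a)).
  rewrite [LHS]big_seq [RHS]big_seq; apply: eq_bigr => a aP.
  rewrite mulr_sumr [LHS]big_seq_cond [RHS]big_seq_cond; apply: eq_bigr => b /andP[bP ba].
  rewrite /M [kap b a]kapN pcN mulrnAr !mulrA rho2_cd // 1?eq_sym //.
  have -> : (pc (kap a b) * y a * dh a * del) *+ (mu a * mu b) =
            (pc (kap a b) * y a * dh a * (L b * dh b)) *+ (mu a * mu b).
    by rewrite mulnC !mulrnA; congr (_ *+ _); rewrite -mulrnAr mdelE // mulrnAr.
  have -> : (- pc (kap a b) * y b * dh b * del) *+ (mu b * mu a) =
            (- pc (kap a b) * y b * dh b * (L a * dh a)) *+ (mu b * mu a).
    by rewrite mulnC !mulrnA; congr (_ *+ _); rewrite -mulrnAr mdelE // mulrnAr.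
  by rewrite [(mu b * mu a)%N]mulnC -mulNrn -mulrnBl /y; congr (_ *+ _); ring.
have Z a : a \in Pi -> \sum_(b <- Pi | b != a) M a b = 0.
  move=> aP; case: (posnP (mu a)) => [e|ma].
    by rewrite big1 // => b _; rewrite /M e mul0n mulr0n.
  transitivity (pc (\sum_(b <- Pi | b != a) kap a b *+ mu b) * ((y a * dh a * del) *+ mu a)); last first.
    by rewrite BA1 // pc0 mul0r.
  rewrite (rmorph_sum (@pc K)) mulr_suml; apply: eq_bigr => b _.
  by rewrite (rmorphMn (@pc K)) /= /M mulrnAr mulrnAl -mulrnA mulnC -!mulrA.
rewrite (eq_bigr (fun a => - \sum_(b <- Pi | b != a) M a b - \sum_(b <- Pi | b != a) M b a)); last first.
  by move=> a _; rewrite big_split /= !sumrN.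
rewrite big_split /= !sumrN [X in _ - X](exchange_big_dep xpredT) //=.
rewrite big_seq big1 ?oppr0 ?add0r; last by move=> a /Z.
rewrite big_seq big1 ?oppr0 // => a /Z Za; rewrite -[RHS]Za.
by apply: eq_bigl => b; rewrite eq_sym.
Qed.

Lemma grad_del_sqr : pder1 del ^+ 2 + pder2 del ^+ 2 = \sum_(a <- Pi) dh a ^+ 2 *+ (mu a ^ 2).
Proof.
have E : pder1 del ^+ 2 + pder2 del ^+ 2 =
    \sum_(a <- Pi) \sum_(b <- Pi) (pc (cd a b) * dh a * dh b) *+ (mu a * mu b).
  rewrite !expr2 pder1_del pder2_del !mulr_suml -big_split; apply: eq_bigr => a _.
  rewrite !mulr_sumr -big_split; apply: eq_bigr => b _ /=.
  rewrite !mulrnAl !mulrnAr -!mulrnA -mulrnDl [(mu b * mu a)%N]mulnC; congr (_ *+ _).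
  by rewrite /cd pcD !pcM; ring.
rewrite E -[RHS]addr0 -[X in _ + X]cross_sum -big_split /= [LHS]big_seq [RHS]big_seq.
apply: eq_bigr => a aP; rewrite (bigD1_seq a) //=; congr (_ + _).
have -> : cd a a = 1 by rewrite /cd -(cs1 a) !expr2.
by rewrite pc1 mul1r -expr2 mulnn.
Qed.

(** Divided by [- del ^ 3], this says that the Laplacian of [1 / del] is [1 / del] times the sum of
    [mu_a (mu_a + 1) / L a ^ 2]: the function [1 / del] is annihilated by the Schroedinger
    operator. *)
Lemma lap_del :
  del * (pder1 (pder1 del) + pder2 (pder2 del)) - (pder1 del ^+ 2 + pder2 del ^+ 2) *+ 2 =
  - \sum_(a <- Pi) dh a ^+ 2 *+ (mu a * (mu a).+1).
Proof.
have H a : a \in Pi -> (del * Dv (- si a) (co a) (dh a)) *+ mu a =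
    (dh a * Dv (- si a) (co a) del - dh a ^+ 2) *+ mu a.
  move=> aP; case: (posnP (mu a)) => [->|ma]; first by rewrite !mulr0n.
  congr (_ *+ _); rewrite (delE aP ma) DvM Dv_L.
  have -> : co a * co a - si a * - si a = 1 by rewrite mulrN opprK -(cs1 a) !expr2.
  by rewrite pc1; ring.
have E : del * (pder1 (pder1 del) + pder2 (pder2 del)) =
    pder1 del ^+ 2 + pder2 del ^+ 2 - \sum_(a <- Pi) dh a ^+ 2 *+ mu a.
  transitivity (\sum_(a <- Pi) (del * Dv (- si a) (co a) (dh a)) *+ mu a).
    rewrite pder1_del pder2_del !(der_sum (@pder1D K)) !(der_sum (@pder2D K)).
    rewrite -big_split mulr_sumr; apply: eq_bigr => a _ /=.
    rewrite (derMn (@pder1D K)) (derMn (@pder2D K)) -mulrnDl mulrnAr.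
    congr (_ *+ _); congr (_ * _); rewrite /Dv pder1M pder2M -pcN !pder1C !pder2C; ring.
  rewrite !expr2 {2}pder1_del {2}pder2_del !mulr_sumr -big_split -sumrB /= [LHS]big_seq [RHS]big_seq.
  apply: eq_bigr => a aP; rewrite H // !mulrnAr -mulrnDl -mulrnBl /Dv pcN; congr (_ *+ _); ring.
rewrite E grad_del_sqr -sumrB -sumrMnl -sumrB -sumrN; apply: eq_bigr => a _.
by rewrite mulnS mulrnDr mulnn mulr2n; ring.
Qed.
End Arrangement.

(** * The Baker-Akhieser polynomial *)

Section Operator.
Variable K : comNzRingType.
Local Notation B := {poly {poly K}}.
Implicit Types (p q : B).
Variables (I : eqType) (Pi : seq I) (mu : I -> nat) (co si : I -> K) (kap : I -> I -> K).
Hypothesis uPi : uniq Pi.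
Hypothesis cs1 : forall a, co a ^+ 2 + si a ^+ 2 = 1.
Hypothesis sd_reg : forall a b, a \in Pi -> b \in Pi -> a != b -> forall x, sd co si a b * x = 0 -> x = 0.
Hypothesis kapE : forall a b, a \in Pi -> b \in Pi -> a != b -> cd co si a b = kap a b * sd co si a b.
Hypothesis BA : forall a, a \in Pi -> forall k, (k < mu a)%N ->
  \sum_(b <- Pi | b != a) kap a b ^+ k.*2.+1 *+ mu b = 0.
Variable nv : nat -> K.
Hypothesis nvK : forall n, nv n * n.+1%:R = 1.
Hypothesis newt : newton_odd K.
Variables e1 e2 : K.
Hypothesis c_reg : forall a, a \in Pi -> forall x, (co a * e2 - si a * e1) * x = 0 -> x = 0.

Local Notation del := (del Pi mu co si).
Local Notation L := (L co si).
Local Notation mtot := (mtot Pi mu).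
Local Notation T := (Dv e1 e2).

Definition QIall p := forall a, a \in Pi -> QI nv (co a) (si a) e1 e2 (mu a) p.

(** At each line [QI_top] kills the [mu a] lowest normal coefficients of the leading form;
    coprimality assembles the divisors. *)
Lemma QIall_top p d : QIall p -> dlt d.+1 p -> exists h, hpart d p = del * h.
Proof.
move=> Qp dp; rewrite /del -lock; apply: (prod_dvd cs1 sd_reg uPi) => // a aP.
apply/(lfX_dvdP (cs1 a)) => i k km.
have lh := dlt_rot (co a) (si a) (@dlt_hpart _ d p).
have gh := dge_rot (co a) (si a) (@dge_hpart _ d p).
have [dik|ikd|e] := ltngtP (i + k) d; [exact: gh | exact: lh |].
have /(dlt_rot (co a) (si a)) /(_ i k) := hpart_rest dp.
rewrite e leqnn rotB bcoefB => /(_ isT)/eqP; rewrite subr_eq0 => /eqP <-.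
have -> : i = (d - k)%N by rewrite -e addnK.
by apply: (QI_top nvK newt (c_reg aP) (Qp a aP)) => //; rewrite -e leq_addl.
Qed.

Lemma QIall_zero p : QIall p -> dlt mtot p -> p = 0.
Proof.
move=> Qp; suff H d : (d <= mtot)%N -> dlt d p -> p = 0 by apply: H.
elim: d => [|d IH] dm dp; first exact: dlt0.
apply: IH; first exact: ltnW.
have [h hE] := QIall_top Qp dp.
have h0 : h = 0.
  apply/dlt0/(dlt_delI (co := co) (si := si) cs1 (Pi := Pi) (mu := mu)).
  by rewrite -hE; apply: dlt_leq (@dlt_hpart _ d p).
by have := hpart_rest dp; rewrite hE h0 mulr0 subr0.
Qed.

(* By [lap_del], [Rop p = exp (- e.x) del^2 (H - e.e) (p exp (e.x) / del)] where [H] is the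
   Schroedinger operator; [MM] collects the terms containing [e] and [LL] the others. *)
Definition lapt p := td1 e1 (td1 e1 p) + td2 e2 (td2 e2 p) - pc (e1 ^+ 2 + e2 ^+ 2) * p.
Definition Rop p := del * lapt p - (pder1 del * td1 e1 p + pder2 del * td2 e2 p) *+ 2.
Definition LL p := del * (pder1 (pder1 p) + pder2 (pder2 p))
  - (pder1 del * pder1 p + pder2 del * pder2 p) *+ 2.
Definition MM p := (del * T p - p * T del) *+ 2.

Lemma laptE p : lapt p = pder1 (pder1 p) + pder2 (pder2 p) + T p *+ 2.
Proof.
rewrite /lapt /td1 /td2 pder1D pder2D pder1M pder2M pder1C pder2C /Dv !expr2 pcD !pcM.
ring.
Qed.
Lemma RopE p : Rop p = LL p + MM p.
Proof. by rewrite /Rop laptE /LL /MM /td1 /td2 /Dv; ring. Qed.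

Lemma td1D p q : td1 e1 (p + q) = td1 e1 p + td1 e1 q.
Proof. by rewrite /td1 pder1D; ring. Qed.
Lemma td2D p q : td2 e2 (p + q) = td2 e2 p + td2 e2 q.
Proof. by rewrite /td2 pder2D; ring. Qed.
Lemma td1CM k p : td1 e1 (pc k * p) = pc k * td1 e1 p.
Proof. by rewrite /td1 pder1M pder1C; ring. Qed.
Lemma td2CM k p : td2 e2 (pc k * p) = pc k * td2 e2 p.
Proof. by rewrite /td2 pder2M pder2C; ring. Qed.
Lemma td1N p : td1 e1 (- p) = - td1 e1 p.
Proof. by rewrite -mulN1r -pc1 -pcN td1CM pcN pc1 mulN1r. Qed.
Lemma td2N p : td2 e2 (- p) = - td2 e2 p.
Proof. by rewrite -mulN1r -pc1 -pcN td2CM pcN pc1 mulN1r. Qed.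
Lemma LLD p q : LL (p + q) = LL p + LL q.
Proof. by rewrite /LL !(pder1D, pder2D); ring. Qed.
Lemma MMD p q : MM (p + q) = MM p + MM q.
Proof. by rewrite /MM !DvD; ring. Qed.
Lemma RopD p q : Rop (p + q) = Rop p + Rop q.
Proof. by rewrite !RopE LLD MMD; ring. Qed.
Lemma RopCM k p : Rop (pc k * p) = pc k * Rop p.
Proof.
by rewrite !RopE /LL /MM /Dv !(pder1M, pder1C, pder2M, pder2C, mul0r, add0r); ring.
Qed.
Lemma RopN p : Rop (- p) = - Rop p.
Proof. by rewrite -mulN1r -pc1 -pcN RopCM pcN pc1 mulN1r. Qed.

Lemma dlt_Dv u v n p : dlt n p -> dlt n.-1 (Dv u v p).
Proof. by move=> dp; apply: dltD; apply: dltCM; [apply: dlt_pder1 | apply: dlt_pder2]. Qed.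
Lemma dge_Dv u v n p : dge n p -> dge n.-1 (Dv u v p).
Proof. by move=> dp; apply: dgeD; apply: dgeCM; [apply: dge_pder1 | apply: dge_pder2]. Qed.
Lemma dltMn n m p : dlt n p -> dlt n (p *+ m).
Proof. by move=> dp i j ij; rewrite !coefMn dp ?mul0rn. Qed.
Lemma dgeMn n m p : dge n p -> dge n (p *+ m).
Proof. by move=> dp i j ij; rewrite !coefMn dp ?mul0rn. Qed.

Lemma dlt_LL d p : dlt d.+1 p -> dlt (mtot + d).-1 (LL p).
Proof.
move=> dp; have dd : dlt mtot.+1 del by apply: dlt_del.
have := dlt_pder1 dp; have := dlt_pder2 dp; rewrite /= => p2 p1.
have := dlt_pder1 dd; have := dlt_pder2 dd; rewrite /= => D2 D1.
case: d {dp} p1 p2 => [|d] p1 p2.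
  rewrite /LL (dlt0 p1) (dlt0 p2) pder10 pder20 !mulr0 !addr0 mulr0 mul0rn subr0.
  exact: dlt_0.
apply: dltB.
  apply: dlt_leq (dltM dd (dltD (dlt_pder1 p1) (dlt_pder2 p2))).
  by rewrite /= addnS.
by apply: dltMn; apply: dltD; apply: dltM.
Qed.
Lemma dlt_MM d p : dlt d.+1 p -> dlt (mtot + d) (MM p).
Proof.
move=> dp; have dd : dlt mtot.+1 del by apply: dlt_del.
rewrite /MM; apply: dltMn; apply: dltB.
  exact: (dltM dd (dlt_Dv _ _ dp)).
by have := dltM dp (dlt_Dv _ _ dd); rewrite /= addnC.
Qed.
Lemma dge_MM d p : dge d p -> dge (mtot + d).-1 (MM p).
Proof.
move=> dp; have dd : dge mtot del by apply: dge_del.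
rewrite /MM; apply: dgeMn; apply: dgeB.
  by apply: dge_leq (dgeM dd (dge_Dv _ _ dp)); lia.
by apply: dge_leq (dgeM dp (dge_Dv _ _ dd)); lia.
Qed.
Lemma dlt_Rop d p : dlt d.+1 p -> dlt (mtot + d) (Rop p).
Proof.
move=> dp; rewrite RopE; apply: dltD; last exact: dlt_MM.
by apply: dlt_leq (dlt_LL dp); lia.
Qed.
Lemma dlt_Rel d p p' : del * p' = Rop p -> dlt d.+1 p -> dlt d p'.
Proof.
by move=> e dp; apply: (dlt_delI cs1 (mu := mu) (Pi := Pi)); rewrite e addnC; apply: dlt_Rop.
Qed.

Lemma iterT_linear n a q :
  iter n T (L a * q) = L a * iter n T q + (pc (co a * e2 - si a * e1) * iter n.-1 T q) *+ n.
Proof.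
elim: n => [|n IH]; first by rewrite /= addr0.
rewrite iterS IH DvD DvM Dv_L (derMn (@DvD K e1 e2)) DvM.
have -> k : T (pc k) = 0 by rewrite /Dv pder1C pder2C !mulr0 addr0.
rewrite mul0r add0r mulrS.
have -> : (pc (co a * e2 - si a * e1) * T (iter n.-1 T q)) *+ n =
          (pc (co a * e2 - si a * e1) * iter n T q) *+ n by case: n {IH}.
by rewrite -/(iter n.+1 T q) /=; ring.
Qed.

(** The value of [del] at [(e1, e2)]. *)
Definition dele : K := \prod_(a <- Pi) (co a * e2 - si a * e1) ^+ mu a.

Lemma dele_reg x : dele * x = 0 -> x = 0.
Proof.
rewrite /dele; set P := Pi; have : {subset P <= Pi} by [].
elim: P x => [|a r IH] x sP; first by rewrite big_nil mul1r.
have ca := c_reg (sP _ (mem_head _ _)).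
have sr : {subset r <= Pi} by move=> y yr; rewrite sP // inE yr orbT.
rewrite big_cons; elim: (mu a) => [|m IHm]; first by rewrite mul1r; apply: IH.
by rewrite exprS -!mulrA => /ca; rewrite mulrA; apply: IHm.
Qed.

Lemma Tpc k : T (pc k) = 0.
Proof. by rewrite /Dv pder1C pder2C !mulr0 addr0. Qed.

Lemma iterT_del : iter mtot T del = pc dele *+ mtot`! /\ iter mtot.+1 T del = 0.
Proof.
rewrite /del -lock /mtot /dele; elim: Pi => [|a r [CE CE0]].
  rewrite !big_nil; split; first by rewrite fact0 mulr1n pc1.
  by rewrite /= -pc1 Tpc.
rewrite !big_cons; elim: (mu a) => [|m [CE' CE0']]; first by rewrite !mul1r.
rewrite !exprS -!mulrA addSn; split; rewrite iterT_linear.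
  by rewrite CE0' mulr0 add0r CE' [in RHS]pcM factS mulnC mulrnA mulrnAr.
by rewrite iterS CE0' mulr0 mul0rn addr0 -pc0 Tpc mulr0.
Qed.

Lemma dlt_iterT n k p : dlt n p -> dlt (n - k) (iter k T p).
Proof.
move=> dp; elim: k => [|k IH]; first by rewrite subn0.
by rewrite /= subnS; apply: dlt_Dv.
Qed.

Lemma iterT_wronski k p : del * T p = p * T del -> del * iter k T p = p * iter k T del.
Proof.
move=> E; elim: k => [|k IH]; first by rewrite mulrC.
apply: (delI cs1 (mu := mu) (Pi := Pi)).
have := congr1 T IH; rewrite !DvM -!iterS => /(congr1 ( *%R del)).
rewrite !mulrDr [X in X + _ = _]mulrCA IH ![del * (T p * _)]mulrA E.
by rewrite mulrCA -!mulrA [T del * _]mulrC => /addrI.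
Qed.

Lemma bMn_reg n p : p *+ n.+1 = 0 -> p = 0.
Proof.
move=> e; apply: bpolyP => i j; rewrite !coef0; apply: (@natI _ _ nvK n).
by rewrite mul0rn -!coefMn e !coef0.
Qed.

(** [MM p = 0] says that [p / del] is constant along [e], whence [del T^k p = p T^k del] for all
    [k]. At [k = mtot] the left side vanishes by degree, while [T^k del] is [mtot!] times the
    regular constant [dele]. *)
Lemma MM_zero p : MM p = 0 -> dlt mtot p -> p = 0.
Proof.
move=> M0 dp; have E : del * T p = p * T del.
  apply/eqP; rewrite -subr_eq0; apply/eqP.
  exact: bMn_reg M0.
have [CE CE0] := iterT_del.
have Ts : iter mtot T p = 0.
  by apply: dlt0; have := @dlt_iterT _ mtot _ dp; rewrite subnn.
have := iterT_wronski mtot E; rewrite CE Ts mulr0.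
have := fact_gt0 mtot; case: (mtot`!) => // n _ /esym.
rewrite mulrnAr => /bMn_reg Cs; apply: bpolyP => i j; rewrite !coef0; apply: dele_reg.
by have := congr1 (fun q : B => q`_j`_i) Cs; rewrite mulrC bcoefCM !coef0.
Qed.

(** [MM] sends the homogeneous part of degree [d] to degree [mtot + d - 1]. If [MM p] has nothing
    there, [MM_zero] kills that part. *)
Lemma MM_drop d p : (d < mtot)%N -> dlt d.+1 p -> dlt (mtot + d).-1 (MM p) -> dlt d p.
Proof.
move=> dm dp dM; set s := hpart d p; have ds : dlt d (p - s) by apply: hpart_rest.
suff s0 : s = 0 by rewrite s0 subr0 in ds.
apply: MM_zero; last by apply: dlt_leq (dlt_hpart p (d := d)).
apply: (@dlt_dge _ (mtot + d).-1); last exact: (dge_MM (@dge_hpart _ d p)).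
have -> : MM s = MM p - MM (p - s).
  by rewrite -[in MM p](subrK s p) (MMD (p - s) s) addrAC subrr add0r.
apply: dltB => //; have [d0|dpos] := posnP d; last first.
  by rewrite -(prednK dpos) addnS; apply: dlt_MM; rewrite prednK.
have -> : p - s = 0 by apply: dlt0; rewrite -d0.
rewrite /MM /Dv pder10 pder20 !(mulr0, mul0r, addr0, subr0) mul0rn.
exact: dlt_0.
Qed.

(** Here [MM p = - LL p], and [LL] lowers degrees by one more than [MM] does, so [MM_drop] applies
    again and again. *)
Lemma Rop_zero p : Rop p = 0 -> dlt mtot p -> p = 0.
Proof.
move=> Rp; suff H d : (d <= mtot)%N -> dlt d p -> p = 0 by apply: H.
elim: d => [|d IH] dm dp; first exact: dlt0.
apply: IH; first exact: ltnW.
apply: MM_drop => //; have -> : MM p = - LL p.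
  by apply/eqP; rewrite -addr_eq0 addrC -RopE Rp.
by apply/dltN/dlt_LL.
Qed.
Local Notation dh := (dh Pi mu co si).

Definition tdn a p := pc (co a) * td2 e2 p - pc (si a) * td1 e1 p.

Lemma QIall_dvd p a : QIall p -> a \in Pi -> (0 < mu a)%N -> exists h, tdn a p = L a * h.
Proof.
move=> Qp aP ma; apply/(qs_col0 nvK (cs1 a) e1 e2) => i.
rewrite /tdn -(d2_qs nvK) -[LHS]/(qs nv (co a) (si a) e1 e2 p i 1%N) (Qp a aP) //.
by rewrite -[1%N]/(0.*2.+1) ltn_Sdouble.
Qed.

Lemma qs_lap c s p : c ^+ 2 + s ^+ 2 = 1 -> qs nv c s e1 e2 (lapt p) =
  d1 (d1 (qs nv c s e1 e2 p)) + d2 (d2 (qs nv c s e1 e2 p)) - kc (e1 ^+ 2 + e2 ^+ 2) * qs nv c s e1 e2 p.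
Proof.
move=> cs; rewrite !(d1_qs nvK) !(d2_qs nvK) -qsD -qsCM -qsB; congr qs.
have pcs : pc c ^+ 2 + pc s ^+ 2 = 1 :> B by rewrite !expr2 -!pcM -pcD -!expr2 cs pc1.
rewrite /lapt; move: (td1 e1 p) (td2 e2 p) => U V.
rewrite !(td1D, td2D, td1CM, td2CM, td1N, td2N).
move: (td1 e1 U) (td1 e1 V) (td2 e2 U) (td2 e2 V) => u v w z.
rewrite -[u in LHS]mul1r -[z in LHS]mul1r -pcs; ring.
Qed.

Lemma vanish_Y2X_shift b n i (f : ser K) :
  vanish b n f -> vanish (b (+) odd i) (n + i) (Y2 K ^+ i * f).
Proof.
move=> vf k j oj jn; rewrite scY2X; case: ltnP => // ij; apply: vf; last by lia.
by rewrite oddB // oj addbK.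
Qed.

Lemma qsMn c s p n : qs nv c s e1 e2 (p *+ n) = qs nv c s e1 e2 p *+ n.
Proof. by elim: n => [|n IH]; rewrite ?qs0 // !mulrS qsD IH. Qed.

(** The quotient is [lapt p] minus twice the sum of the [mu_b r_b], where [r_b] is the normal
    derivative at [b] divided by [L b]; it exists because the first odd coefficient vanishes.
    Stability at [a] is checked in the frame of [a]: its own term combines with the second normal
    derivative, and the other lines are treated together by the Baker-Akhieser identities. *)
Lemma QIall_stable p : QIall p -> exists2 p', del * p' = Rop p & QIall p'.
Proof.
move=> Qp.
have [r rE] : exists r : I -> B, forall a, a \in Pi -> (0 < mu a)%N -> tdn a p = L a * r a.
  exists (fun a => if pselect (exists h, tdn a p = L a * h) is left H then projT1 (cid H) else 0).
  move=> a aP ma; case: pselect => [H|[]]; last exact: QIall_dvd.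
  by case: cid.
have delr a : a \in Pi -> (del * r a) *+ mu a = (dh a * tdn a p) *+ mu a.
  move=> aP; case: (posnP (mu a)) => [->//|ma].
  by rewrite (delE co si uPi aP ma) rE //; congr (_ *+ _); ring.
pose p' := lapt p - (\sum_(a <- Pi) r a *+ mu a) *+ 2.
exists p'.
  rewrite /p' mulrBr mulrnAr mulr_sumr /Rop; congr (_ - _ *+ 2).
  rewrite pder1_del // pder2_del // !mulr_suml -big_split [LHS]big_seq [RHS]big_seq /=.
  apply: eq_bigr => a aP; rewrite mulrnAr delr // !mulrnAl -mulrnDl /tdn; congr (_ *+ _); ring.
move=> a aP; case: (posnP (mu a)) => [m0|ma]; first by rewrite m0.
rewrite /QI /p' qsB qs_lap //; set q := qs nv (co a) (si a) e1 e2 p.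
have V : vanish true (mu a).*2 q by apply: Qp.
rewrite qsMn (bigD1_seq a) //= qsD mulrnDl qsMn -mulrnA.
set rho := qs _ _ _ _ _ (\sum_(_ <- _ | _) _).
set ra := qs _ _ _ _ _ (r a).
have -> : d1 (d1 q) + d2 (d2 q) - kc (e1 ^+ 2 + e2 ^+ 2) * q - (ra *+ (mu a * 2) + rho *+ 2) =
  (d1 (d1 q) - kc (e1 ^+ 2 + e2 ^+ 2) * q) + (d2 (d2 q) - ra *+ (mu a * 2)) - rho *+ 2 by ring.
have raE : Y2 K * ra = d2 q.
  by rewrite /ra /q d2_qs // -/(tdn a p) rE // qsM rot_lf // pinX2.
apply: vanishB; [apply: vanishD; [apply: vanishB|]|].
- by do 2 apply: vanish_d1.
- exact: vanishCM.
(* Column [j] of this difference is column [j + 2] of [q] times [(j + 2) (j + 1 - 2 mu_a)]. For odd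
   [j < 2 mu_a], either [j + 2 < 2 mu_a] and the column vanishes, or [j = 2 mu_a - 1] and the factor
   does. *)
- move=> i j oj jn; rewrite scB scMn.
  have -> : ra i j = q i j.+2 *+ j.+2.
    by have := congr1 (fun f : ser K => f i j.+1) raE; rewrite scY2M.
  rewrite -[d2 (d2 q) i j]/(q i j.+2 *+ j.+2 *+ j.+1).
  have [jn2|] := ltnP j.+2 (mu a).*2; first by rewrite V ?mul0rn ?subrr //= negbK.
  move=> jn2; rewrite (_ : j.+1 = (mu a * 2)%N) ?subrr //.
  by rewrite muln2; move: oj jn jn2; have := odd_double (mu a); lia.
have -> : rho *+ 2 = rho + rho by rewrite mulr2n.
suff vr : vanish true (mu a).*2 rho by apply: vanishD.
set N := (mu a).*2.
(* A factor [x1^N] does not mix columns, and makes room for the geometric expansion of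
   [1 / (x1 - kap x2)] modulo [x2^N]. *)
apply/(@vanish_Y1X _ true N N).
have sdr b : b \in Pi -> b != a ->
    (Y1 K - kc (kap a b) * Y2 K) * qs nv (co a) (si a) e1 e2 (r b *+ mu b) =
    (d1 q - kc (kap a b) * d2 q) *+ mu b.
  move=> bP ba; case: (posnP (mu b)) => [->|mb]; first by rewrite !mulr0n qs0 mulr0.
  rewrite qsMn mulrnAr; congr (_ *+ _).
  apply/eqP; rewrite -subr_eq0; apply/eqP/serP => i j; rewrite sc0.
  apply: (@sd_reg a b) => //; first by rewrite eq_sym.
  rewrite -scCM (_ : kc _ * _ = 0) //.
  have Hr := congr1 (qs nv (co a) (si a) e1 e2) (rE b bP mb).
  rewrite qsM rot_L pinB !pinM !pinC pinX1 pinX2 kapE // 1?eq_sym // kcM in Hr.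
  have Ht : qs nv (co a) (si a) e1 e2 (tdn b p) =
      kc (kap a b) * kc (sd co si a b) * d2 q - kc (sd co si a b) * d1 q.
    rewrite -kcM -kapE // 1?eq_sym // /q d1_qs // d2_qs // -!qsCM -qsB; congr qs.
    rewrite /tdn; move: (td1 e1 p) (td2 e2 p) => u v.
    have pcs : pc (co a) ^+ 2 + pc (si a) ^+ 2 = 1 :> B by rewrite !expr2 -!pcM -pcD -!expr2 cs1 pc1.
    rewrite /cd /sd pcD pcD pcN !pcM -[u in LHS]mul1r -[v in LHS]mul1r -pcs; ring.
  move: Hr; rewrite {}Ht => Hr.
  transitivity ((kc (kap a b) * kc (sd co si a b) * d2 q - kc (sd co si a b) * d1 q) -
    (kc (kap a b) * kc (sd co si a b) * Y2 K - kc (sd co si a b) * Y1 K) * qs nv (co a) (si a) e1 e2 (r b)).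
    ring.
  by rewrite Hr subrr.
have geom b : b \in Pi -> b != a -> Y1 K ^+ N * qs nv (co a) (si a) e1 e2 (r b *+ mu b) =
    \sum_(i < N) Y1 K ^+ (N.-1 - i) * (Y2 K ^+ i *
      (kc (kap a b ^+ i *+ mu b) * d1 q - kc (kap a b ^+ i.+1 *+ mu b) * d2 q))
    + Y2 K ^+ N * (kc (kap a b) ^+ N * qs nv (co a) (si a) e1 e2 (r b *+ mu b)).
  move=> bP ba; rewrite -[X in X * _](subrK ((kc (kap a b) * Y2 K) ^+ N)) subrXX mulrDl.
  rewrite mulrAC sdr // exprMn mulrA [kc _ ^+ N * Y2 K ^+ N]mulrC; congr (_ + _).
  rewrite mulrC mulr_suml; apply: eq_bigr => i _.
  rewrite -!mulrA; congr (_ * _); rewrite exprMn exprS !(rmorphMn (@kc K)) /= !(rmorphXn (@kc K)) /= kcM (rmorphXn (@kc K)) /=.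
  rewrite !mulrnAl -mulrnBl mulrnAr mulrnAr; congr (_ *+ _); ring.
rewrite /rho qs_sum mulr_sumr big_seq_cond.
under eq_bigr => b /andP[bP ba] do rewrite geom //.
rewrite -big_seq_cond big_split /= exchange_big /= -mulr_sumr.
apply: vanishD; last exact: vanish_Y2X.
apply: vanish_sum => i _; rewrite -!mulr_sumr; apply/vanish_Y1X.
rewrite sumrB -!mulr_suml -!(rmorph_sum (@kc K)) /=.
have iN : (i < (mu a).*2)%N := ltn_ord i.
(* Summed over [b], the odd powers of [kap] cancel. What survives is [x2^i d1 q] for even [i] and
   [x2^i d2 q] for odd [i], both without odd columns below [N]. *)
have [oi|ei] := boolP (odd i).
  have ei : (i : nat) = (i./2).*2.+1 by rewrite -[LHS]odd_double_half oi.
  rewrite [in X in kc X * d1 q]ei BA //; last by lia.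
  rewrite (rmorph0 (@kc K)) mul0r sub0r mulrN; apply: vanishN.
  have := @vanish_Y2X_shift false N.-1 i (kc (\sum_(b <- Pi | b != a) kap a b ^+ i.+1 *+ mu b) * d2 q).
  rewrite oi /= => H; apply: vanish_leq (H _); first by lia.
  by apply: vanishCM; apply: (@vanish_d2 _ true); rewrite prednK // /N double_gt0.
have ei' : i.+1 = (i./2).*2.+1 by rewrite -[in LHS](odd_double_half i) (negbTE ei).
rewrite [in X in kc X * d2 q]ei' BA //; last by lia.
rewrite (rmorph0 (@kc K)) mul0r subr0.
have := @vanish_Y2X_shift true N i (kc (\sum_(b <- Pi | b != a) kap a b ^+ i *+ mu b) * d1 q).
rewrite (negbTE ei) /= => H; apply: vanish_leq (H _); first by lia.
by apply: vanishCM; apply: vanish_d1.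
Qed.
Lemma QIall_iterates : exists p : nat -> B,
  [/\ p 0%N = del ^+ 2, forall k, del * p k.+1 = Rop (p k) & forall k, QIall (p k)].
Proof.
have step p : exists p', QIall p -> del * p' = Rop p /\ QIall p'.
  (* The default 0 concerns only a [p] that is not quasi-invariant, and no iterate is of this
     kind. *)
  have [/(QIall_stable)[p' pE Qp']|nQ] := EM (QIall p); last by exists 0.
  by exists p'.
pose next p := projT1 (cid (step p)).
exists (fun k => iter k next (del ^+ 2)).
have Q k : QIall (iter k next (del ^+ 2)).
  elim: k => [|k IH]; last by have [] := projT2 (cid (step (iter k next (del ^+ 2)))) IH.
  move=> a aP; rewrite /= /del -lock (bigD1_seq a) //= exprMn -exprM muln2.
  exact: QI_lfX.
by split=> // k; have [] := projT2 (cid (step (iter k next (del ^+ 2)))) (Q k).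
Qed.

Lemma MM_delM g : MM (del * g) = (del ^+ 2 * T g) *+ 2.
Proof. by rewrite /MM DvM; ring. Qed.

(** On [del * g] the operator [MM] gives [2 del^2 T g], so each step contributes a factor 2 and one
    derivative along [e] to the top part; [LL] reaches only lower degrees. *)
Lemma iterates_top (p : nat -> B) : p 0%N = del ^+ 2 -> (forall k, del * p k.+1 = Rop (p k)) ->
  forall k, (k <= mtot)%N -> dlt (mtot.*2 - k) (p k - del * (iter k T del *+ 2 ^ k)).
Proof.
move=> p0 pS; have dd : dlt mtot.+1 del by apply: dlt_del.
elim=> [|k IH] km; first by rewrite p0 expr2 /= mulr1n subrr; apply: dlt_0.
have {}IH := IH (ltnW km); set g := iter k T del *+ 2 ^ k in IH.
set s := p k - _ in IH; pose d := (mtot.*2 - k)%N.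
have dg : dlt d.+1 (del * g).
  have := dltM dd (@dltMn _ (2 ^ k)%N _ (@dlt_iterT _ k _ dd)).
  by apply: dlt_leq; rewrite /d; lia.
have -> : iter k.+1 T del *+ 2 ^ k.+1 = T g *+ 2.
  by rewrite iterS /g (derMn (@DvD K e1 e2)) expnS mulnC mulrnA.
apply: (dlt_delI cs1 (mu := mu) (Pi := Pi)).
have -> : del * (p k.+1 - del * (T g *+ 2)) = LL (del * g) + (LL s + MM s).
  rewrite mulrBr pS -(subrK (del * g) (p k)) -/s RopD !RopE MM_delM; ring.
have e : (mtot.*2 - k.+1 + mtot = (mtot + d).-1)%N by rewrite /d; lia.
rewrite e; apply: dltD; first exact: dlt_LL.
apply: dltD; first by apply: dlt_LL => //; apply: dlt_leq IH; rewrite /d; lia.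
rewrite (_ : (mtot + d).-1 = (mtot + d.-1)%N); last by rewrite /d; lia.
by apply: dlt_MM => //; rewrite prednK // /d; lia.
Qed.

(** After [mtot] steps the top part has become a constant multiple of [dele * del]. One step further
    the degree is below [mtot], where quasi-invariance forces zero; this is why [Rop] kills the
    iterate of index [mtot]. *)
Lemma BA_function : exists (p : nat -> B) (s : B),
  [/\ p 0%N = del ^+ 2, forall k, del * p k.+1 = Rop (p k), forall k, QIall (p k),
      Rop (p mtot) = 0 & p mtot = (pc dele * del) *+ (2 ^ mtot * mtot`!) + s /\ dlt mtot s].
Proof.
have [p [p0 pS Qp]] := QIall_iterates; have top := iterates_top p0 pS.
have [CE _] := iterT_del.
exists p, (p mtot - (pc dele * del) *+ (2 ^ mtot * mtot`!)).
have ds : dlt mtot (p mtot - (pc dele * del) *+ (2 ^ mtot * mtot`!)).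
  have := top _ (leqnn mtot); rewrite CE -mulrnA mulrnAr -addnn addnK.
  by rewrite [(mtot`! * _)%N]mulnC [del * _]mulrC.
split=> //; last by rewrite addrC subrK.
rewrite -pS (QIall_zero (Qp mtot.+1)) ?mulr0 //.
apply: (dlt_Rel (pS mtot)).
rewrite -(subrK ((pc dele * del) *+ (2 ^ mtot * mtot`!)) (p mtot)); apply: dltD.
  exact: dlt_leq ds.
by apply: dltMn; apply: dltCM; apply: dlt_del.
Qed.
End Operator.

(** * Bispectral symmetry *)

Section Coefwise.
Variables (K : comNzRingType) (phi : K -> K).
Local Notation B := {poly {poly K}}.
Hypothesis phiD : forall x y, phi (x + y) = phi x + phi y.
Implicit Types p q : B.

Definition ext p : B := map_poly (map_poly phi) p.

Lemma bcoef_ext p i j : (ext p)`_j`_i = phi p`_j`_i.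
Proof.
have phi0 : phi 0 = 0 by apply: (addrI (phi 0)); rewrite -phiD !addr0.
by rewrite coef_map_id0 ?map_poly0 // coef_map_id0.
Qed.
Lemma extD p q : ext (p + q) = ext p + ext q.
Proof. by apply: bpolyP => i j; rewrite bcoefD !bcoef_ext bcoefD phiD. Qed.
Lemma extC k : ext (pc k) = pc (phi k).
Proof.
have phi0 : phi 0 = 0 by apply: (addrI (phi 0)); rewrite -phiD !addr0.
apply: bpolyP => i j; rewrite bcoef_ext !coefC; case: j => [|j] /=; last by rewrite !coef0.
by rewrite !coefC; case: i.
Qed.
Lemma ext_pder1 p : ext (pder1 p) = pder1 (ext p).
Proof. by apply: bpolyP => i j; rewrite bcoef1 !bcoef_ext bcoef1 (derMn phiD). Qed.
Lemma ext_pder2 p : ext (pder2 p) = pder2 (ext p).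
Proof. by apply: bpolyP => i j; rewrite bcoef2 !bcoef_ext bcoef2 (derMn phiD). Qed.
Lemma dlt_ext n p : dlt n p -> dlt n (ext p).
Proof.
have phi0 : phi 0 = 0 by apply: (addrI (phi 0)); rewrite -phiD !addr0.
by move=> dp i j ij; rewrite bcoef_ext dp.
Qed.

Hypothesis phiM : forall x y, phi (x * y) = phi x * y + x * phi y.
Lemma extM p q : ext (p * q) = ext p * q + p * ext q.
Proof.
apply: bpolyP => i j; rewrite bcoefD !bcoefM bcoef_ext bcoefM (der_sum phiD) -big_split.
apply: eq_bigr => b _; rewrite (der_sum phiD) -big_split; apply: eq_bigr => a _.
by rewrite phiM !bcoef_ext.
Qed.
Lemma extX1 : ext (pX1 K) = 0.
Proof.
apply: bpolyP => i j; rewrite bcoef_ext coef0 coef0 coefC; case: eqP => _; rewrite ?coef0 ?(der0 phiD) //.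
by rewrite coefX; case: eqP => _; rewrite ?(der0 phiD) ?(der1 phiM).
Qed.
Lemma extX2 : ext (pX2 K) = 0.
Proof.
apply: bpolyP => i j; rewrite bcoef_ext coef0 coef0 coefX; case: eqP => _; rewrite ?coef0 ?(der0 phiD) //.
by rewrite coef1; case: eqP => _; rewrite ?(der0 phiD) ?(der1 phiM).
Qed.
End Coefwise.

Section Swap.
Variable F : comNzRingType.
Local Notation K := {poly {poly F}}.
Local Notation B := {poly {poly K}}.
Local Notation X1 := (pX1 K).
Local Notation X2 := (pX2 K).
Local Notation z1 := (pc (pX1 F) : B).
Local Notation z2 := (pc (pX2 F) : B).
Implicit Types p q : B.

(* [K] is [F[z1, z2]] and [B] is [K[x1, x2]]; [sw] exchanges [x] and [z]. *)
Definition psi : K -> B := bev ((@pc K) \o (@pc F)) X1 X2.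
HB.instance Definition _ := GRing.RMorphism.on psi.
Definition sw : B -> B := bev psi z1 z2.
HB.instance Definition _ := GRing.RMorphism.on sw.
Definition Dz1 : B -> B := ext (@pder1 F).
Definition Dz2 : B -> B := ext (@pder2 F).

Lemma psiC c : psi (pc c) = pc (pc c). Proof. exact: bevC. Qed.
Lemma psiX1 : psi (pX1 F) = X1. Proof. exact: bevX1. Qed.
Lemma psiX2 : psi (pX2 F) = X2. Proof. exact: bevX2. Qed.
Lemma psiD x y : psi (x + y) = psi x + psi y. Proof. exact: rmorphD. Qed.
Lemma psiM x y : psi (x * y) = psi x * psi y. Proof. exact: rmorphM. Qed.
Lemma swC k : sw (pc k) = psi k. Proof. exact: bevC. Qed.
Lemma swX1 : sw X1 = z1. Proof. exact: bevX1. Qed.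
Lemma swX2 : sw X2 = z2. Proof. exact: bevX2. Qed.
Lemma swD p q : sw (p + q) = sw p + sw q. Proof. exact: rmorphD. Qed.
Lemma swM p q : sw (p * q) = sw p * sw q. Proof. exact: rmorphM. Qed.
Lemma swN p : sw (- p) = - sw p. Proof. exact: rmorphN. Qed.
Lemma swB p q : sw (p - q) = sw p - sw q. Proof. by rewrite swD swN. Qed.
Lemma swMn p n : sw (p *+ n) = sw p *+ n. Proof. exact: rmorphMn. Qed.
Lemma sw0 : sw 0 = 0. Proof. exact: rmorph0. Qed.

Lemma psi_sw k : sw (psi k) = pc k.
Proof.
elim/bpoly_ind: k => [c|p q ep eq|p ep|p ep].
- by rewrite psiC swC psiC.
- by rewrite psiD swD ep eq pcD.
- by rewrite psiM swM ep psiX1 swX1 pcM.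
- by rewrite psiM swM ep psiX2 swX2 pcM.
Qed.
Lemma swK : involutive sw.
Proof.
elim/bpoly_ind => [k|p q ep eq|p ep|p ep].
- by rewrite swC psi_sw.
- by rewrite !swD ep eq.
- by rewrite !swM ep swX1 swC psiX1.
- by rewrite !swM ep swX2 swC psiX2.
Qed.

Lemma Dz1D p q : Dz1 (p + q) = Dz1 p + Dz1 q. Proof. exact: (extD (@pder1D F)). Qed.
Lemma Dz2D p q : Dz2 (p + q) = Dz2 p + Dz2 q. Proof. exact: (extD (@pder2D F)). Qed.
Lemma Dz1M p q : Dz1 (p * q) = Dz1 p * q + p * Dz1 q.
Proof. exact: (extM (@pder1D F) (@pder1M F)). Qed.
Lemma Dz2M p q : Dz2 (p * q) = Dz2 p * q + p * Dz2 q.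
Proof. exact: (extM (@pder2D F) (@pder2M F)). Qed.
Lemma Dz1C k : Dz1 (pc k) = pc (pder1 k). Proof. exact: (extC (@pder1D F)). Qed.
Lemma Dz2C k : Dz2 (pc k) = pc (pder2 k). Proof. exact: (extC (@pder2D F)). Qed.
Lemma Dz1X1 : Dz1 X1 = 0. Proof. exact: (extX1 (@pder1D F) (@pder1M F)). Qed.
Lemma Dz1X2 : Dz1 X2 = 0. Proof. exact: (extX2 (@pder1D F) (@pder1M F)). Qed.
Lemma Dz2X1 : Dz2 X1 = 0. Proof. exact: (extX1 (@pder2D F) (@pder2M F)). Qed.
Lemma Dz2X2 : Dz2 X2 = 0. Proof. exact: (extX2 (@pder2D F) (@pder2M F)). Qed.
Lemma Dz1_pder1 p : Dz1 (pder1 p) = pder1 (Dz1 p). Proof. exact: (ext_pder1 (@pder1D F)). Qed.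
Lemma Dz1_pder2 p : Dz1 (pder2 p) = pder2 (Dz1 p). Proof. exact: (ext_pder2 (@pder1D F)). Qed.
Lemma Dz2_pder1 p : Dz2 (pder1 p) = pder1 (Dz2 p). Proof. exact: (ext_pder1 (@pder2D F)). Qed.
Lemma Dz2_pder2 p : Dz2 (pder2 p) = pder2 (Dz2 p). Proof. exact: (ext_pder2 (@pder2D F)). Qed.

Lemma pder1_psi k : pder1 (psi k) = psi (pder1 k).
Proof.
apply: (@derivation_unique _ _ psi (fun k => pder1 (psi k)) (fun k => psi (pder1 k)))
  => {k} [p q|p q|p q|p q|c||].
- by rewrite psiD pder1D.
- by rewrite pder1D psiD.
- by rewrite psiM pder1M.
- by rewrite pder1M psiD !psiM.
- by rewrite psiC !pder1C rmorph0.
- by rewrite psiX1 !pder1X1 rmorph1.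
- by rewrite psiX2 !pder1X2 rmorph0.
Qed.
Lemma pder2_psi k : pder2 (psi k) = psi (pder2 k).
Proof.
apply: (@derivation_unique _ _ psi (fun k => pder2 (psi k)) (fun k => psi (pder2 k)))
  => {k} [p q|p q|p q|p q|c||].
- by rewrite psiD pder2D.
- by rewrite pder2D psiD.
- by rewrite psiM pder2M.
- by rewrite pder2M psiD !psiM.
- by rewrite psiC !pder2C rmorph0.
- by rewrite psiX1 !pder2X1 rmorph0.
- by rewrite psiX2 !pder2X2 rmorph1.
Qed.

Lemma pder1_sw p : pder1 (sw p) = sw (Dz1 p).
Proof.
apply: (@derivation_unique _ _ sw (fun p => pder1 (sw p)) (fun p => sw (Dz1 p)))
  => {p} [p q|p q|p q|p q|k||].
- by rewrite swD pder1D.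
- by rewrite Dz1D swD.
- by rewrite swM pder1M.
- by rewrite Dz1M swD !swM.
- by rewrite Dz1C !swC pder1_psi.
- by rewrite swX1 pder1C Dz1X1 sw0.
- by rewrite swX2 pder1C Dz1X2 sw0.
Qed.
Lemma pder2_sw p : pder2 (sw p) = sw (Dz2 p).
Proof.
apply: (@derivation_unique _ _ sw (fun p => pder2 (sw p)) (fun p => sw (Dz2 p)))
  => {p} [p q|p q|p q|p q|k||].
- by rewrite swD pder2D.
- by rewrite Dz2D swD.
- by rewrite swM pder2M.
- by rewrite Dz2M swD !swM.
- by rewrite Dz2C !swC pder2_psi.
- by rewrite swX1 pder2C Dz2X1 sw0.
- by rewrite swX2 pder2C Dz2X2 sw0.
Qed.
Lemma sw_pder1 p : sw (pder1 p) = Dz1 (sw p).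
Proof. by rewrite -[in LHS](swK p) pder1_sw swK. Qed.
Lemma sw_pder2 p : sw (pder2 p) = Dz2 (sw p).
Proof. by rewrite -[in LHS](swK p) pder2_sw swK. Qed.

Lemma dlt_psi n k : dlt n k -> dlt n (psi k).
Proof.
move=> dk; rewrite /psi bevE; apply: dlt_sum => j _; apply: dlt_sum => i _ /=.
have [ij|ij] := leqP n (i + j); first by rewrite dk // !rmorph0 !mul0r; apply: dlt_0.
rewrite -mulrA; apply: dltCM.
by apply: dlt_leq (dltM (dltX (n := i) (@dltX1 K)) (dltX (n := j) (@dltX2 K))); lia.
Qed.

Lemma dlt_sw n p : (forall i j, dlt n p`_j`_i) -> dlt n (sw p).
Proof.
move=> dp; rewrite /sw bevE; apply: dlt_sum => j _; apply: dlt_sum => i _ /=.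
rewrite -!(rmorphXn (@pc K)) -mulrA -pcM mulrC; apply: dltCM.
exact: dlt_psi.
Qed.
End Swap.

(* [bR / del], [bG / dele] and [bN] span the sl_2 behind the bispectral duality; accordingly
   [bG] sends what [bR] and [bN] kill to what [bR] kills. *)
Section Bispectral.
Variables (S : comNzRingType) (d1 d2 D1 D2 : S -> S).
Hypotheses (d1D : forall p q, d1 (p + q) = d1 p + d1 q) (d2D : forall p q, d2 (p + q) = d2 p + d2 q).
Hypotheses (D1D : forall p q, D1 (p + q) = D1 p + D1 q) (D2D : forall p q, D2 (p + q) = D2 p + D2 q).
Hypotheses (d1M : forall p q, d1 (p * q) = d1 p * q + p * d1 q)
  (d2M : forall p q, d2 (p * q) = d2 p * q + p * d2 q)
  (D1M : forall p q, D1 (p * q) = D1 p * q + p * D1 q)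
  (D2M : forall p q, D2 (p * q) = D2 p * q + p * D2 q).
Hypotheses (D1d1 : forall p, D1 (d1 p) = d1 (D1 p)) (D1d2 : forall p, D1 (d2 p) = d2 (D1 p))
  (D2d1 : forall p, D2 (d1 p) = d1 (D2 p)) (D2d2 : forall p, D2 (d2 p) = d2 (D2 p)).
Variables (x1 x2 z1 z2 del dele : S) (m : nat).
Hypotheses (d1x1 : d1 x1 = 1) (d1x2 : d1 x2 = 0) (d2x1 : d2 x1 = 0) (d2x2 : d2 x2 = 1).
Hypotheses (d1z1 : d1 z1 = 0) (d1z2 : d1 z2 = 0) (d2z1 : d2 z1 = 0) (d2z2 : d2 z2 = 0).
Hypotheses (D1x1 : D1 x1 = 0) (D1x2 : D1 x2 = 0) (D2x1 : D2 x1 = 0) (D2x2 : D2 x2 = 0).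
Hypotheses (D1z1 : D1 z1 = 1) (D1z2 : D1 z2 = 0) (D2z1 : D2 z1 = 0) (D2z2 : D2 z2 = 1).
Hypotheses (D1del : D1 del = 0) (D2del : D2 del = 0) (d1dele : d1 dele = 0) (d2dele : d2 dele = 0).
Hypothesis euler_del : x1 * d1 del + x2 * d2 del = del *+ m.
Hypothesis euler_dele : z1 * D1 dele + z2 * D2 dele = dele *+ m.

Let t1 p := d1 p + z1 * p.
Let t2 p := d2 p + z2 * p.
Let T1 p := D1 p + x1 * p.
Let T2 p := D2 p + x2 * p.
Definition bR p := del * (t1 (t1 p) + t2 (t2 p) - (z1 ^+ 2 + z2 ^+ 2) * p)
  - (d1 del * t1 p + d2 del * t2 p) *+ 2.
Definition bG p := dele * (T1 (T1 p) + T2 (T2 p) - (x1 ^+ 2 + x2 ^+ 2) * p)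
  - (D1 dele * T1 p + D2 dele * T2 p) *+ 2.
Definition bN p := z1 * D1 p + z2 * D2 p - x1 * d1 p - x2 * d2 p.

Let d10 : d1 0 = 0 := der0 d1D.
Let d20 : d2 0 = 0 := der0 d2D.
Let D10 : D1 0 = 0 := der0 D1D.
Let D20 : D2 0 = 0 := der0 D2D.
Let dD := (d1D, d2D, D1D, D2D, derN d1D, derN d2D, derN D1D, derN D2D,
  derMn d1D, derMn d2D, derMn D1D, derMn D2D).
Let dM := (d1M, d2M, D1M, D2M).
Let dx := (d1x1, d1x2, d2x1, d2x2, d1z1, d1z2, d2z1, d2z2, D1x1, D1x2, D2x1, D2x2,
  D1z1, D1z2, D2z1, D2z2, D1del, D2del, d1dele, d2dele, d10, d20, D10, D20, der1 d1M, der1 d2M, der1 D1M, der1 D2M).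

Lemma bRD p q : bR (p + q) = bR p + bR q.
Proof. by rewrite /bR /t1 /t2 !(dD, dM, dx); ring. Qed.
Lemma bRZ k p : d1 k = 0 -> d2 k = 0 -> bR (k * p) = k * bR p.
Proof. by move=> k1 k2; rewrite /bR /t1 /t2 !(dD, dM, dx, k1, k2); ring. Qed.
Lemma bRN p : bR (- p) = - bR p.
Proof. by apply: (addrI (bR p)); rewrite -bRD !subrr /bR /t1 /t2 !(dx, mulr0, addr0, mul0rn, subr0). Qed.
Lemma bRB p q : bR (p - q) = bR p - bR q. Proof. by rewrite bRD bRN. Qed.
Lemma bRMn p n : bR (p *+ n) = bR p *+ n. Proof. exact: (derMn bRD). Qed.

Lemma bR_T1 p : bR (T1 p) = T1 (bR p) + (del * z1 * p) *+ 2.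
Proof.
rewrite /bR /t1 /t2 /T1 !expr2 !(dD, dM, D1d1, D1d2, dx); ring.
Qed.
Lemma bR_T2 p : bR (T2 p) = T2 (bR p) + (del * z2 * p) *+ 2.
Proof.
rewrite /bR /t1 /t2 /T2 !expr2 !(dD, dM, D2d1, D2d2, dx); ring.
Qed.
Lemma bR_x1 p : bR (x1 * p) = x1 * bR p + (del * t1 p - d1 del * p) *+ 2.
Proof. by rewrite /bR /t1 /t2 !(dD, dM, dx); ring. Qed.
Lemma bR_x2 p : bR (x2 * p) = x2 * bR p + (del * t2 p - d2 del * p) *+ 2.
Proof. by rewrite /bR /t1 /t2 !(dD, dM, dx); ring. Qed.

(** The commutators of [bR] with the [T_i] and the [x_i], from which [bG] is built, are of first
    order. Given [bR p = 0], everything collects into [4 dele del bN p] and the Euler expressions of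
    [del] and [dele], which cancel because both have the same degree [m]. *)
Lemma bR_bG p : bR p = 0 -> bN p = 0 -> bR (bG p) = 0.
Proof.
move=> R0 N0.
have RT1 : bR (T1 p) = (del * z1 * p) *+ 2 by rewrite bR_T1 R0 /T1 !(dx, mulr0, addr0, add0r).
have RT2 : bR (T2 p) = (del * z2 * p) *+ 2 by rewrite bR_T2 R0 /T2 !(dx, mulr0, addr0, add0r).
have RTT1 : bR (T1 (T1 p)) = (del * p) *+ 2 + (del * z1 * T1 p) *+ 4.
  by rewrite bR_T1 RT1 /T1 !(dD, dM, dx); ring.
have RTT2 : bR (T2 (T2 p)) = (del * p) *+ 2 + (del * z2 * T2 p) *+ 4.
  by rewrite bR_T2 RT2 /T2 !(dD, dM, dx); ring.
have Rx1 : bR (x1 * p) = (del * t1 p - d1 del * p) *+ 2 by rewrite bR_x1 R0 mulr0 add0r.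
have Rx2 : bR (x2 * p) = (del * t2 p - d2 del * p) *+ 2 by rewrite bR_x2 R0 mulr0 add0r.
have Rxx1 : bR (x1 ^+ 2 * p) = (x1 * (del * t1 p - d1 del * p)) *+ 4 + (del * p) *+ 2.
  by rewrite expr2 -mulrA bR_x1 Rx1 /t1 !(dD, dM, dx); ring.
have Rxx2 : bR (x2 ^+ 2 * p) = (x2 * (del * t2 p - d2 del * p)) *+ 4 + (del * p) *+ 2.
  by rewrite expr2 -mulrA bR_x2 Rx2 /t2 !(dD, dM, dx); ring.
have c1 : d1 (D1 dele) = 0 by rewrite -D1d1 d1dele D10.
have c2 : d2 (D1 dele) = 0 by rewrite -D1d2 d2dele D10.
have c3 : d1 (D2 dele) = 0 by rewrite -D2d1 d1dele D20.
have c4 : d2 (D2 dele) = 0 by rewrite -D2d2 d2dele D20.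
rewrite /bG bRB (bRZ _ d1dele d2dele) bRMn (bRD (D1 dele * T1 p)) (bRZ _ c1 c2) (bRZ _ c3 c4).
rewrite bRB (bRD (T1 (T1 p))) mulrDl (bRD (x1 ^+ 2 * p)).
rewrite RTT1 RTT2 RT1 RT2 Rxx1 Rxx2.
transitivity ((dele * del * bN p) *+ 4 + (dele * p * (x1 * d1 del + x2 * d2 del)) *+ 4
    - (del * p * (z1 * D1 dele + z2 * D2 dele)) *+ 4).
  by rewrite /bN /t1 /t2 /T1 /T2; ring.
by rewrite N0 euler_del euler_dele; ring.
Qed.

Lemma bN_del : bN del = - (del *+ m).
Proof. by rewrite /bN !dx -euler_del; ring. Qed.

Hypothesis d1d2 : forall p, d1 (d2 p) = d2 (d1 p).
(** [bN] is the Euler operator in [z] minus the one in [x], and [bR] is homogeneous of weight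
    [2 - m] for it. *)
Lemma bN_bR p : bN (bR p) = bR (bN p) + bR p *+ 2 - bR p *+ m.
Proof.
have N_t1 q : bN (t1 q) = t1 (bN q) + t1 q.
  by rewrite /bN /t1 !(dD, dM, D1d1, D1d2, D2d1, D2d2, dx, d1d2); ring.
have N_t2 q : bN (t2 q) = t2 (bN q) + t2 q.
  by rewrite /bN /t2 !(dD, dM, D1d1, D1d2, D2d1, D2d2, dx, d1d2); ring.
have ND q r : bN (q + r) = bN q + bN r by rewrite /bN !dD; ring.
have NM q r : bN (q * r) = bN q * r + q * bN r by rewrite /bN !dM; ring.
have N_d1 : bN (d1 del) = d1 del - d1 del *+ m.
  have -> : bN (d1 del) = d1 (bN del) + d1 del.
    by rewrite /bN !(dD, dM, D1d1, D1d2, D2d1, D2d2, dx, d1d2); ring.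
  by rewrite bN_del -mulNrn (derMn d1D) (derN d1D); ring.
have N_d2 : bN (d2 del) = d2 del - d2 del *+ m.
  have -> : bN (d2 del) = d2 (bN del) + d2 del.
    by rewrite /bN !(dD, dM, D1d1, D1d2, D2d1, D2d2, dx, d1d2); ring.
  by rewrite bN_del -mulNrn (derMn d2D) (derN d2D); ring.
have Nz1 : bN z1 = z1 by rewrite /bN !dx; ring.
have Nz2 : bN z2 = z2 by rewrite /bN !dx; ring.
have t1D q r : t1 (q + r) = t1 q + t1 r by rewrite /t1 d1D; ring.
have t2D q r : t2 (q + r) = t2 q + t2 r by rewrite /t2 d2D; ring.
(* Only additivity and the weight 1 of [t1] and [t2] matter, so they are abstracted. *)
pose R (s1 s2 : S -> S) q := del * (s1 (s1 q) + s2 (s2 q) - (z1 * z1 + z2 * z2) * q)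
  - (d1 del * s1 q + d2 del * s2 q) *+ 2.
suff key s1 s2 : (forall q, bN (s1 q) = s1 (bN q) + s1 q) -> (forall q, bN (s2 q) = s2 (bN q) + s2 q) ->
    (forall q r, s1 (q + r) = s1 q + s1 r) -> (forall q r, s2 (q + r) = s2 q + s2 r) ->
    bN (R s1 s2 p) = R s1 s2 (bN p) + R s1 s2 p *+ 2 - R s1 s2 p *+ m.
  by have := key t1 t2 N_t1 N_t2 t1D t2D; rewrite /R -!expr2.
move=> N1 N2 s1D s2D; rewrite /R !(derN ND, derMn ND, ND, NM) N_d1 N_d2 Nz1 Nz2 bN_del.
rewrite !(N1, N2, s1D, s2D).
move: (bN p) => np.
move: (s1 (s1 np)) (s2 (s2 np)) (s1 np) (s2 np) (s1 (s1 p)) (s2 (s2 p)) => a b c d e f.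
ring.
Qed.
End Bispectral.

Lemma euler (I : eqType) (Pi : seq I) (mu : I -> nat) (uPi : uniq Pi) (G : comNzRingType) (co si : I -> G) :
  pX1 G * pder1 (del Pi mu co si) + pX2 G * pder2 (del Pi mu co si) = del Pi mu co si *+ mtot Pi mu.
Proof.
pose E p : {poly {poly G}} := pX1 G * pder1 p + pX2 G * pder2 p.
have ED p q : E (p + q) = E p + E q by rewrite /E pder1D pder2D; ring.
have EM p q : E (p * q) = E p * q + p * E q by rewrite /E pder1M pder2M; ring.
rewrite -/(E _) (der_del _ _ _ uPi ED EM) /mtot -sumrMnr big_seq [RHS]big_seq.
apply: eq_bigr => a aP; rewrite (mdelE _ _ _ uPi) //; congr (_ * _ *+ _).
by rewrite /E pder1_L pder2_L /L /lf; ring.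
Qed.

(** * The layer below the top of the Baker-Akhieser polynomial *)

Section Subleading.
Variables (S : comNzRingType) (d1 d2 : S -> S).
Hypotheses (d1D : forall p q, d1 (p + q) = d1 p + d1 q) (d2D : forall p q, d2 (p + q) = d2 p + d2 q).
Hypotheses (d1M : forall p q, d1 (p * q) = d1 p * q + p * d1 q)
  (d2M : forall p q, d2 (p * q) = d2 p * q + p * d2 q).
Variables (I : eqType) (Pi : seq I) (mu : I -> nat).
Variables (del del' w1 w2 h : S) (dh dh' l l' n1 n2 : I -> S).
Hypotheses (d1l : forall a, d1 (l a) = n1 a) (d2l : forall a, d2 (l a) = n2 a).
Hypotheses (d1del' : d1 del' = 0) (d2del' : d2 del' = 0).
Hypotheses (d1dh' : forall a, d1 (dh' a) = 0) (d2dh' : forall a, d2 (dh' a) = 0).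
Hypotheses (d1h : d1 h = 0) (d2h : d2 h = 0) (h2 : h *+ 2 = 1).
Hypothesis l'E : forall a, l' a = n1 a * w1 + n2 a * w2.
Hypothesis delE : forall a, a \in Pi -> (0 < mu a)%N -> del = l a * dh a.
Hypothesis del'E : forall a, a \in Pi -> (0 < mu a)%N -> del' = l' a * dh' a.
Hypothesis lap : del * (d1 (d1 del) + d2 (d2 del)) - (d1 del ^+ 2 + d2 del ^+ 2) *+ 2 =
  - \sum_(a <- Pi) dh a ^+ 2 *+ (mu a * (mu a).+1).

(** [LL] and [MM] for abstract derivations, so that they apply in [x] and in [z] alike. *)
Definition aL q := del * (d1 (d1 q) + d2 (d2 q)) - (d1 del * d1 q + d2 del * d2 q) *+ 2.
Definition aM q := (del * (w1 * d1 q + w2 * d2 q) - q * (w1 * d1 del + w2 * d2 del)) *+ 2.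
(* The component of the Baker-Akhieser polynomial just below its top [del' * del]; it is
   visibly symmetric in the two sets of variables. *)
Definition subleading := - (h * \sum_(a <- Pi) (dh' a * dh a) *+ (mu a * (mu a).+1)).

Lemma aMD p q : aM (p + q) = aM p + aM q.
Proof. by rewrite /aM !(d1D, d2D); ring. Qed.
Lemma aMZ k p : d1 k = 0 -> d2 k = 0 -> aM (k * p) = k * aM p.
Proof. by move=> k1 k2; rewrite /aM !(d1M, d2M, k1, k2); ring. Qed.

(** [aM q] is [2 del^2] times the derivative along [w] of [q / del]; for [q = dh a] the quotient is
    [1 / l a], and the result is [- 2 l' a] times the square of [dh a]. With the factors [dh' a] and
    [h = 1/2] this cancels term by term the value of [aL] given by [lap]. *)
Lemma aL_subleading : aL (del' * del) + aM subleading = 0.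
Proof.
have -> : aL (del' * del) = - \sum_(a <- Pi) (del' * dh a ^+ 2) *+ (mu a * (mu a).+1).
  transitivity (del' * (del * (d1 (d1 del) + d2 (d2 del)) - (d1 del ^+ 2 + d2 del ^+ 2) *+ 2)).
    rewrite /aL !(d1M, d2M, d1D, d2D, d1del', d2del', der0 d1D, der0 d2D); ring.
  by rewrite lap mulrN mulr_sumr; congr (- _); apply: eq_bigr => a _; rewrite mulrnAr.
rewrite /subleading (derN aMD) aMZ // (der_sum aMD) mulr_sumr -opprD -big_split big1_seq ?oppr0 //=.
move=> a aP; case: (posnP (mu a)) => [->|ma]; first by rewrite !mulr0n /aM !(d1D, d2D, der0 d1D, der0 d2D); ring.
rewrite (derMn aMD) aMZ // mulrnAr -mulrnDl.
have -> : aM (dh a) = - (l' a * dh a ^+ 2) *+ 2.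
  rewrite /aM {1}(delE aP ma) (_ : d1 del = n1 a * dh a + l a * d1 (dh a)); last first.
    by rewrite {1}(delE aP ma) d1M d1l.
  rewrite (_ : d2 del = n2 a * dh a + l a * d2 (dh a)); last by rewrite {1}(delE aP ma) d2M d2l.
  by rewrite l'E; congr (_ *+ 2); ring.
have -> : h * (dh' a * (- (l' a * dh a ^+ 2) *+ 2)) = - ((h *+ 2) * (del' * dh a ^+ 2)).
  by rewrite (del'E aP ma); ring.
by rewrite h2 mul1r subrr mul0rn.
Qed.
End Subleading.

(** * Symmetry of the Baker-Akhieser polynomial in [x] and [z] *)

Section Duality.
Variable F : comNzRingType.
Local Notation K := {poly {poly F}}.
Local Notation B := {poly {poly K}}.
Local Notation X1 := (pX1 K).
Local Notation X2 := (pX2 K).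
Local Notation z1 := (pc (pX1 F) : B).
Local Notation z2 := (pc (pX2 F) : B).
Variables (I : eqType) (Pi : seq I) (mu : I -> nat) (co0 si0 : I -> F) (kap0 : I -> I -> F).
Hypothesis uPi : uniq Pi.
Hypothesis cs0 : forall a, co0 a ^+ 2 + si0 a ^+ 2 = 1.
Hypothesis sd0_reg : forall a b, a \in Pi -> b \in Pi -> a != b -> forall x, sd co0 si0 a b * x = 0 -> x = 0.
Hypothesis kapE0 : forall a b, a \in Pi -> b \in Pi -> a != b -> cd co0 si0 a b = kap0 a b * sd co0 si0 a b.
Hypothesis kapN0 : forall a b, kap0 a b = - kap0 b a.
Hypothesis BA0 : forall a, a \in Pi -> forall k, (k < mu a)%N ->
  \sum_(b <- Pi | b != a) kap0 a b ^+ k.*2.+1 *+ mu b = 0.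
Variable nv0 : nat -> F.
Hypothesis nvK0 : forall n, nv0 n * n.+1%:R = 1.
Hypothesis newt0 : newton_odd F.

Definition pco a : K := pc (co0 a).
Definition psi' a : K := pc (si0 a).
Definition pkap a b : K := pc (kap0 a b).
Definition pnv n : K := pc (nv0 n).

Lemma pcs1 a : pco a ^+ 2 + psi' a ^+ 2 = 1.
Proof. by rewrite !expr2 -!pcM -pcD -!expr2 cs0 pc1. Qed.
Lemma psdE a b : sd pco psi' a b = pc (sd co0 si0 a b).
Proof. by rewrite /sd pcD pcN !pcM. Qed.
Lemma psd_reg a b : a \in Pi -> b \in Pi -> a != b -> forall x, sd pco psi' a b * x = 0 -> x = 0.
Proof.
move=> aP bP ab x; rewrite psdE => e; apply: bpolyP => i j; rewrite !coef0.
by apply: (sd0_reg aP bP ab); rewrite -bcoefCM e !coef0.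
Qed.
Lemma pkapE a b : a \in Pi -> b \in Pi -> a != b -> cd pco psi' a b = pkap a b * sd pco psi' a b.
Proof.
by move=> aP bP ab; rewrite psdE /pkap -pcM -kapE0 // /cd pcD !pcM.
Qed.
Lemma pkapN a b : pkap a b = - pkap b a.
Proof. by rewrite /pkap kapN0 pcN. Qed.
Lemma pBA a : a \in Pi -> forall k, (k < mu a)%N ->
  \sum_(b <- Pi | b != a) pkap a b ^+ k.*2.+1 *+ mu b = 0.
Proof.
move=> aP k ka; rewrite -[RHS]pc0 -(BA0 aP ka) (rmorph_sum (@pc F)); apply: eq_bigr => b _.
by rewrite (rmorphMn (@pc F)) (rmorphXn (@pc F)).
Qed.
Lemma pnvK n : pnv n * n.+1%:R = 1.
Proof. by rewrite -(rmorph_nat (@pc F)) -pcM nvK0 pc1. Qed.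
Lemma pnewt : newton_odd K.
Proof.
move=> k h H j jk; apply: bpolyP => i l; rewrite !coef0.
apply: (newt0 (k := k) (h := fun j => (h j)`_l`_i)) => // n nk.
have := congr1 (fun q : K => q`_l`_i) (H n nk); rewrite !coef0 !coef_sum => E.
by rewrite -[RHS]E; apply: eq_bigr => m _; rewrite !coefMn.
Qed.
Lemma pc_regK a : a \in Pi -> forall x, (pco a * pX2 F - psi' a * pX1 F) * x = 0 -> x = 0.
Proof. by move=> _ x; apply: (lf_reg (cs0 a)). Qed.

Local Notation del0 := (del Pi mu co0 si0).
Local Notation dh0 := (dh Pi mu co0 si0).
Local Notation del := (del Pi mu pco psi').
Local Notation dh := (dh Pi mu pco psi').
Local Notation Rop := (Rop Pi mu pco psi' (pX1 F) (pX2 F)).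

Lemma deleE : dele Pi mu pco psi' (pX1 F) (pX2 F) = del0.
Proof. by rewrite /dele /del0 -lock. Qed.

Lemma sw_L a : sw (L pco psi' a) = pc (L co0 si0 a).
Proof.
rewrite /L /lf swB !swM !swC swX1 swX2 [in RHS]pcD [in RHS]pcN ![in RHS]pcM.
by rewrite !psiC.
Qed.
Lemma sw_del : sw del = pc del0.
Proof.
rewrite /del /del0 -!lock (rmorph_prod (@sw F)) (rmorph_prod (@pc K)); apply: eq_bigr => a _.
by rewrite (rmorphXn (@sw F)) (rmorphXn (@pc K)) /= sw_L.
Qed.
Lemma sw_dh a : sw (dh a) = pc (dh0 a).
Proof.
rewrite /dh /dh0 -!lock swM [in RHS]pcM (rmorph_prod (@sw F)) (rmorph_prod (@pc K)).
rewrite (rmorphXn (@sw F)) (rmorphXn (@pc K)) /= sw_L; congr (_ * _).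
by apply: eq_bigr => b _; rewrite (rmorphXn (@sw F)) (rmorphXn (@pc K)) /= sw_L.
Qed.
Lemma swp_del : sw (pc del0) = del. Proof. by rewrite -sw_del swK. Qed.
Lemma swp_dh a : sw (pc (dh0 a)) = dh a. Proof. by rewrite -sw_dh swK. Qed.

Lemma Dz1_del : Dz1 del = 0.
Proof. by rewrite -swp_del -sw_pder1 pder1C sw0. Qed.
Lemma Dz2_del : Dz2 del = 0.
Proof. by rewrite -swp_del -sw_pder2 pder2C sw0. Qed.

Local Notation bR := (bR (@pder1 K) (@pder2 K) z1 z2 del).
Local Notation bG := (bG (@Dz1 F) (@Dz2 F) X1 X2 (pc del0)).

Lemma Rop_bR p : Rop p = bR p.
Proof. by rewrite /Rop /bR /lapt /td1 /td2 !expr2 !(pcD (pX1 F * _)) !pcM. Qed.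

Lemma sw_td1 q : sw (td1 (pX1 F) q) = Dz1 (sw q) + X1 * sw q.
Proof. by rewrite /td1 swD sw_pder1 swM swC psiX1. Qed.
Lemma sw_td2 q : sw (td2 (pX2 F) q) = Dz2 (sw q) + X2 * sw q.
Proof. by rewrite /td2 swD sw_pder2 swM swC psiX2. Qed.
Lemma sw_lapt q : sw (lapt (pX1 F) (pX2 F) q) = (Dz1 (Dz1 (sw q) + X1 * sw q) + X1 * (Dz1 (sw q) + X1 * sw q))
   + (Dz2 (Dz2 (sw q) + X2 * sw q) + X2 * (Dz2 (sw q) + X2 * sw q)) - (X1 ^+ 2 + X2 ^+ 2) * sw q.
Proof.
have H2 (u v k p : B) : sw (u + v - k * p) = sw u + sw v - sw k * sw p.
  by rewrite swB swD swM.
pose f1 r : B := Dz1 r + X1 * r; pose f2 r : B := Dz2 r + X2 * r.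
have E1 : sw (td1 (pX1 F) (td1 (pX1 F) q)) = f1 (f1 (sw q)).
  exact: (etrans (sw_td1 _) (congr1 f1 (sw_td1 q))).
have E2 : sw (td2 (pX2 F) (td2 (pX2 F) q)) = f2 (f2 (sw q)).
  exact: (etrans (sw_td2 _) (congr1 f2 (sw_td2 q))).
have E3 : sw (pc (pX1 F ^+ 2 + pX2 F ^+ 2)) = X1 ^+ 2 + X2 ^+ 2.
  by rewrite swC psiD !expr2 !psiM psiX1 psiX2.
exact: (etrans (H2 _ _ _ _) (congr2 (fun x y => x - y * sw q) (congr2 +%R E1 E2) E3)).
Qed.
Lemma sw_Rop q : sw (Rop q) = bG (sw q).
Proof.
have H1 (d A g1 g2 u v : B) : sw (d * A - (g1 * u + g2 * v) *+ 2) =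
    sw d * sw A - (sw g1 * sw u + sw g2 * sw v) *+ 2 by rewrite swB swMn swD !swM.
have E1 : sw (pder1 del) = Dz1 (pc del0) by rewrite sw_pder1 sw_del.
have E2 : sw (pder2 del) = Dz2 (pc del0) by rewrite sw_pder2 sw_del.
apply: (etrans (H1 _ _ _ _ _ _)).
exact: (congr2 (fun x y => x - y *+ 2) (congr2 *%R sw_del (sw_lapt q))
  (congr2 +%R (congr2 *%R E1 (sw_td1 q)) (congr2 *%R E2 (sw_td2 q)))).
Qed.

Local Notation mtot := (mtot Pi mu).
Local Notation bN := (bN (@pder1 K) (@pder2 K) (@Dz1 F) (@Dz2 F) X1 X2 z1 z2).

Lemma Dz1z1 : Dz1 z1 = 1. Proof. by rewrite Dz1C pder1X1 pc1. Qed.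
Lemma Dz1z2 : Dz1 z2 = 0. Proof. by rewrite Dz1C pder1X2 pc0. Qed.
Lemma Dz2z1 : Dz2 z1 = 0. Proof. by rewrite Dz2C pder2X1 pc0. Qed.
Lemma Dz2z2 : Dz2 z2 = 1. Proof. by rewrite Dz2C pder2X2 pc1. Qed.

Lemma euler_z : z1 * Dz1 (pc del0) + z2 * Dz2 (pc del0) = pc del0 *+ mtot.
Proof.
rewrite Dz1C Dz2C -!pcM -pcD (euler _ uPi) -(rmorphMn (@pc K)) //.
Qed.

Lemma bN_Rop p : bN (Rop p) = Rop (bN p) + Rop p *+ 2 - Rop p *+ mtot.
Proof.
have H q : Rop q = bR q by apply: Rop_bR.
have X : bN (bR p) = bR (bN p) + bR p *+ 2 - bR p *+ mtot.
  exact: (bN_bR (@pder1D K) (@pder2D K) (@Dz1D F) (@Dz2D F) (@pder1M K) (@pder2M K) (@Dz1M F) (@Dz2M F)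
    (@Dz1_pder1 F) (@Dz1_pder2 F) (@Dz2_pder1 F) (@Dz2_pder2 F)
    (pder1X1 K) (pder1X2 K) (pder2X1 K) (pder2X2 K) (pder1C _) (pder1C _) (pder2C _) (pder2C _)
    Dz1z1 Dz1z2 Dz2z1 Dz2z2 (Dz1_del) (Dz2_del) (euler mu uPi pco psi') (@pder12 K)).
exact: (etrans (congr1 bN (H p)) (etrans X
  (esym (congr2 (fun u v => u + v *+ 2 - v *+ mtot) (H (bN p)) (H p))))).
Qed.

Lemma bND p q : bN (p + q) = bN p + bN q.
Proof. by rewrite /bN !(pder1D, pder2D, Dz1D, Dz2D); ring. Qed.
Lemma bNM p q : bN (p * q) = bN p * q + p * bN q.
Proof. by rewrite /bN !(pder1M, pder2M, Dz1M, Dz2M); ring. Qed.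
Lemma bN_delE : bN del = - (del *+ mtot).
Proof.
exact: (bN_del _ _ (Dz1_del) (Dz2_del) (euler mu uPi pco psi')).
Qed.

(** [del ^ 2] has weight [- 2 mtot], and each application of [Rop] followed by division by [del]
    adds 2, so the weight reaches 0 at [k = mtot]. *)
Lemma bN_iterates (p : nat -> B) : p 0%N = del ^+ 2 -> (forall k, del * p k.+1 = Rop (p k)) ->
  forall k, bN (p k) + p k *+ mtot.*2 = p k *+ k.*2.
Proof.
move=> p0 pS; elim=> [|k IH].
  by rewrite p0 expr2 bNM bN_delE -addnn mulrnDr mulr0n; ring.
apply: (delI (pcs1) (mu := mu) (Pi := Pi)).
have -> : del * (bN (p k.+1) + p k.+1 *+ mtot.*2) = bN (Rop (p k)) + (Rop (p k)) *+ mtot *+ 3.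
  by rewrite -pS bNM bN_delE -addnn mulrnDr; ring.
have {}IH : bN (p k) = p k *+ k.*2 - p k *+ mtot.*2 by rewrite -IH addrK.
have -> : bN (Rop (p k)) = Rop (p k) *+ k.*2 - Rop (p k) *+ mtot.*2 + Rop (p k) *+ 2 - Rop (p k) *+ mtot.
  rewrite bN_Rop IH (derB (@RopD _ _ _ _ _ _ _ _)) !(derMn (@RopD _ _ _ _ _ _ _ _)) //.
rewrite [RHS]mulrnAr pS; move: (Rop (p k)) => R.
by rewrite -!addnn !mulrnDr !mulrS; ring.
Qed.

(** On a bihomogeneous component [bN] multiplies by the difference of the two degrees, an integer
    that can be cancelled when nonzero. *)
Lemma bihom p : bN p = 0 -> forall i j k l, (k + l != i + j)%N -> p`_j`_i`_l`_k = 0.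
Proof.
move=> N0 i j k l ne; set c := p`_j`_i.
have E : pX1 F * pder1 c + pX2 F * pder2 c = c *+ (i + j).
  have := congr1 (fun q : B => q`_j`_i) N0; rewrite /bN !coef0 !bcoefB bcoefD !bcoefCM.
  rewrite !bcoef_ext; try by [exact: pder1D | exact: pder2D].
  rewrite bcoefX1M bcoefX2M mulrnDr -/c.
  have -> : (if i is i'.+1 then (pder1 p)`_j`_i' else 0) = c *+ i.
    by rewrite /c; case: i {c ne} => // i; rewrite bcoef1.
  have -> : (if j is j'.+1 then (pder2 p)`_j'`_i else 0) = c *+ j.
    by rewrite /c; case: j {c ne} => // j; rewrite bcoef2.
  by move=> H; rewrite -[LHS]subr0 -H; ring.
have := congr1 (fun q : K => q`_l`_k) E; rewrite bcoefD bcoefX1M bcoefX2M !coefMn.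
have -> : (if k is k'.+1 then (pder1 c)`_l`_k' else 0) = c`_l`_k *+ k.
  by case: k {ne} => // k; rewrite bcoef1.
have -> : (if l is l'.+1 then (pder2 c)`_l'`_k else 0) = c`_l`_k *+ l.
  by case: l {ne} => // l; rewrite bcoef2.
rewrite -mulrnDr => H.
have [lt|gt|/eqP e] := ltngtP (k + l) (i + j); last by rewrite (negbTE ne) in e.
- apply: (@natI _ _ nvK0 (i + j - (k + l)).-1) => /=; rewrite mul0rn prednK ?subn_gt0 //.
  by rewrite mulrnBr ?(ltnW lt) // H subrr.
- apply: (@natI _ _ nvK0 (k + l - (i + j)).-1) => /=; rewrite mul0rn prednK ?subn_gt0 //.
  by rewrite mulrnBr ?(ltnW gt) // H subrr.
Qed.

Local Notation LL := (LL Pi mu pco psi').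
Local Notation MM := (MM Pi mu pco psi' (pX1 F) (pX2 F)).
Local Notation QIall := (QIall Pi mu pco psi' pnv (pX1 F) (pX2 F)).
Local Notation Lz := (aL (@Dz1 F) (@Dz2 F) (pc del0)).
Local Notation Mz := (aM (@Dz1 F) (@Dz2 F) (pc del0) X1 X2).
Local Notation Lx := (aL (@pder1 K) (@pder2 K) del).
Local Notation Mx := (aM (@pder1 K) (@pder2 K) del z1 z2).
Local Notation h := (pc (pc (nv0 1)) : B).
Local Notation Pst := (subleading Pi mu h dh (fun a => pc (dh0 a))).

Lemma bGE q : bG q = Lz q + Mz q.
Proof.
have D1X r : Dz1 (X1 * r) = X1 * Dz1 r by rewrite Dz1M Dz1X1 mul0r add0r.
have D2X r : Dz2 (X2 * r) = X2 * Dz2 r by rewrite Dz2M Dz2X2 mul0r add0r.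
rewrite /bG /aL /aM Dz1D Dz2D D1X D2X.
move: (Dz1 (Dz1 q)) (Dz2 (Dz2 q)) (Dz1 q) (Dz2 q) (Dz1 (pc del0)) (Dz2 (pc del0)) => a b c d e f.
ring.
Qed.

Lemma dlt_Dz1 n (q : B) : dlt n q -> dlt n (Dz1 q).
Proof. exact: (dlt_ext (@pder1D F)). Qed.
Lemma dlt_Dz2 n (q : B) : dlt n q -> dlt n (Dz2 q).
Proof. exact: (dlt_ext (@pder2D F)). Qed.

Lemma dlt_Lz n q : dlt n q -> dlt n (Lz q).
Proof.
move=> dq; rewrite /aL Dz1C Dz2C; apply: dltB.
  by apply: dltCM; apply: dltD; [do 2 apply: dlt_Dz1 | do 2 apply: dlt_Dz2].
by apply: dltMn; apply: dltD; apply: dltCM; [apply: dlt_Dz1 | apply: dlt_Dz2].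
Qed.
Lemma dlt_Mz n q : dlt n q -> dlt n.+1 (Mz q).
Proof.
move=> dq; rewrite /aM Dz1C Dz2C; apply: dltMn; apply: dltB.
  apply: dltCM; apply: dltD.
    exact: (dltM (@dltX1 K) (dlt_Dz1 dq)).
  exact: (dltM (@dltX2 K) (dlt_Dz2 dq)).
rewrite [X in dlt _ X]mulrC ![X1 * pc _]mulrC ![X2 * pc _]mulrC.
apply: (dltM (m := 2)) => //; apply: dltD; apply: dltCM; [exact: dltX1 | exact: dltX2].
Qed.

Lemma h2 : h *+ 2 = 1.
Proof. by rewrite -!(rmorphMn (@pc _)) /= -mulr_natr nvK0 !pc1. Qed.

Lemma pcL_E a : pc (L co0 si0 a) = - pc (psi' a) * z1 + pc (pco a) * z2.
Proof.
rewrite /L /lf pcD pcN (pcM (pc (co0 a))) (pcM (pc (si0 a))).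
exact: (etrans (addrC _ _) (congr2 +%R (esym (mulNr _ _)) erefl)).
Qed.

Lemma subleading_x : Lx (pc del0 * del) + Mx Pst = 0.
Proof.
apply: (aL_subleading (@pder1D K) (@pder2D K) (@pder1M K) (@pder2M K)
  (n1 := fun a => - pc (psi' a)) (n2 := fun a => pc (pco a))
  (pder1_L pco psi') (pder2_L pco psi') (pder1C _) (pder2C _)
  (fun a => pder1C _) (fun a => pder2C _) (pder1C _) (pder2C _) h2 (l' := fun a => pc (L co0 si0 a))).
- exact: pcL_E.
- by move=> a aP ma; rewrite -(delE _ _ uPi).
- by move=> a aP ma; rewrite -pcM -(delE _ _ uPi).
- exact: (lap_del uPi (pcs1) (pkapE) (pkapN)
    (fun a aP ma => pBA aP (k := 0) ma)).
Qed.

Lemma subleading_z : Lz (pc del0 * del) + Mz Pst = 0.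
Proof.
have -> : Pst = subleading Pi mu h (fun a => pc (dh0 a)) dh.
  by rewrite /subleading; congr (- (_ * _)); apply: eq_bigr => a _; rewrite mulrC.
rewrite mulrC.
apply: (aL_subleading (@Dz1D F) (@Dz2D F) (@Dz1M F) (@Dz2M F)
  (n1 := fun a => pc (- pc (si0 a))) (n2 := fun a => pc (pc (co0 a)))
  (l := fun a => pc (L co0 si0 a)) (l' := L pco psi')).
- by move=> a; rewrite Dz1C pder1_L.
- by move=> a; rewrite Dz2C pder2_L.
- exact: Dz1_del.
- exact: Dz2_del.
- by move=> a; rewrite -swp_dh -sw_pder1 pder1C sw0.
- by move=> a; rewrite -swp_dh -sw_pder2 pder2C sw0.
- by rewrite Dz1C pder1C pc0.
- by rewrite Dz2C pder2C pc0.
- exact: h2.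
- by move=> a; rewrite /L /lf pcN mulNr addrC.
- by move=> a aP ma; rewrite -pcM -(delE _ _ uPi).
- by move=> a aP ma; rewrite -(delE _ _ uPi).
have := congr1 (@pc K) (lap_del uPi cs0 kapE0 kapN0 (fun a aP ma => BA0 aP (k := 0) ma)).
rewrite !Dz1C !Dz2C pcD !pcN pcM pcD (rmorphMn (@pc K)) /= pcD !(rmorphXn (@pc K)) /= => ->.
rewrite (rmorph_sum (@pc K)); congr (- _); apply: eq_bigr => a _.
by rewrite (rmorphMn (@pc K)) (rmorphXn (@pc K)).
Qed.

Lemma dlt_Pst : dlt mtot Pst.
Proof.
apply: dltN; apply: dltCM; rewrite big_seq; apply: dlt_sum => a aP.
case: (posnP (mu a)) => [->|ma]; first by rewrite mulr0n; apply: dlt_0.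
apply: dltMn; apply: dltCM; apply: (dlt_lfI (pcs1 a)).
have: dlt mtot.+1 del by apply: dlt_del.
by rewrite (delE _ _ uPi aP ma).
Qed.

(* [Phi - sw Phi] has degree less than [mtot] in [x] and is killed by [Rop], hence vanishes by
   [Rop_zero]; that [Rop] kills [sw Phi] amounts to [bG Phi = 0]. *)
Theorem BA_symmetric : exists (p : nat -> B) (Phi s : B),
  [/\ p 0%N = del ^+ 2, forall k, del * p k.+1 = Rop (p k) &
      p mtot = Phi *+ (2 ^ mtot * mtot`!)] /\
  [/\ QIall Phi, sw Phi = Phi, Phi = pc del0 * del + s & forall i j, dlt mtot s`_j`_i].
Proof.
have [p [s' [p0 pS Qp pZ [pE ds']]]] := BA_function uPi (pcs1) (psd_reg) (pkapE)
  (pBA) (pnvK) (pnewt) (pc_regK).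
rewrite deleE in pE.
pose c := (2 ^ mtot * mtot`!)%N; pose inv := nv0 1 ^+ mtot * fv nv0 mtot.
have invK : inv *+ c = 1.
  rewrite /c mulnC mulrnA /inv -mulrnAr fvE // mulr1 -mulr_natr natrX -exprMn.
  by rewrite nvK0 expr1n.
pose k := pc inv : K.
have kK (q : B) : pc k * q *+ c = q.
  by rewrite -mulrnAl -!(rmorphMn (@pc _)) /= invK !pc1 mul1r.
pose Phi := pc k * p mtot; pose s := pc k * s'.
have ds : dlt mtot s by apply: dltCM.
have PE : Phi = pc del0 * del + s by rewrite /Phi pE mulrDr mulrnAr kK.
have RP : Rop Phi = 0 by rewrite /Phi RopCM pZ mulr0.
have NP : bN Phi = 0.
  have := bN_iterates p0 pS mtot; rewrite -[RHS]add0r => /addIr Np.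
  by rewrite /Phi bNM Np mulr0 addr0 /bN !(pder1C, pder2C, Dz1C, Dz2C, pc0); ring.
(* By [subleading_x] the highest terms of [Rop Phi = 0] cancel. What remains bounds the degree of
   [MM (s - Pst)], and [MM_drop] then lowers that of [s - Pst]. *)
have dsP1 : dlt mtot.-1 (s - Pst).
  have dsP : dlt mtot (s - Pst) by apply: dltB => //; apply: dlt_Pst.
  have MsP : Mx (s - Pst) = - Lx Pst - Lx (s - Pst).
    have := RP; rewrite RopE PE.
    have -> : LL (pc del0 * del + s) = Lx (pc del0 * del) + Lx Pst + Lx (s - Pst).
      rewrite -[in LHS](subrK Pst s) (LLD _ _ _ _ (pc del0 * del)) (LLD _ _ _ _ (s - Pst) Pst).
      exact: (etrans (congr1 (+%R _) (addrC _ _)) (addrA _ _ _)).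
    have -> : MM (pc del0 * del + s) = Mx Pst + Mx (s - Pst).
      rewrite -[in LHS](subrK Pst s) (MMD _ _ _ _ _ _ (pc del0 * del)) (MMD _ _ _ _ _ _ (s - Pst) Pst).
      have -> : MM (pc del0 * del) = 0.
        rewrite /MM (DvM _ _ (pc del0) del).
        have -> : Dv (pX1 F) (pX2 F) (pc del0) = 0 by rewrite /Dv pder1C pder2C !mulr0 addr0.
        by move: (Dv _ _ _) => u; ring.
      exact: (etrans (add0r _) (addrC _ _)).
    move=> H; have S := subleading_x.
    move: (Lx (pc del0 * del)) (Lx Pst) (Lx (s - Pst)) (Mx Pst) (Mx (s - Pst)) H S => a b d e f H S.
    have -> : f = (a + b + d + (e + f)) - (a + e) - b - d by ring.
    by rewrite H S; ring.
  have [m0|mpos] := posnP mtot; first by rewrite m0 in dsP *.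
  apply: (MM_drop uPi (pcs1) (pnvK) (pc_regK)); rewrite ?prednK ?ltnS //.
  rewrite [X in dlt _ X]MsP; apply: dltB; first apply: dltN.
    by apply: dlt_LL => //; rewrite prednK //; apply: dlt_Pst.
  by apply: dlt_LL => //; rewrite prednK.
(* [Mz] raises the [x]-degree by one, but it kills the top part, and on [Pst] it cancels [Lz] of the
   top part by [subleading_z]. On the rest the bound [dsP1] leaves exactly enough room. *)
have dG : dlt mtot (bG Phi).
  rewrite PE -(subrK Pst s) bGE.
  have -> : Lz (pc del0 * del + (s - Pst + Pst)) = Lz (pc del0 * del) + Lz (s - Pst) + Lz Pst.
    by rewrite /aL !(Dz1D, Dz2D); ring.
  have -> : Mz (pc del0 * del + (s - Pst + Pst)) = Mz (s - Pst) + Mz Pst.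
    rewrite !(aMD (@Dz1D F) (@Dz2D F)) [Mz (pc del0 * del)](_ : _ = 0) ?add0r //.
    by rewrite /aM Dz1M Dz2M Dz1_del Dz2_del; ring.
  have -> (a b c' d e : B) : a + b + c' + (d + e) = (a + e) + (b + c' + d) by ring.
  rewrite subleading_z add0r; apply: dltD; first apply: dltD.
  - by apply: dlt_Lz; apply: dlt_leq dsP1; apply: leq_pred.
  - by apply: dlt_Lz; apply: dlt_Pst.
  - have [m0|mpos] := posnP mtot; last by rewrite -(prednK mpos); apply: dlt_Mz.
    rewrite m0 in dsP1 *; rewrite (dlt0 dsP1) /aM (der0 (@Dz1D F)) (der0 (@Dz2D F)).
    by rewrite !(mulr0, mul0r, addr0, subr0) mul0rn; apply: dlt_0.
have RG : Rop (bG Phi) = 0.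
  apply: (etrans (Rop_bR (bG Phi))).
  apply: (bR_bG (@pder1D K) (@pder2D K) (@Dz1D F) (@Dz2D F) (@pder1M K) (@pder2M K) (@Dz1M F) (@Dz2M F)
    (@Dz1_pder1 F) (@Dz1_pder2 F) (@Dz2_pder1 F) (@Dz2_pder2 F)
    (pder1X1 K) (pder1X2 K) (pder2X1 K) (pder2X2 K) (pder1C _) (pder2C _)
    Dz1z1 Dz1z2 Dz2z1 Dz2z2 (Dz1_del) (Dz2_del) (pder1C _) (pder2C _)
    (euler mu uPi pco psi') (euler_z) _ NP).
  exact: (etrans (esym (Rop_bR Phi)) RP).
have G0 : bG Phi = 0.
  exact: (Rop_zero uPi (pcs1) (pnvK) (pc_regK) RG dG).
have RS : Rop (sw Phi) = 0.
  apply: (can_inj (@swK F)); rewrite sw0.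
  by apply: (etrans (sw_Rop (sw Phi))); rewrite swK.
have ND : bN (pc del0 * del) = 0.
  rewrite bNM (bN_delE) -mulNrn mulrnAr mulrN.
  have -> : bN (pc del0) = pc del0 *+ mtot.
    by rewrite -(euler_z) /bN !pder1C !pder2C; ring.
  by rewrite mulrnAl mulNrn subrr.
have Ns : bN s = 0 by have := NP; rewrite PE bND ND add0r.
(* Equality of the degrees in [x] and [z] turns the bound on [s] into one on its coefficients, so
   that [sw s] is also of [x]-degree less than [mtot]. *)
have ms i j : dlt mtot s`_j`_i.
  move=> k' l kl; have [e|ne] := eqVneq (k' + l)%N (i + j)%N; last exact: (bihom Ns).
  by rewrite ds -?e // !coef0.
have sw_top : sw (pc del0 * del) = pc del0 * del by rewrite swM swp_del sw_del mulrC.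
have sP : sw Phi = Phi.
  apply/esym/eqP; rewrite -subr_eq0; apply/eqP.
  apply: (Rop_zero uPi (pcs1) (pnvK) (pc_regK)).
    rewrite [LHS](RopD _ _ _ _ _ _ Phi (- sw Phi)) (RopN _ _ _ _ _ _ (sw Phi)).
    exact: (etrans (congr2 (fun u v => u - v) RP RS) (subrr _)).
  rewrite PE swD sw_top opprD addrACA subrr add0r; apply: dltB => //.
  exact: dlt_sw.
exists p, Phi, s; split; first by split=> //; rewrite -/c /Phi kK.
by split=> // a aP; apply: QI_CM; apply: Qp.
Qed.
End Duality.

(** * Restriction of power series to a line *)

Section LineValues.
Variable K : comNzRingType.
Local Notation B := {poly {poly K}}.
Implicit Types (f g : ser K) (p : B).
Variables c s : K.

(* Taylor coefficients in [t] of [f (c t, s t)]. *)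
Definition evs f n := \sum_(i < n.+1) f i (n - i)%N * c ^+ i * s ^+ (n - i).

Lemma evsD f g n : evs (f + g) n = evs f n + evs g n.
Proof. by rewrite -big_split /=; apply: eq_bigr => i _; rewrite scD !mulrDl. Qed.
Lemma evsCM k f n : evs (kc k * f) n = k * evs f n.
Proof. by rewrite /evs mulr_sumr; apply: eq_bigr => i _; rewrite scCM !mulrA. Qed.
Lemma evsY1M f n : evs (Y1 K * f) n = if n is n'.+1 then c * evs f n' else 0.
Proof.
rewrite /evs big_ord_recl scY1M !mul0r add0r; case: n => [|n]; first by rewrite big_ord0.
rewrite mulr_sumr; apply: eq_bigr => i _; rewrite scY1M /= /bump /= add1n subSS exprS.
ring.
Qed.
Lemma evsY2M f n : evs (Y2 K * f) n = if n is n'.+1 then s * evs f n' else 0.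
Proof.
pose F i := (Y2 K * f) i (n - i)%N * c ^+ i * s ^+ (n - i).
rewrite -[LHS]/(\sum_(i < n.+1) F i) big_ord_recr /= {2}/F scY2M subnn !mul0r addr0 {}/F.
case: n => [|n]; first by rewrite big_ord0.
rewrite mulr_sumr; apply: eq_bigr => i _; rewrite scY2M.
by rewrite subSn ?leq_ord // exprS; ring.
Qed.

Lemma evs_pinM p f : (forall n, evs f n = 0) -> forall n, evs (pin p * f) n = 0.
Proof.
move=> H; elim/bpoly_ind: p => [k|p q IHp IHq|p IH|p IH] n.
- by rewrite pinC evsCM H mulr0.
- by rewrite pinD mulrDl evsD IHp IHq addr0.
- by rewrite pinM pinX1 -mulrA evsY1M; case: n => // n; rewrite IH mulr0.
- by rewrite pinM pinX2 -mulrA evsY2M; case: n => // n; rewrite IH mulr0.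
Qed.

(** Each coefficient sees only a truncation of [g], which reduces the claim to polynomial
    multipliers. *)
Lemma evsM0 g f : (forall n, evs f n = 0) -> forall n, evs (g * f) n = 0.
Proof.
move=> H n; rewrite -(evs_pinM (ser_tr n.+1 g) H n); apply: eq_bigr => i _; congr (_ * _ * _).
have i_n := leq_ord i; rewrite !scM; apply: eq_bigr => a _; apply: eq_bigr => b _.
by rewrite [in RHS]/pin /= coef_ser_tr //; have := leq_ord a; have := leq_ord b; lia.
Qed.

Hypothesis cs1 : c ^+ 2 + s ^+ 2 = 1.

Lemma evs_pin p n : evs (pin p) n = (rot c s p)`_0`_n.
Proof.
elim/bpoly_ind: p n => [k|p q IHp IHq|p IH|p IH] n.
- rewrite rotC pinC -[kc k]mulr1 evsCM /pc coefC /= coefC; case: n => [|n].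
    by rewrite /evs big_ord_recl big_ord0 /= /fps_c /= !mulr1 addr0 mulr1.
  rewrite /evs big1 ?mulr0 // => i _; rewrite /= /fps_c.
  by case: eqP => e; case: eqP => e'; rewrite ?mul0r //; have := ltn_ord i; lia.
- by rewrite pinD evsD IHp IHq rotD bcoefD.
- rewrite pinM pinX1 evsY1M rotM rotX1 mulrBl bcoefB -!mulrA !bcoefCM bcoefX1M bcoefX2M mulr0 subr0.
  by case: n => [|n]; rewrite ?mulr0 // IH.
- rewrite pinM pinX2 evsY2M rotM rotX2 mulrDl bcoefD -!mulrA !bcoefCM bcoefX1M bcoefX2M mulr0 addr0.
  by case: n => [|n]; rewrite ?mulr0 // IH.
Qed.

Lemma evs_pin0 p : (forall n, evs (pin p) n = 0) <-> exists h, p = lf c s * h.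
Proof.
rewrite -[lf c s]expr1; split=> [H|/(lfX_dvdP cs1 1) H n]; last by rewrite evs_pin H.
by apply/(lfX_dvdP cs1 1) => i [|//] _; rewrite -evs_pin.
Qed.

Variable nv : nat -> K.
Hypothesis nvK : forall n, nv n * n.+1%:R = 1.

Lemma qs1 e1 e2 p : qs nv 1 0 e1 e2 p = Eser nv e1 e2 * pin p.
Proof.
have rot1 u v : u = 1 -> v = 0 -> rot u v p = p.
  move=> u1 v0; apply: (@bev_unique K B (rot u v) idfun) => [k||] /=; first by rewrite rotC.
    by rewrite rotX1 u1 v0 pc0 pc1 mul1r mul0r subr0.
  by rewrite rotX2 u1 v0 pc0 pc1 mul1r mul0r add0r.
by rewrite /qs rot1 // /Erot !mul1r !mul0r addr0 subr0 mulrC.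
Qed.

(** Multiplication by the exponential or by its inverse preserves vanishing on the line, so the
    polynomial condition of [QI_angP] agrees with the one on Taylor series. *)
Lemma QI_evs e1 e2 m p : QI nv c s e1 e2 m p <->
  forall k, odd k -> (k < m.*2)%N -> forall n, evs (iter k (@ang K) (Eser nv e1 e2 * pin p)) n = 0.
Proof.
rewrite (QI_angP nvK cs1).
split=> H k ok km; have := H k ok km; rewrite -qs1 (iter_ang_qs nvK) qs1.
  by move/evs_pin0; apply: evsM0.
move=> {}H; apply/evs_pin0 => n; rewrite -[pin _]mul1r -(EserV nvK e1 e2).
by rewrite mulrC mulrA [pin _ * _]mulrC mulrC; apply: evsM0.
Qed.
End LineValues.

(** * Invertibility of the modules of quasi-invariants *)

Section Reflection.
Variable K : comNzRingType.
Local Notation B := {poly {poly K}}.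
Implicit Types (p : B) (c s : K).

Definition flip : B -> B := @bev K B (@pc K) (pX1 K) (- pX2 K).
HB.instance Definition _ := GRing.RMorphism.on flip.

Lemma flipM p q : flip (p * q) = flip p * flip q. Proof. exact: rmorphM. Qed.
Lemma flipD p q : flip (p + q) = flip p + flip q. Proof. exact: rmorphD. Qed.
Lemma flipB p q : flip (p - q) = flip p - flip q. Proof. exact: rmorphB. Qed.
Lemma flipX1 : flip (pX1 K) = pX1 K. Proof. exact: bevX1. Qed.
Lemma flipX2 : flip (pX2 K) = - pX2 K. Proof. exact: bevX2. Qed.
Lemma flipC k : flip (pc k) = pc k. Proof. exact: bevC. Qed.

Lemma coef_flip p i j : (flip p)`_j`_i = (-1) ^+ j * p`_j`_i.
Proof.
elim/bpoly_ind: p i j => [k|p q IHp IHq|p IH|p IH] i j.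
- rewrite flipC /pc coefC; case: eqP => [->|_]; first by rewrite mul1r.
  by rewrite coef0 mulr0.
- by rewrite flipD !bcoefD IHp IHq mulrDr.
- rewrite flipM flipX1 !bcoefX1M.
  by case: i => [|i]; rewrite ?mulr0 // IH.
- rewrite flipM flipX2 mulNr bcoefN !bcoefX2M.
  by case: j => [|j]; rewrite ?mulr0 ?oppr0 // IH exprS mulN1r mulNr.
Qed.

Variables c s : K.
Hypothesis cs1 : c ^+ 2 + s ^+ 2 = 1.
Variables C S : K.
Hypotheses (CS1 : C * c + S * s = c) (CS2 : S * c - C * s = s).
Definition refl : B -> B :=
  @bev K B (@pc K) (pc C * pX1 K + pc S * pX2 K) (pc S * pX1 K - pc C * pX2 K).
HB.instance Definition _ := GRing.RMorphism.on refl.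

Lemma rot_refl p : rot c s (refl p) = flip (rot c s p).
Proof.
have c1 : pc c = pc C * pc c + pc S * pc s by rewrite -!pcM -pcD CS1.
have c2 : pc s = pc S * pc c - pc C * pc s by rewrite -!pcM -pcN -pcD CS2.
have r1 : rot c s (pc C * pX1 K + pc S * pX2 K) = pc c * pX1 K + pc s * pX2 K.
  rewrite rotD !rotM !rotC rotX1 rotX2.
  by apply: (etrans _ (esym (congr2 (fun u v => u * pX1 K + v * pX2 K) c1 c2))); ring.
have r2 : rot c s (pc S * pX1 K - pc C * pX2 K) = pc s * pX1 K - pc c * pX2 K.
  rewrite rotB !rotM !rotC rotX1 rotX2.
  by apply: (etrans _ (esym (congr2 (fun u v => v * pX1 K - u * pX2 K) c1 c2))); ring.
apply: (@bev_unique K B (rot c s \o refl) (flip \o rot c s)) => [k||] /=.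
- by rewrite [refl _]bevC rotC flipC.
- rewrite [refl _]bevX1 r1 rotX1 flipB !flipM !flipC.
  by rewrite flipX1 flipX2 mulrN opprK.
- rewrite [refl _]bevX2 r2 rotX2 flipD !flipM !flipC.
  by rewrite flipX1 flipX2 mulrN.
Qed.

Variable nv : nat -> K.
Hypothesis nvK : forall n, nv n * n.+1%:R = 1.

Lemma qs_e0 p : qs nv c s 0 0 p = pin (rot c s p).
Proof. by rewrite /qs /Erot !mulr0 addr0 subr0 Eser0 // mulr1. Qed.

(** In the frame of the line, [p - refl p] is twice the odd part in the normal coordinate. Column
    [2m] being even, vanishing of the odd columns below [2m] already gives divisibility by the power
    [2m + 1]. *)
Lemma refl_QI m p : (exists h, p - refl p = lf c s ^+ m.*2.+1 * h) <-> QI nv c s 0 0 m p.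
Proof.
rewrite lfX_dvdP //; split=> H i j.
  move=> oj jm; rewrite qs_e0 [LHS]/=; apply: (natI nvK (n := 1)); rewrite mul0rn.
  have := H i j (ltnW jm); rewrite rotB rot_refl bcoefB coef_flip -signr_odd oj expr1.
  by rewrite mulN1r opprK mulr2n.
rewrite ltnS => jm; rewrite rotB rot_refl bcoefB coef_flip -signr_odd.
case: (boolP (odd j)) => oj; last by rewrite mul1r subrr.
have := H i j oj; rewrite qs_e0 /= => ->; first by rewrite mulr0 subr0.
by rewrite ltn_neqAle jm andbT; apply: contraTneq oj => ->; rewrite odd_double.
Qed.
End Reflection.

(** * Truncated exponentials and splitting of high-order polynomials *)

Section TruncExp.
Variable K : comNzRingType.
Local Notation B := {poly {poly K}}.
Local Notation X1 := (pX1 K).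
Local Notation X2 := (pX2 K).
Implicit Types (p q w : B).
Variable nv : nat -> K.
Hypothesis nvK : forall n, nv n * n.+1%:R = 1.

Definition EX D w : B := \sum_(k < D) pc (fv nv k) * w ^+ k.

Lemma rot_EX c s D w : rot c s (EX D w) = EX D (rot c s w).
Proof.
rewrite /EX (rmorph_sum (rot c s)); apply: eq_bigr => k _.
by rewrite /= rotM rotC (rmorphXn (rot c s)).
Qed.

Lemma der_EX (d : B -> B) a D w : (forall p q, d (p + q) = d p + d q) ->
  (forall p q, d (p * q) = d p * q + p * d q) -> (forall k, d (pc k) = 0) ->
  d w = pc a -> d (EX D.+1 w) = pc a * EX D w.
Proof.
move=> dD dM dC dw; have d0 : d 0 = 0 by rewrite -(pc0 K) dC.
have dX n : d (w ^+ n.+1) = (pc a * w ^+ n) *+ n.+1.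
  elim: n => [|n IH]; first by rewrite expr1 expr0 mulr1 dw.
  rewrite exprS dM dw IH mulrnAr [w * (_ * _)]mulrCA -exprS.
  by rewrite -mulrS.
rewrite /EX (big_morph d dD d0) big_ord_recl dM dC expr0 -(pc1 K) dC mulr0 mul0r addr0 add0r.
rewrite mulr_sumr; apply: eq_bigr => k _; rewrite dM dC mul0r add0r dX /=.
by rewrite mulrnAr -mulrnAl -(rmorphMn (@pc K)) /= fvS // mulrCA.
Qed.

Lemma EXE D a b i j : (EX D (pc a * X1 + pc b * X2))`_j`_i =
  if (i + j < D)%N then a ^+ i * b ^+ j * (fv nv i * fv nv j) else 0.
Proof.
set w := _ + _; elim: D i j => [|D IH] i j; first by rewrite /EX big_ord0 !coef0.
have dw1 : pder1 w = pc a.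
  by rewrite /w pder1D !pder1M !pder1C pder1X1 pder1X2 !(mul0r, mulr0, mulr1, addr0, add0r).
have dw2 : pder2 w = pc b.
  by rewrite /w pder2D !pder2M !pder2C pder2X1 pder2X2 !(mul0r, mulr0, mulr1, addr0, add0r).
case: i => [|i]; last first.
  apply: (natI nvK (n := i)); rewrite -bcoef1.
  rewrite (der_EX _ (@pder1D K) (@pder1M K) (@pder1C K) dw1) bcoefCM IH addSn ltnS.
  case: ifP => _; last by rewrite mulr0 mul0rn.
  by rewrite -[RHS]mulrnAr -mulrnAl fvS // exprS !mulrA.
case: j => [|j]; last first.
  apply: (natI nvK (n := j)); rewrite -bcoef2.
  rewrite (der_EX _ (@pder2D K) (@pder2M K) (@pder2C K) dw2) bcoefCM IH addnS ltnS.
  case: ifP => _; last by rewrite mulr0 mul0rn.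
  by rewrite -[RHS]mulrnAr -mulrnAr fvS // exprS; ring.
rewrite /EX big_ord_recl bcoefD expr0 mulr1 coef_sum coef_sum big1 ?addr0 => [|k _].
  by rewrite [in LHS]/= /fv big_ord0 !mulr1 pc1 !coef1.
have dw : dge 1 w.
  by apply: dgeD; apply: dgeCM; [apply: dgeX1 | apply: dgeX2].
by rewrite bcoefCM [X in _ * X](@dgeX _ 1 (lift ord0 k) _ dw 0%N 0%N) ?mulr0.
Qed.

(* Multiplication by [exp (b t)] turns the truncation of [exp (- b t)] into 1 up to order [D]. *)
Lemma EX_Eser D b i j : (j < D)%N ->
  (pin (EX D (pc (- b) * X2)) * Eser nv 0 b) i j = (1 : ser K) i j.
Proof.
move=> jD; rewrite -(EserV nvK 0 b) oppr0 mulrC !scM.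
apply: eq_bigr => x _; apply: eq_bigr => y _; congr (_ * _); rewrite /=.
have -> : pc (- b) * X2 = pc 0 * X1 + pc (- b) * X2 by rewrite pc0 mul0r add0r.
rewrite EXE.
have := leq_ord y; move: (i - x)%N => [|n] yj; last by rewrite expr0n !mul0r if_same.
by case: ltnP => //; lia.
Qed.
End TruncExp.

Section Split.
Variable K : comNzRingType.
Local Notation B := {poly {poly K}}.
Implicit Types (p q : B).

Lemma bcoef_X1XM m p i j : (pX1 K ^+ m * p)`_j`_i = if (i < m)%N then 0 else p`_j`_(i - m).
Proof.
elim: m i => [|m IH] i; first by rewrite mul1r subn0.
by rewrite exprS -mulrA bcoefX1M; case: i => // i; rewrite IH.
Qed.
Lemma bcoef_X2XM m p i j : (pX2 K ^+ m * p)`_j`_i = if (j < m)%N then 0 else p`_(j - m)`_i.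
Proof.
elim: m j => [|m IH] j; first by rewrite mul1r subn0.
by rewrite exprS -mulrA bcoefX2M; case: j => // j; rewrite IH.
Qed.

(** A monomial [x1^i x2^j] with [i < m] and [j < n] has too small a degree to occur in [p]. The last
    clause lets parity conditions on columns pass from [p] to [h]. *)
Lemma box_split m n k p : dge (m + n + k) p -> exists h q,
  [/\ p = pX1 K ^+ m * h + pX2 K ^+ n * q, dge k h, dge k q &
      forall i j, h`_j`_i = if (j < n)%N then p`_j`_(m + i) else 0].
Proof.
move=> dp; pose h : B := \poly_(j < n) drop_poly m p`_j; exists h, (drop_poly n p).
have hE i j : h`_j`_i = if (j < n)%N then p`_j`_(m + i) else 0.
  by rewrite coef_poly; case: ifP => _; rewrite ?coef0 // coef_drop_poly addnC.
split=> // [|i j ij|i j ij].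
- apply: bpolyP => i j; rewrite bcoefD bcoef_X1XM bcoef_X2XM hE coef_drop_poly.
  case: (ltnP j n) => jn; case: (ltnP i m) => im; rewrite ?addr0 ?add0r.
  + by apply: dp; lia.
  + by rewrite subnKC.
  + by rewrite subnK.
  + by rewrite subnK.
- by rewrite hE; case: ifP => // jn; apply: dp; lia.
- by rewrite coef_drop_poly; apply: dp; lia.
Qed.
End Split.

(** * Quasi-invariants modulo a power of one linear form *)

Section Modules.
Variable K : comNzRingType.
Local Notation B := {poly {poly K}}.
Local Notation X1 := (pX1 K).
Local Notation X2 := (pX2 K).
Implicit Types (p q : B).
Variable nv : nat -> K.
Hypothesis nvK : forall n, nv n * n.+1%:R = 1.

Section Line.
Variables (c s : K) (m : nat).
Hypothesis cs1 : c ^+ 2 + s ^+ 2 = 1.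
Local Notation QIl e1 e2 := (QI nv c s e1 e2 m).
Local Notation l := (lf c s).
Local Notation N := m.*2.+1.

(** The exponent [N = 2 m + 1] is positive even for [m = 0], which [cong00] relies on. *)
Definition cong p q := exists h, p - q = l ^+ N * h.

Lemma cong_refl p : cong p p.
Proof. by exists 0; rewrite subrr mulr0. Qed.
Lemma cong_sym p q : cong p q -> cong q p.
Proof. by case=> h e; exists (- h); rewrite mulrN -e opprB. Qed.
Lemma cong_trans p q r : cong p q -> cong q r -> cong p r.
Proof. by move=> [h e] [k f]; exists (h + k); rewrite mulrDr -e -f addrA subrK. Qed.
Lemma congD p q p' q' : cong p q -> cong p' q' -> cong (p + p') (q + q').
Proof. by move=> [h e] [k f]; exists (h + k); rewrite mulrDr -e -f opprD addrACA. Qed.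
Lemma congN p q : cong p q -> cong (- p) (- q).
Proof. by move=> [h e]; exists (- h); rewrite mulrN -e opprD. Qed.
Lemma congM p q p' q' : cong p q -> cong p' q' -> cong (p * p') (q * q').
Proof.
move=> [h e] [k f]; exists (h * p' + q * k).
by rewrite mulrDr [_ * (q * k)]mulrCA mulrA -e -f; ring.
Qed.
Lemma cong_lfM p : cong (l ^+ N * p) 0.
Proof. by exists p; rewrite subr0. Qed.

Lemma cong00 p q : cong p q -> p`_0`_0 = q`_0`_0.
Proof.
case=> h /(congr1 (fun r : B => r`_0`_0)); rewrite bcoefB => e.
apply/eqP; rewrite -subr_eq0 e.
by rewrite (dgeM (m := N) (n := 0) _ (@dge0 _ h)) ?addn0 // -[N in dge N _]muln1; apply: dgeX; apply: dge_lf.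
Qed.

Lemma QI_cong e1 e2 p q : cong p q -> QIl e1 e2 q -> QIl e1 e2 p.
Proof.
case=> h e Qq; have -> : p = l ^+ m.*2 * (l * h) + q by rewrite mulrA -exprSr -e subrK.
by apply: QI_D => //; apply: QI_lfX.
Qed.

Lemma QI_mul e1 e2 f1 f2 p q : QIl e1 e2 p -> QIl f1 f2 q -> QIl (e1 + f1) (e2 + f2) (p * q).
Proof.
move=> Qp Qq; rewrite /QI.
have -> : qs nv c s (e1 + f1) (e2 + f2) (p * q) = qs nv c s e1 e2 p * qs nv c s f1 f2 q.
  rewrite /qs rotM pinM mulrACA; congr (_ * _); rewrite /Erot (Eser_mul nvK).
  by congr Eser; ring.
exact: (vanishM (b := true) (b' := true)).
Qed.

Lemma QI0_1 : QIl 0 0 1.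
Proof. by rewrite /QI qs_e0 // (rmorph1 (rot c s)) pin1 -(rmorph1 (@kc K)); apply: vanish_kc. Qed.

Local Notation y := (pc c * X1 + pc s * X2).
Lemma rot_y : rot c s y = X1.
Proof.
have cs : pc c ^+ 2 + pc s ^+ 2 = 1 by rewrite !expr2 -!pcM -pcD -!expr2 cs1 pc1.
by rewrite rotD !rotM !rotC rotX1 rotX2 -[RHS]mul1r -cs; ring.
Qed.

Lemma QI0_yM k p : QIl 0 0 p -> QIl 0 0 (y ^+ k * p).
Proof.
rewrite /QI !qs_e0 // rotM pinM (rmorphXn (rot c s)) /= rot_y (rmorphXn (@pin K)) /= pinX1.
by move=> v; apply/vanish_Y1X.
Qed.

(* Truncation of [exp (- c t)], which cancels the factor [exp (c t)] transversal to the line. *)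
Definition twist D e1 e2 := EX nv D (pc (- (c * e2 - s * e1)) * l).

(** The weight is a tangential exponential, free of the normal coordinate, times a normal one, which
    the truncated factor cancels up to order [D]. *)
Lemma QI_twist D e1 e2 p : (N <= D)%N -> QIl 0 0 p -> QIl e1 e2 (twist D e1 e2 * p).
Proof.
move=> ND; rewrite /QI qs_e0 // => v.
rewrite /qs rotM pinM /twist rot_EX rotM rotC rot_lf //.
set b := c * e2 - s * e1.
have -> : Erot nv c s e1 e2 = Eser nv (c * e1 + s * e2) 0 * Eser nv 0 b.
  by rewrite (Eser_mul nvK) addr0 add0r.
have -> (u w x z : ser K) : u * w * (x * z) = w * (x * (u * z)) by ring.
apply: (vanishM (b := true) (b' := true)) => //.
apply: (vanishM (b := true) (b' := true)) => //; first exact: vanish_E0.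
move=> i j oj jm; rewrite (EX_Eser nvK); last by apply: leq_trans ND; apply: leq_trans jm _.
by rewrite -(rmorph1 (@kc K)); exact: (@vanish_kc K _ 1 i j oj jm).
Qed.

Lemma twistK D e1 e2 : (N <= D)%N -> cong (twist D e1 e2 * twist D (- e1) (- e2)) 1.
Proof.
move=> ND; apply/(lfX_dvdP cs1) => i j jN.
rewrite rotB (rmorph1 (rot c s)) rotM /twist !rot_EX !rotM !rotC rot_lf // bcoefB.
set b := c * e2 - s * e1; have -> : c * - e2 - s * - e1 = - b by rewrite /b; ring.
set P := EX _ _ _; set Q := EX _ _ _.
have jD : (j < D)%N by apply: leq_trans ND.
suff -> : (P * Q)`_j`_i = (1 : ser K) i j by rewrite -pin1 subrr.
rewrite -[LHS]/(pin (P * Q) i j) pinM.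
have -> : pin P * pin Q = pin P * Eser nv 0 b * (pin Q * Eser nv 0 (- b)).
  have := EserV nvK 0 b; rewrite oppr0 => E; rewrite mulrACA E mulr1 //.
rewrite -(mul1r 1) !scM; apply: eq_bigr => x _; apply: eq_bigr => z _.
rewrite (EX_Eser nvK); last by apply: leq_ltn_trans jD; apply: leq_ord.
by rewrite (EX_Eser nvK) //; apply: leq_ltn_trans jD; apply: leq_subr.
Qed.

Lemma line_split k n p : dge (k + N + n) p -> exists h q,
  [/\ p = y ^+ k * h + l ^+ N * q, dge n h, dge n q & QIl 0 0 p -> QIl 0 0 h].
Proof.
move=> /(@dge_rot _ _ c s)/box_split[h [q [pE dh dq hE]]].
exists (rot c (- s) h), (rot c (- s) q); split; [|exact: dge_rot|exact: dge_rot|].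
  apply: (rot_inj cs1); rewrite pE rotD !rotM !(rmorphXn (rot c s)) /= rot_y rot_lf //.
  by rewrite !rot_idV.
rewrite /QI !qs_e0 // rot_idV // => v i j oj jm; rewrite /= hE; case: ifP => // _.
exact: v.
Qed.
End Line.
End Modules.

(** * Elements supported near one line, and the decomposition of 1 *)

Section Invertible.
Variable K : comNzRingType.
Local Notation B := {poly {poly K}}.
Local Notation X1 := (pX1 K).
Local Notation X2 := (pX2 K).
Implicit Types (p q : B).
Variables (I : eqType) (Pi : seq I) (mu : I -> nat) (co si : I -> K) (sdi : I -> I -> K).
Hypothesis uPi : uniq Pi.
Hypothesis cs1 : forall a, co a ^+ 2 + si a ^+ 2 = 1.
Hypothesis sdK : forall a b, a \in Pi -> b \in Pi -> a != b -> sdi a b * sd co si a b = 1.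
Variable nv : nat -> K.
Hypothesis nvK : forall n, nv n * n.+1%:R = 1.

Local Notation L := (L co si).
Local Notation QIall := (QIall Pi mu co si nv).
Local Notation cg a := (cong (co a) (si a) (mu a)).
Local Notation N a := (mu a).*2.+1.
Local Notation y a := (pc (co a) * X1 + pc (si a) * X2).
Local Notation S := (\sum_(a <- Pi) N a)%N.
Local Notation Delta := (\prod_(a <- Pi) L a ^+ N a).
Local Notation La a := (\prod_(b <- Pi | b != a) L b ^+ N b).

Definition inI (P Q x : B) := exists u v, x = P * u + Q * v.

Lemma inI_mul P P' Q x x' : inI P Q x -> inI P' Q x' -> inI (P * P') Q (x * x').
Proof.
move=> [u [v ->]] [u' [v' ->]].
by exists (u * u'), (P * u * v' + v * (P' * u' + Q * v')); ring.
Qed.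
Lemma inI_mulr P Q Q' x x' : inI P Q x -> inI P Q' x' -> inI P (Q * Q') (x * x').
Proof.
move=> [u [v ->]] [u' [v' ->]].
by exists (u * (P * u' + Q' * v') + Q * v * u'), (v * v'); ring.
Qed.
Lemma inI_M P Q x z : inI P Q x -> inI P Q (z * x).
Proof. by move=> [u [v ->]]; exists (z * u), (z * v); ring. Qed.

(** In the frame of [a] the form [y a] is [X1] and [L b] is [cd X2 - sd X1], with [sd]
    invertible. *)
Lemma y_comax a b : a \in Pi -> b \in Pi -> a != b -> inI (L b) (L a) (y a).
Proof.
move=> aP bP ab; exists (- pc (sdi a b)), (pc (sdi a b) * pc (cd co si a b)).
apply: (rot_inj (cs1 a)); rewrite rot_y // rotD !rotM rotN !rotC rot_lf // rot_L.
rewrite -[LHS]mul1r -pc1 -(sdK aP bP ab) pcM; ring.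
Qed.

Lemma y_inI a : a \in Pi -> inI (La a) (L a) (y a ^+ S).
Proof.
move=> aP; suff H (r : seq I) : {subset r <= Pi} ->
    inI (\prod_(b <- r | b != a) L b ^+ N b) (L a) (y a ^+ \sum_(b <- r) N b) by apply: H.
elim: r => [|b r IH] rP; first by exists 1, 0; rewrite !big_nil expr0 mulr0 addr0 mulr1.
have {}IH := IH (fun x xr => rP x (mem_behead (s := b :: r) xr)).
have bP := rP b (mem_head _ _).
rewrite !big_cons exprD; case: eqVneq => [_|ba] /=; first exact: inI_M.
apply: inI_mul => //; elim: (N b) => [|n IHn]; first by exists 1, 0; rewrite expr0 mulr0 addr0 mulr1.
by rewrite !exprS; apply: inI_mul => //; apply: y_comax; rewrite // eq_sym.
Qed.

Lemma leq_NS a : a \in Pi -> (N a <= S)%N.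
Proof. by move=> aP; rewrite (bigD1_seq a) //= leq_addr. Qed.

(** By [y_inI] the power [S] of [y a] lies in the ideal of [La a] and [L a]. Replacing [L a] by its
    power [N a] takes [N a] such factors, and [N a <= S] makes [S * S] serve all lines. *)
Definition ydeg := (S * S)%N.

(* [e a] is [y a ^+ ydeg] to high order along the line of [a] and 0 along the others. *)
Lemma idem_exists : exists e : I -> B, forall a, a \in Pi ->
  [/\ forall b, b \in Pi -> b != a -> cg b (e a) 0, cg a (e a) (y a ^+ ydeg) &
      exists u, L a ^+ N a * e a = Delta * u].
Proof.
suff /boolp.choice[e eP] : forall a, exists e : B, a \in Pi ->
    [/\ forall b, b \in Pi -> b != a -> cg b e 0, cg a e (y a ^+ ydeg) &
      exists u, L a ^+ N a * e = Delta * u] by exists e.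
move=> a.
have [aP|_] := boolP (a \in Pi); last by exists 0.
have [u [v E]] : inI (La a) (L a ^+ N a) (y a ^+ ydeg).
  have := y_inI aP; rewrite /ydeg exprM; move: (y a ^+ S) => z zI.
  rewrite -(subnK (leq_NS aP)) exprD; apply: inI_M.
  elim: (N a) => [|n IH]; first by exists 0, 1; rewrite !expr0 mulr0 add0r mulr1.
  by rewrite !exprS; apply: inI_mulr.
exists (La a * u) => _; split.
- move=> b bP ba; rewrite -big_filter (bigD1_seq b) ?filter_uniq ?mem_filter ?ba //= -mulrA.
  exact: cong_lfM.
- by apply: cong_sym; exists v; rewrite E addrC addKr.
- by exists u; rewrite (bigD1_seq a aP uPi) //= mulrA.
Qed.

Lemma M_gt0 a : a \in Pi -> (0 < ydeg)%N.
Proof. by move=> /leq_NS NS; rewrite muln_gt0 andbb; apply: leq_trans NS. Qed.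

Lemma Delta_QI e1 e2 p : QIall e1 e2 (Delta * p).
Proof.
move=> a aP; rewrite (bigD1_seq a aP uPi) //= -mulrA exprSr -mulrA.
by apply: (QI_lfX nv (cs1 a)).
Qed.

Lemma cong_Delta p : (forall a, a \in Pi -> cg a p 0) -> exists g, p = Delta * g.
Proof.
move=> H; apply: (prod_dvd (Pi := Pi) cs1) => //.
  move=> a b aP bP ab x e.
  by rewrite -[x]mul1r -(sdK aP bP ab) -mulrA e mulr0.
by move=> a /H[h]; rewrite subr0; exists h.
Qed.

Lemma cong_sum a (r : seq I) (F G : I -> B) : (forall b, b \in r -> cg a (F b) (G b)) ->
  cg a (\sum_(b <- r) F b) (\sum_(b <- r) G b).
Proof.
elim: r => [|b r IH] H; first by rewrite !big_nil; apply: cong_refl.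
rewrite !big_cons; apply: congD; first by apply: H; rewrite mem_head.
by apply: IH => x xr; apply: H; rewrite inE xr orbT.
Qed.

Lemma cong_pick a (F : I -> B) : a \in Pi -> (forall b, b \in Pi -> b != a -> cg a (F b) 0) ->
  cg a (\sum_(b <- Pi) F b) (F a).
Proof.
move=> aP H; apply: (cong_trans (cong_sum (G := fun b => if b == a then F a else 0) _)).
  by move=> b bP; case: eqVneq => [->|ba]; [apply: cong_refl | apply: H].
rewrite (bigD1_seq a aP uPi) /= eqxx big1 ?addr0; first exact: cong_refl.
by move=> b /negPf ->.
Qed.

Variable e : I -> B.
Hypothesis e0 : forall a b, a \in Pi -> b \in Pi -> b != a -> cg b (e a) 0.
Hypothesis eM : forall a, a \in Pi -> cg a (e a) (y a ^+ ydeg).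
Hypothesis eD : forall a, a \in Pi -> exists u, L a ^+ N a * e a = Delta * u.

Lemma e00 a : a \in Pi -> (e a)`_0`_0 = 0.
Proof.
move=> aP; rewrite (cong00 (eM aP)).
have dy : dge 1 (y a) by apply: dgeD; apply: dgeCM; [exact: dgeX1 | exact: dgeX2].
by rewrite (@dgeX _ 1 ydeg _ dy 0%N 0%N) // muln1 (M_gt0 aP).
Qed.

(** At each line a polynomial of high order splits as [y a ^ ydeg * h + L a ^ N a * g], and its
    first summand is a multiple of [e a] modulo [L a ^ N a]. Going through all lines accumulates the
    factor [Delta]. *)
Lemma high_order_ideal (Id : B -> Prop) :
  (forall p q, Id p -> Id q -> Id (p + q)) -> (forall r p, Id p -> Id (r * p)) ->
  (forall a, a \in Pi -> Id (e a)) -> Id Delta ->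
  forall p, dge (\sum_(a <- Pi) (ydeg + N a)) p -> Id p.
Proof.
move=> IdD IdM Ide IdDel p dp.
suff H (r : seq I) q p' : {subset r <= Pi} -> (forall g, Id (q * \prod_(a <- r) L a ^+ N a * g)) ->
    dge (\sum_(a <- r) (ydeg + N a)) p' -> Id (q * p').
  by rewrite -[p]mul1r; apply: H dp => // g; rewrite mul1r mulrC; apply: IdM.
elim: r q p' => [|a r IH] q p' rP H dp'.
  by have := H p'; rewrite big_nil mulr1.
have aP := rP a (mem_head _ _).
move: dp'; rewrite big_cons => /(line_split nvK (cs1 a))[h [g [-> dh dg _]]].
have [w wE] := cong_sym (eM aP).
have -> : q * (y a ^+ ydeg * h + L a ^+ N a * g) =
    q * h * e a + (q * L a ^+ N a * (w * h) + q * L a ^+ N a * g).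
  have -> : y a ^+ ydeg = e a + L a ^+ N a * w by rewrite -wE [RHS]addrC subrK.
  ring.
apply: IdD; first by apply: IdM; apply: Ide.
have rP' x : x \in r -> x \in Pi by move=> xr; apply: rP; rewrite inE xr orbT.
have H' g' : Id (q * L a ^+ N a * \prod_(b <- r) L b ^+ N b * g').
  by have := H g'; rewrite big_cons !mulrA.
rewrite -mulrDr; apply: IH => //; apply: dgeD => //.
exact: (dgeM (@dge0 _ w) dh).
Qed.

Local Notation D := (ydeg + S)%N.
Local Notation tw e1 e2 a := (twist nv (co a) (si a) D e1 e2).
Local Notation QIa a := (QI nv (co a) (si a) 0 0 (mu a)).

Lemma leq_ND a : a \in Pi -> (N a <= D)%N.
Proof. by move=> aP; apply: leq_trans (leq_addl _ _); apply: leq_NS. Qed.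

Lemma local_QI e1 e2 a c : a \in Pi -> QIa a c -> QIall e1 e2 (tw e1 e2 a * (e a * c)).
Proof.
move=> aP Qc b bP; case: (eqVneq b a) => [->|ba].
  apply: (QI_cong (cs1 a) (q := tw e1 e2 a * (y a ^+ ydeg * c))).
    by apply: congM; [apply: cong_refl | apply: congM; [apply: eM | apply: cong_refl]].
  by apply: (QI_twist nvK (cs1 a)); [apply: leq_ND | apply: (QI0_yM nvK)].
apply: (QI_cong (cs1 b) (q := 0)); last exact: QI_0.
rewrite -[0](mulr0 (tw e1 e2 a)) -[in X in cong _ _ _ _ X](mul0r c).
by apply: congM; [apply: cong_refl | apply: congM; [apply: e0 | apply: cong_refl]].
Qed.

Lemma rot_exp a e1 e2 : rot (co a) (si a) (pc (- e1) * X1 + pc (- e2) * X2) =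
  pc (- (co a * e1 + si a * e2)) * X1 + pc (- (co a * e2 - si a * e1)) * X2.
Proof.
rewrite rotD !rotM !rotC rotX1 rotX2 !pcN pcD pcD pcN !pcM; ring.
Qed.

(** The truncation [f] of [exp (- e.x)] fails to be quasi-invariant only in high order. Up to order
    [ydeg + N a] it agrees with the twist at [a] of a polynomial in the tangential coordinate, and
    [line_split] makes the error a multiple of [e a] modulo [L a ^ N a]. Subtracting these errors
    for all lines does not change the value at the origin, where each [e a] vanishes. *)
Lemma unit_at_origin e1 e2 : exists f, QIall e1 e2 f /\ f`_0`_0 = 1.
Proof.
pose f := EX nv D.+1 (pc (- e1) * X1 + pc (- e2) * X2).
have R a : exists r, a \in Pi -> exists h, [/\ QIa a h &
    cg a (f - e a * r) (tw e1 e2 a * h)].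
  have [aP|_] := boolP (a \in Pi); last by exists 0.
  pose h := EX nv D.+1 (pc (- (co a * e1 + si a * e2)) * y a).
  have Qh : QIa a h.
    rewrite /QI qs_e0 // /h rot_EX rotM rotC rot_y // => i j oj jm /=.
    have -> : pc (- (co a * e1 + si a * e2)) * X1 =
      pc (- (co a * e1 + si a * e2)) * X1 + pc 0 * X2 by rewrite pc0 mul0r addr0.
    rewrite (EXE nvK); case: ifP => // _.
    by case: j oj {jm} => // j _; rewrite expr0n /= mulr0 mul0r.
  have dD : dge (ydeg + N a + 0) (f - tw e1 e2 a * h).
    rewrite -[f - _](rot_id (cs1 a)); apply: dge_rot => i j; rewrite addn0 => ij.
    have ijD : (i + j < D)%N by apply: leq_trans ij _; rewrite leq_add2l leq_NS.
    rewrite rotB bcoefB rotM /f /h /twist !rot_EX rot_exp !rotM !rotC rot_y // rot_lf //.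
    set b := - (_ + _); set c := - (_ - _).
    rewrite (EXE nvK) (ltnW (n := _.+1)) ?ltnS // -[X in _ - X]/(pin (_ * _) i j) pinM.
    have -> : pc b * X1 = pc b * X1 + pc 0 * X2 by rewrite pc0 mul0r addr0.
    have -> : pc c * X2 = pc 0 * X1 + pc c * X2 by rewrite pc0 mul0r add0r.
    apply/eqP; rewrite subr_eq0 -[X in X == _]/(Eser nv b c i j); apply/eqP.
    rewrite -[b in LHS]add0r -[c in LHS]addr0 -(Eser_mul nvK) !scM.
    apply: eq_bigr => x _; apply: eq_bigr => z _; have lx := leq_ord x; have lz := leq_ord z.
    by rewrite /= !(EXE nvK) !ifT //; lia.
  have [r [q [E _ _ _]]] := line_split nvK (cs1 a) dD.
  exists r => _; exists h; split=> //.
  have [g gE] : cg a (f - tw e1 e2 a * h) (e a * r).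
    apply: cong_trans (congM (cong_sym (eM aP)) (cong_refl _ _ _ r)).
    by exists q; rewrite E addrC addKr.
  by exists g; rewrite -gE addrAC.
have [r rP] := boolp.choice R.
exists (f - \sum_(b <- Pi) e b * r b); split.
- move=> a aP; have [h [Qh hE]] := rP a aP.
  apply: (QI_cong (cs1 a) (q := tw e1 e2 a * h)); last first.
    by apply: (QI_twist nvK (cs1 a)); [apply: leq_ND|].
  apply: cong_trans hE; apply: congD; first exact: cong_refl.
  apply: congN; apply: (cong_pick (F := fun b => e b * r b)) => // b bP ba.
  rewrite -[0](mul0r (r b)); apply: congM; last exact: cong_refl.
  by apply: e0 => //; rewrite eq_sym.
rewrite bcoefB /f (EXE nvK) /= !expr0 /fv big_ord0 !mul1r coef_sum coef_sum.
rewrite big_seq big1 ?subr0 // => a aP.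
by rewrite bcoefM /= big_ord_recl big_ord0 big_ord_recl big_ord0 /= e00 // mul0r !addr0.
Qed.

Lemma QIall_mul e1 e2 f1 f2 p q : QIall e1 e2 p -> QIall f1 f2 q -> QIall (e1 + f1) (e2 + f2) (p * q).
Proof. by move=> Qp Qq a aP; apply: (QI_mul nvK); [apply: Qp | apply: Qq]. Qed.
Lemma QIall0_mul e1 e2 p q : QIall 0 0 p -> QIall e1 e2 q -> QIall e1 e2 (p * q).
Proof. by move=> Qp /(QIall_mul Qp); rewrite !add0r. Qed.
Lemma QIall0_1 : QIall 0 0 1.
Proof. by move=> a aP; apply: (QI0_1 nvK). Qed.

Lemma one_sub_expr (x : B) n : 1 - x ^+ n = (1 - x) * \sum_(i < n) x ^+ i.
Proof. by rewrite -opprB -[1 - x]opprB subrX1 mulNr. Qed.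

Section Pairing.
Variables e1 e2 : K.

Definition sumprod (P Q : B -> Prop) x := exists r : seq (B * B),
  (forall t, t \in r -> P t.1 /\ Q t.2) /\ x = \sum_(t <- r) t.1 * t.2.

Lemma sumprodD P Q x z : sumprod P Q x -> sumprod P Q z -> sumprod P Q (x + z).
Proof.
move=> [r [rP ->]] [r' [rP' ->]]; exists (r ++ r'); rewrite big_cat; split=> // t.
by rewrite mem_cat => /orP[/rP|/rP'].
Qed.
Lemma sumprod1 (P Q : B -> Prop) p q : P p -> Q q -> sumprod P Q (p * q).
Proof. by move=> Pp Qq; exists [:: (p, q)]; rewrite big_seq1; split=> // t; rewrite inE => /eqP ->. Qed.
Lemma sumprodM (P Q : B -> Prop) r x : (forall q, Q q -> Q (r * q)) ->
  sumprod P Q x -> sumprod P Q (r * x).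
Proof.
move=> QM [s [sP ->]]; exists [seq (t.1, r * t.2) | t <- s]; split=> [t /mapP[t' /sP[P1 Q1] ->]|].
  by split=> //; apply: QM.
by rewrite big_map mulr_sumr; apply: eq_bigr => t _; rewrite mulrCA.
Qed.
Lemma sumprod_sum (P Q : B -> Prop) (J : eqType) (r : seq J) (F : J -> B) :
  (forall j, j \in r -> sumprod P Q (F j)) -> sumprod P Q (\sum_(j <- r) F j).
Proof.
elim: r => [|j r IH] H; first by exists [::]; rewrite !big_nil.
rewrite big_cons; apply: sumprodD; first by apply: H; rewrite mem_head.
by apply: IH => k kr; apply: H; rewrite inE kr orbT.
Qed.

(** The ideal generated by the module contains [Delta], and also each [e a], since twists are
    invertible modulo [L a ^ N a]. Hence it contains all polynomials of high order, in particular a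
    power of [1 - f], where [f] has value 1 at the origin; and 1 differs from that power by a
    multiple of [f]. *)
Lemma sumprod_ideal : sumprod (QIall e1 e2) (fun _ => True) 1.
Proof.
have [f [Qf f0]] := unit_at_origin e1 e2.
pose K' := (\sum_(a <- Pi) (ydeg + N a))%N.
have H : sumprod (QIall e1 e2) (fun _ => True) ((1 - f) ^+ K').
  apply: high_order_ideal.
  - exact: sumprodD.
  - by move=> r p; apply: sumprodM.
  - move=> a aP; have [w wE] := cong_sym (twistK nvK (cs1 a) e1 e2 (leq_ND aP)).
    have [u uE] := eD aP.
    have -> : e a = tw e1 e2 a * (e a * 1) * tw (- e1) (- e2) a + Delta * u * w.
      rewrite -uE [L a ^+ N a * _]mulrC -[e a * _ * w]mulrA -wE; ring.
    by apply: sumprodD; apply: sumprod1 => //; [apply: (local_QI _ _ aP); apply: (QI0_1 nvK) | apply: Delta_QI].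
  - rewrite -[X in sumprod _ _ X]mulr1; apply: sumprod1 => //.
    by have := Delta_QI e1 e2 1; rewrite mulr1.
  - rewrite -[K' in dge K']muln1; apply: dgeX => i j; case: i => [|//]; case: j => // _.
    by rewrite bcoefB f0 !coef1 subrr.
have -> : 1 = f * \sum_(i < K') (1 - f) ^+ i + (1 - f) ^+ K'.
  have := one_sub_expr (1 - f) K'; rewrite opprB addrCA subrr addr0 => <-.
  by rewrite subrK.
by apply: sumprodD => //; apply: sumprod1.
Qed.

(** [Delta] brings any cofactor into the opposite module, which makes the unconstrained factors of
    [sumprod_ideal] admissible. *)
Lemma sumprod_Delta g : sumprod (QIall e1 e2) (QIall (- e1) (- e2)) (Delta * g).
Proof.
have [r [rP E]] := sumprod_ideal.
have -> : Delta * g = \sum_(t <- r) t.1 * (Delta * (t.2 * g)).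
  move: (Delta) => P; rewrite -[LHS]mul1r E mulr_suml; apply: eq_bigr => t _; ring.
by apply: sumprod_sum => t /rP[Qt _]; apply: sumprod1 => //; apply: Delta_QI.
Qed.

(** Along [a], [p] is [y a ^ (2 ydeg) * c] with [c] quasi-invariant of weight 0. One factor
    [y a ^ ydeg] goes to each module, in the form of [e a] with opposite twists. The products [F a]
    so obtained leave an error divisible by [Delta]. *)
Lemma sumprod_high p : QIall 0 0 p -> dge (ydeg + ydeg + S) p ->
  sumprod (QIall e1 e2) (QIall (- e1) (- e2)) p.
Proof.
move=> Qp dp.
have R a : exists c, a \in Pi -> QIa a c /\ cg a p (y a ^+ (ydeg + ydeg) * c).
  have [aP|_] := boolP (a \in Pi); last by exists 0.
  have da : dge (ydeg + ydeg + N a + 0) p by apply: dge_leq dp; rewrite addn0 leq_add2l leq_NS.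
  have [c [q [pE _ _ Qc]]] := line_split nvK (cs1 a) da.
  by exists c => _; split; [apply: Qc; apply: Qp | exists q; rewrite {1}pE addrC addKr].
have [c cP] := boolp.choice R.
pose F a := tw e1 e2 a * (e a * c a) * (tw (- e1) (- e2) a * (e a * 1)).
have FJ a : a \in Pi -> sumprod (QIall e1 e2) (QIall (- e1) (- e2)) (F a).
  move=> aP; apply: sumprod1; apply: (local_QI _ _ aP); last exact: (QI0_1 nvK).
  by have [] := cP a aP.
have [g gE] : exists g, p - \sum_(a <- Pi) F a = Delta * g.
  apply: cong_Delta => a aP; rewrite -[X in cong _ _ _ _ X](subrr p); apply: congD; first exact: cong_refl.
  apply: congN; apply: (cong_trans (q := F a)).
    apply: (cong_pick (F := F)) => // b bP ba.
    rewrite -[0](mul0r (tw (- e1) (- e2) b * (e b * 1))); apply: congM; last exact: cong_refl.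
    rewrite -[0](mulr0 (tw e1 e2 b)) -[in X in cong _ _ _ _ X](mul0r (c b)).
    apply: congM; [exact: cong_refl | apply: congM; [|exact: cong_refl]].
    by apply: e0 => //; rewrite eq_sym.
  have [_ pc'] := cP a aP; apply: cong_trans (cong_sym pc').
  have -> : F a = tw e1 e2 a * tw (- e1) (- e2) a * (e a * e a * c a) by rewrite /F; ring.
  rewrite -[y a ^+ _ * _]mul1r exprD; apply: congM; first exact: (twistK nvK (cs1 a) _ _ (leq_ND aP)).
  by apply: congM; [apply: congM; apply: eM | apply: cong_refl].
rewrite -[p](subrK (\sum_(a <- Pi) F a)) gE; apply: sumprodD; first exact: sumprod_Delta.
by apply: sumprod_sum => a /FJ.
Qed.

(** [n = 1 - f g] is quasi-invariant of weight 0 and vanishes at the origin. A high power of it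
    falls under [sumprod_high], and the geometric sum supplies a product of the required form. *)
Lemma sumprod_1 : sumprod (QIall e1 e2) (QIall (- e1) (- e2)) 1.
Proof.
have [f [Qf f0]] := unit_at_origin e1 e2.
have [g [Qg g0]] := unit_at_origin (- e1) (- e2).
pose K' := (ydeg + ydeg + S)%N; pose n := 1 - f * g.
have Qfg : QIall 0 0 (f * g) by have := QIall_mul Qf Qg; rewrite !subrr.
have Qn : QIall 0 0 n.
  by move=> a aP; apply: QI_B; [apply: QIall0_1 | apply: Qfg].
have QnX k : QIall 0 0 (n ^+ k).
  elim: k => [|k IH]; first exact: QIall0_1.
  by rewrite exprS; apply: QIall0_mul.
have -> : 1 = f * (g * \sum_(i < K') n ^+ i) + n ^+ K'.
  have := one_sub_expr n K'; rewrite {2}/n opprB addrCA subrr addr0 mulrA => <-.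
  by rewrite subrK.
apply: sumprodD.
  apply: sumprod1 => //; rewrite mulrC; apply: QIall0_mul => //.
  by move=> a aP; apply: QI_sum => i _; apply: QnX.
apply: sumprod_high => //; rewrite -[X in dge X]muln1; apply: dgeX => i j.
case: i => [|//]; case: j => // _; rewrite bcoefB bcoefM !coef1 !big_ord_recl !big_ord0 /=.
by rewrite f0 g0 mulr1 !addr0 subrr.
Qed.
End Pairing.
End Invertible.

Theorem QIall_invertible (K : comNzRingType) (I : eqType) (Pi : seq I) (mu : I -> nat)
    (co si : I -> K) (sdi : I -> I -> K) (nv : nat -> K) (e1 e2 : K) :
  uniq Pi -> (forall a, co a ^+ 2 + si a ^+ 2 = 1) ->
  (forall a b, a \in Pi -> b \in Pi -> a != b -> sdi a b * sd co si a b = 1) ->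
  (forall n, nv n * n.+1%:R = 1) ->
  exists r : seq ({poly {poly K}} * {poly {poly K}}),
    (forall t, t \in r -> QIall Pi mu co si nv e1 e2 t.1 /\
                          QIall Pi mu co si nv (- e1) (- e2) t.2) /\
    1 = \sum_(t <- r) t.1 * t.2.
Proof.
move=> uPi cs1 sdK nvK.
have [e eP] := idem_exists mu uPi cs1 sdK.
by apply: (sumprod_1 uPi cs1 sdK nvK (e := e)) => [a b aP bP ba|a aP|a aP];
  have [H1 H2 H3] := eP a aP; [apply: H1 | apply: H2 | apply: H3].
Qed.

(** * The spectral module *)

Section Tau.
Variable K : comNzRingType.
Local Notation B := {poly {poly K}}.
Implicit Types (p q : B).
Variables k1 k2 : K.

(** The Taylor expansion at [x = 0] of [p (x - k)], used with [k = xi]. *)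
Definition tau : B -> ser K := @bev K (ser K) (@kc K) (Y1 K - kc k1) (Y2 K - kc k2).
HB.instance Definition _ := GRing.RMorphism.on tau.

Lemma tauD p q : tau (p + q) = tau p + tau q. Proof. exact: rmorphD. Qed.
Lemma tauM p q : tau (p * q) = tau p * tau q. Proof. exact: rmorphM. Qed.
Lemma tauN p : tau (- p) = - tau p. Proof. exact: rmorphN. Qed.
Lemma tauMn p n : tau (p *+ n) = tau p *+ n. Proof. exact: rmorphMn. Qed.
Lemma tauC c : tau (pc c) = kc c. Proof. exact: bevC. Qed.
Lemma tauX1 : tau (pX1 K) = Y1 K - kc k1. Proof. exact: bevX1. Qed.
Lemma tauX2 : tau (pX2 K) = Y2 K - kc k2. Proof. exact: bevX2. Qed.

Lemma d1_tau p : d1 (tau p) = tau (pder1 p).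
Proof.
apply: (@derivation_unique K (ser K) tau (fun p => d1 (tau p)) (fun p => tau (pder1 p))) => {p}
  [p q|p q|p q|p q|c||].
- by rewrite tauD raddfD.
- by rewrite pder1D tauD.
- by rewrite tauM d1M.
- by rewrite pder1M tauD !tauM.
- by rewrite tauC d1C pder1C [RHS]rmorph0.
- by rewrite tauX1 raddfB /= d1Y1 d1C subr0 pder1X1 [RHS]rmorph1.
- by rewrite tauX2 raddfB /= d1Y2 d1C subr0 pder1X2 [RHS]rmorph0.
Qed.

Lemma d2_tau p : d2 (tau p) = tau (pder2 p).
Proof.
apply: (@derivation_unique K (ser K) tau (fun p => d2 (tau p)) (fun p => tau (pder2 p))) => {p}
  [p q|p q|p q|p q|c||].
- by rewrite tauD raddfD.
- by rewrite pder2D tauD.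
- by rewrite tauM d2M.
- by rewrite pder2M tauD !tauM.
- by rewrite tauC d2C pder2C [RHS]rmorph0.
- by rewrite tauX1 raddfB /= d2Y1 d2C subr0 pder2X1 [RHS]rmorph0.
- by rewrite tauX2 raddfB /= d2Y2 d2C subr0 pder2X2 [RHS]rmorph1.
Qed.

Variable nv : nat -> K.
Hypothesis nvK : forall n, nv n * n.+1%:R = 1.
Variables e1 e2 : K.
Local Notation E := (Eser nv e1 e2).

Lemma d1_tauE p : d1 (tau p * E) = tau (td1 e1 p) * E.
Proof. by rewrite d1M d1_tau (d1E nvK) /td1 tauD tauM tauC; ring. Qed.
Lemma d2_tauE p : d2 (tau p * E) = tau (td2 e2 p) * E.
Proof. by rewrite d2M d2_tau (d2E nvK) /td2 tauD tauM tauC; ring. Qed.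

Variables (I : eqType) (Pi : seq I) (mu : I -> nat) (co si : I -> K).
Local Notation del := (del Pi mu co si).
Local Notation dh := (dh Pi mu co si).
Local Notation L := (L co si).
Local Notation Rop := (Rop Pi mu co si e1 e2).
Hypothesis uPi : uniq Pi.
Hypothesis lap : del * (pder1 (pder1 del) + pder2 (pder2 del)) - (pder1 del ^+ 2 + pder2 del ^+ 2) *+ 2 =
  - \sum_(a <- Pi) dh a ^+ 2 *+ (mu a * (mu a).+1).
Variable inv : I -> ser K.
Hypothesis invK : forall a, a \in Pi -> inv a * tau (L a) = 1.

Definition pot := \sum_(a <- Pi) inv a ^+ 2 *+ (mu a * (mu a).+1).
Definition schroedinger (f : ser K) : ser K :=
  d1 (d1 f) + d2 (d2 f) - (pot * f + kc (e1 ^+ 2 + e2 ^+ 2) * f).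
Definition dinv := \prod_(a <- Pi) inv a ^+ mu a.

Lemma dinvK : dinv * tau del = 1.
Proof.
rewrite /del -lock (rmorph_prod tau) /= /dinv -big_split /= big_seq big1 // => a aP.
by rewrite (rmorphXn tau) /= -exprMn invK ?expr1n.
Qed.

Lemma tau_dh a : a \in Pi -> (tau (dh a) ^+ 2) *+ (mu a * (mu a).+1) =
  tau del ^+ 2 * (inv a ^+ 2 *+ (mu a * (mu a).+1)).
Proof.
move=> aP; case: (posnP (mu a)) => [->|ma]; first by rewrite mul0n !mulr0n mulr0.
rewrite (delE _ _ uPi aP ma) tauM mulrnAr -exprMn.
by congr (_ ^+ 2 *+ _); rewrite mulrC mulrA invK // mul1r.
Qed.

(* Conjugating by [tau del] turns the Schroedinger operator into [Rop / del]. *)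
Lemma schroedinger_step f p p' : f * tau del = tau p * E -> del * p' = Rop p ->
  schroedinger f * tau del = tau p' * E.
Proof.
move=> fp pp'; set D := tau del.
have reg (u v : ser K) : D * u = D * v -> u = v.
  by move=> e; rewrite -[u]mul1r -[v]mul1r -dinvK -!mulrA e.
have A1 : tau (td1 e1 p) * E = d1 f * D + f * d1 D by rewrite -d1_tauE -fp d1M.
have A2 : tau (td2 e2 p) * E = d2 f * D + f * d2 D by rewrite -d2_tauE -fp d2M.
have A11 : tau (td1 e1 (td1 e1 p)) * E = d1 (d1 f) * D + (d1 f * d1 D) *+ 2 + f * d1 (d1 D).
  by rewrite -d1_tauE A1 (raddfD (@d1 K)) /= !d1M; ring.
have A22 : tau (td2 e2 (td2 e2 p)) * E = d2 (d2 f) * D + (d2 f * d2 D) *+ 2 + f * d2 (d2 D).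
  by rewrite -d2_tauE A2 (raddfD (@d2 K)) /= !d2M; ring.
have lapD : D * (d1 (d1 D) + d2 (d2 D)) - (d1 D ^+ 2 + d2 D ^+ 2) *+ 2 = - (D ^+ 2 * pot).
  have := congr1 tau lap.
  rewrite tauD tauM tauD !tauN tauMn tauD !(rmorphXn tau) /= -!d1_tau -!d2_tau -/D => ->.
  congr (- _); rewrite (rmorph_sum tau) /pot mulr_sumr big_seq [RHS]big_seq.
  by apply: eq_bigr => a aP; rewrite /= tauMn (rmorphXn tau) /= tau_dh.
apply: reg; rewrite [RHS]mulrA -tauM pp'.
have -> : tau (Rop p) * E = D * (tau (td1 e1 (td1 e1 p)) * E + tau (td2 e2 (td2 e2 p)) * E
    - kc (e1 ^+ 2 + e2 ^+ 2) * (tau p * E)) -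
    (d1 D * (tau (td1 e1 p) * E) + d2 D * (tau (td2 e2 p) * E)) *+ 2.
  rewrite /Rop /lapt; move: (td1 e1 (td1 e1 p)) (td2 e2 (td2 e2 p)) => u v.
  move: (td1 e1 p) (td2 e2 p) => w x.
  rewrite tauD tauN tauMn tauM !tauD tauN !tauM tauC -!d1_tau -!d2_tau -/D; ring.
rewrite A11 A22 A1 A2 -fp /schroedinger; apply/esym/eqP; rewrite -subr_eq0; apply/eqP.
have Z := congr1 (fun x => f * (x + D ^+ 2 * pot)) lapD; rewrite /= addNr mulr0 in Z.
apply: (etrans _ Z).
move: (d1 (d1 f)) (d2 (d2 f)) (d1 (d1 D)) (d2 (d2 D)) => a1 a2 b1 b2.
move: (d1 f) (d2 f) (d1 D) (d2 D) pot (kc _) => a3 a4 b3 b4 c1 c2.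
ring.
Qed.
End Tau.

(** * Differentiation in [z] of power series in [x] *)

Section Coefficients.
Variable F : comNzRingType.
Local Notation K := {poly {poly F}}.
Local Notation B := {poly {poly K}}.
Local Notation X1 := (pX1 K).
Local Notation X2 := (pX2 K).
Implicit Types (f g : ser K) (p q : B).

Definition emb (f : ser F) : ser K := @Ser K (fun i j => pc (f i j)).
Fact emb_is_additive : zmod_morphism emb.
Proof. by move=> f g; apply: serP => i j; rewrite scB /= pcD pcN. Qed.
Fact emb_is_multiplicative : monoid_morphism emb.
Proof.
split=> [|f g]; apply: serP => i j.
  by rewrite /= /fps_c; case: ifP => _; rewrite ?pc1 ?pc0.
rewrite scM /emb /= /fps_mul (rmorph_sum (@pc F)); apply: eq_bigr => a _ /=.
by rewrite (rmorph_sum (@pc F)); apply: eq_bigr => b _; rewrite /= pcM.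
Qed.
HB.instance Definition _ := GRing.isZmodMorphism.Build _ _ emb emb_is_additive.
HB.instance Definition _ := GRing.isMonoidMorphism.Build _ _ emb emb_is_multiplicative.

Lemma embC c : emb (kc c) = kc (pc c).
Proof. by apply: serP => i j; rewrite /= /fps_c; case: ifP => _; rewrite ?pc0. Qed.
Lemma embY1 : emb (Y1 F) = Y1 K.
Proof. by apply: serP => i j; rewrite /= /fps_X1; case: ifP => _; rewrite ?pc0 ?pc1. Qed.
Lemma embY2 : emb (Y2 F) = Y2 K.
Proof. by apply: serP => i j; rewrite /= /fps_X2; case: ifP => _; rewrite ?pc0 ?pc1. Qed.

Section CoefDerivation.
Variable d : K -> K.
Hypothesis dD : forall u v, d (u + v) = d u + d v.
Hypothesis dM : forall u v, d (u * v) = d u * v + u * d v.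
Definition cder f : ser K := @Ser K (fun i j => d (f i j)).

Lemma cderD f g : cder (f + g) = cder f + cder g.
Proof. by apply: serP => i j; rewrite scD /= -dD. Qed.
Lemma cderM f g : cder (f * g) = cder f * g + f * cder g.
Proof.
have d0 : d 0 = 0 by apply: (addrI (d 0)); rewrite -dD !addr0.
apply: serP => i j; rewrite scD !scM -big_split /= /fps_mul (big_morph d dD d0).
apply: eq_bigr => a _; rewrite (big_morph d dD d0) -big_split /=; apply: eq_bigr => b _.
by rewrite dM.
Qed.
Lemma cder_kc c : cder (kc c) = kc (d c).
Proof.
have d0 : d 0 = 0 by apply: (addrI (d 0)); rewrite -dD !addr0.
by apply: serP => i j; rewrite /= /fps_c; case: ifP.
Qed.
End CoefDerivation.

Variables x1 x2 : F.
Local Notation tau := (tau (pc x1) (pc x2)).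

Lemma cder_tau (d : K -> K) (D : B -> B) :
  (forall u v, d (u + v) = d u + d v) -> (forall u v, d (u * v) = d u * v + u * d v) ->
  (forall p q, D (p + q) = D p + D q) -> (forall p q, D (p * q) = D p * q + p * D q) ->
  (forall c, d (pc c) = 0) -> (forall k, D (pc k) = pc (d k)) -> D X1 = 0 -> D X2 = 0 ->
  forall p, cder d (tau p) = tau (D p).
Proof.
move=> dD dM DD DM d0 DC D1 D2.
have cY1 : cder d (Y1 K - kc (pc x1)) = 0.
  apply: serP => i j; rewrite -embY1 -embC -(rmorphB emb) /=.
  exact: d0.
have cY2 : cder d (Y2 K - kc (pc x2)) = 0.
  apply: serP => i j; rewrite -embY2 -embC -(rmorphB emb) /=.
  exact: d0.
apply: (@derivation_unique K (ser K) tau (fun p => cder d (tau p)) (fun p => tau (D p)))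
  => [p q|p q|p q|p q|c||].
- by rewrite tauD cderD.
- by rewrite DD tauD.
- by rewrite tauM cderM.
- by rewrite DM tauD !tauM.
- by rewrite tauC cder_kc // DC tauC.
- by rewrite tauX1 cY1 D1 [RHS]rmorph0.
- by rewrite tauX2 cY2 D2 [RHS]rmorph0.
Qed.

Variable nv0 : nat -> F.
Hypothesis nvK0 : forall n, nv0 n * n.+1%:R = 1.
Local Notation pnv := (pnv nv0).
Local Notation E := (Eser pnv (pX1 F) (pX2 F)).

Lemma fv_pnv n : fv pnv n = pc (fv nv0 n).
Proof. by rewrite /fv (rmorph_prod (@pc F)). Qed.

Lemma scE i j : E i j = pX1 F ^+ i * pX2 F ^+ j * pc (fv nv0 i * fv nv0 j).
Proof. by rewrite /= !fv_pnv pcM. Qed.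

Lemma cder1_E : cder (@pder1 F) E = Y1 K * E.
Proof.
apply: serP => i j; rewrite scY1M -[LHS]/(pder1 (E i j)) scE.
rewrite pder1M pder1C mulr0 addr0 pder1M (derX (@pder1M F) (pX2 F)) pder1X2.
rewrite !mul0r mul0rn mulr0 addr0 (derX (@pder1M F) (pX1 F)) pder1X1 mul1r.
case: i => [|i]; first by rewrite mulr0n !mul0r.
by rewrite scE -(fvS nvK0 i) !(mulrnAl, pcM, rmorphMn (@pc F)) /= mulrnAr.
Qed.

Lemma cder2_E : cder (@pder2 F) E = Y2 K * E.
Proof.
apply: serP => i j; rewrite scY2M -[LHS]/(pder2 (E i j)) scE.
rewrite pder2M pder2C mulr0 addr0 pder2M (derX (@pder2M F) (pX1 F)) pder2X1.
rewrite !mul0r mul0rn mul0r add0r (derX (@pder2M F) (pX2 F)) pder2X2 mul1r.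
case: j => [|j]; first by rewrite mulr0n mulr0 !mul0r.
by rewrite scE -(fvS nvK0 j) !(mulrnAl, mulrnAr, pcM, rmorphMn (@pc F)).
Qed.

(** The angular derivative in [z] with weight [(- x1, - x2)], coefficient by coefficient; here
    [(x1, x2)] is the base point [xi]. *)
Definition cang f : ser K := @Ser K (fun i j => aD (- x1) (- x2) (f i j)).

Lemma cangE f : cang f = kc (pX1 F) * (cder (@pder2 F) f - kc (pc x2) * f) -
  kc (pX2 F) * (cder (@pder1 F) f - kc (pc x1) * f).
Proof.
apply: serP => i j; rewrite scB !scCM !scB !scCM /=.
by rewrite /aD /td1 /td2 !pcN !mulNr.
Qed.

(** The total exponential is [exp ((x - xi).z)], in which [x - xi] and [z] play the same role. Hence
    the weighted angular derivative in [z] corresponds, after the exchange, to the one in [x]. *)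
Lemma cang_tauE q : cang (tau (sw q) * E) = tau (sw (aD (pX1 F) (pX2 F) q)) * E.
Proof.
have t1 := cder_tau (@pder1D F) (@pder1M F) (@Dz1D F) (@Dz1M F) (@pder1C F) (@Dz1C F) (Dz1X1 F) (Dz1X2 F) (sw q).
have t2 := cder_tau (@pder2D F) (@pder2M F) (@Dz2D F) (@Dz2M F) (@pder2C F) (@Dz2C F) (Dz2X1 F) (Dz2X2 F) (sw q).
rewrite cangE (cderM (@pder1D F) (@pder1M F)) (cderM (@pder2D F) (@pder2M F)) t1 t2 cder1_E cder2_E.
rewrite /aD; have s1 := sw_td1 q; have s2 := sw_td2 q.
move: (td1 _ q) (td2 _ q) s1 s2 => u v s1 s2.
rewrite swB !swM swX1 swX2 s1 s2.
move: (sw q) => w; move: (Dz1 w) (Dz2 w) => w1 w2.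
rewrite (tauD _ _ _ (- _)) tauN !tauM !tauC !tauD !tauM tauX1 tauX2.
move: E (tau w) (tau w1) (tau w2) => a b c d.
ring.
Qed.
End Coefficients.

Lemma iter_coef (T : Type) (a : T -> T) (c : ser T -> ser T) k (f : ser T) i j :
  (forall f i j, c f i j = a (f i j)) -> iter k c f i j = iter k a (f i j).
Proof. by move=> ca; elim: k => //= k <-; rewrite ca. Qed.

Lemma iter_cang (F : comNzRingType) (x1 x2 : F) k (f : ser {poly {poly F}}) b c :
  iter k (cang x1 x2) f b c = iter k (aD (- x1) (- x2)) (f b c).
Proof. by apply: iter_coef => g i j; reflexivity. Qed.

Lemma bev_id (F : comNzRingType) (h : {poly {poly F}}) :
  @bev F {poly {poly F}} (@pc F) (pX1 F) (pX2 F) h = h.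
Proof.
apply: (@bev_unique F {poly {poly F}} (@bev F {poly {poly F}} (@pc F) (pX1 F) (pX2 F)) idfun)
  => [k||] /=; first exact: bevC.
  exact: bevX1.
exact: bevX2.
Qed.

(** * Degrees in [z] of Taylor coefficients in [x] *)

Section Grading.
Variable F : comNzRingType.
Local Notation K := {poly {poly F}}.
Implicit Types (f g : ser K).

(* The coefficient of [x1^i x2^j] has [z]-degree less than [n + i + j]. *)
Definition gd n f := forall i j, dlt (n + i + j) (f i j).

Lemma gdM n f g : gd n f -> gd 1 g -> gd n (f * g).
Proof.
move=> df dg i j; rewrite scM; apply: dlt_sum => a _; apply: dlt_sum => b _.
have ai := leq_ord a; have bj := leq_ord b.
apply: dlt_leq (dltM (df a b) (dg (i - a)%N (j - b)%N)); lia.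
Qed.
Lemma gd_kc n c : dlt n c -> gd n (kc c).
Proof.
move=> dc i j; rewrite /= /fps_c; case: ifP => _; last exact: dlt_0.
by apply: dlt_leq dc; rewrite -addnA leq_addr.
Qed.
Lemma gd_emb (f : ser F) : gd 1 (emb f).
Proof. by move=> i j; apply: dlt_leq (@dltC F (f i j)). Qed.
Lemma gdX f n : gd 1 f -> gd 1 (f ^+ n).
Proof.
move=> df; elim: n => [|n IH]; last by rewrite exprS; apply: gdM.
by rewrite expr0 -(rmorph1 (@emb F)); apply: gd_emb.
Qed.
Lemma gd_sum n I (r : seq I) (G : I -> ser K) :
  (forall k, gd n (G k)) -> gd n (\sum_(k <- r) G k).
Proof. by move=> H i j; rewrite sc_sum; apply: dlt_sum => k _; apply: H. Qed.

Lemma gd_tau n (x1 x2 : F) (p : {poly {poly K}}) : (forall i j, dlt n p`_j`_i) ->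
  gd n (tau (pc x1) (pc x2) p).
Proof.
move=> dp; rewrite /tau bevE; apply: gd_sum => j; apply: gd_sum => i.
apply: gdM; [apply: gdM; [exact: gd_kc|]|]; apply: gdX.
  by rewrite -embY1 -embC -(rmorphB (@emb F)); apply: gd_emb.
by rewrite -embY2 -embC -(rmorphB (@emb F)); apply: gd_emb.
Qed.

Lemma gd_E nv0 : gd 1 (Eser (pnv nv0) (pX1 F) (pX2 F)).
Proof.
move=> i j; rewrite scE mulrC; apply: dltCM.
have d1 := @dltX F 1 i _ (@dltX1 F); have d2 := @dltX F 1 j _ (@dltX2 F).
by apply: dlt_leq (dltM d1 d2); lia.
Qed.
End Grading.

(** * The span of the Taylor coefficients of [Psi] *)

Section Spectral.
Variable F : comNzRingType.
Local Notation K := {poly {poly F}}.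
Local Notation B := {poly {poly K}}.
Variables (I : eqType) (Pi : seq I) (mu : I -> nat) (co0 si0 : I -> F) (kap0 : I -> I -> F).
Hypothesis uPi : uniq Pi.
Hypothesis cs0 : forall a, co0 a ^+ 2 + si0 a ^+ 2 = 1.
Hypothesis sd0_reg : forall a b, a \in Pi -> b \in Pi -> a != b -> forall x, sd co0 si0 a b * x = 0 -> x = 0.
Hypothesis kapE0 : forall a b, a \in Pi -> b \in Pi -> a != b -> cd co0 si0 a b = kap0 a b * sd co0 si0 a b.
Hypothesis kapN0 : forall a b, kap0 a b = - kap0 b a.
Hypothesis BA0 : forall a, a \in Pi -> forall k, (k < mu a)%N ->
  \sum_(b <- Pi | b != a) kap0 a b ^+ k.*2.+1 *+ mu b = 0.
Variable nv0 : nat -> F.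
Hypothesis nvK0 : forall n, nv0 n * n.+1%:R = 1.
Hypothesis newt0 : newton_odd F.
Local Notation del0 := (del Pi mu co0 si0).
Local Notation del := (del Pi mu (pco co0) (psi' si0)).
Local Notation dh := (dh Pi mu (pco co0) (psi' si0)).
Local Notation mtot := (mtot Pi mu).
Local Notation QIz x1 x2 := (QIall Pi mu co0 si0 nv0 (- x1) (- x2)).
Local Notation QIall := (QIall Pi mu (pco co0) (psi' si0) (pnv nv0) (pX1 F) (pX2 F)).
Local Notation h := (pc (pc (nv0 1)) : B).

Variables x1 x2 : F.
Local Notation lin a := (kc (si0 a * x1 - co0 a * x2) + (kc (- si0 a) * Y1 F + kc (co0 a) * Y2 F)).
Local Notation QI0 := (QIz x1 x2).
Variable linv : I -> ser F.
Hypothesis linvK : forall a, a \in Pi -> linv a * lin a = 1.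
Local Notation tau := (tau (pc x1) (pc x2)).
Local Notation Es := (Eser (pnv nv0) (pX1 F) (pX2 F)).
Local Notation inv := (fun a => emb (linv a)).
Local Notation hop := (schroedinger (pX1 F) (pX2 F) Pi mu inv).

Lemma tau_L a : tau (L (pco co0) (psi' si0) a) = emb (lin a).
Proof.
rewrite /L /lf tauD tauN !tauM !tauC tauX1 tauX2.
rewrite !(rmorphD (@emb F)) !(rmorphM (@emb F)) /= !embC embY1 embY2.
rewrite pcD pcN !pcM pcN kcD !(rmorphN (@kc K)) !kcM /=.
rewrite /pco /psi'; ring.
Qed.

Lemma invK a : a \in Pi -> inv a * tau (L (pco co0) (psi' si0) a) = 1.
Proof. by move=> aP; rewrite tau_L -(rmorphM (@emb F)) linvK // (rmorph1 (@emb F)). Qed.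

Lemma lin0_reg a : a \in Pi -> forall x, (co0 a * - x2 - si0 a * - x1) * x = 0 -> x = 0.
Proof.
move=> aP x; have := congr1 (fun f : ser F => f 0%N 0%N) (linvK aP).
rewrite scM !big_ord_recl !big_ord0 !scD !scCM /= /fps_c /fps_X1 /fps_X2 /= !mulr0 !addr0.
move=> E; have -> : co0 a * - x2 - si0 a * - x1 = si0 a * x1 - co0 a * x2 by ring.
by move=> H; rewrite -[x]mul1r -E -mulrA H mulr0.
Qed.

Variable Psi : ser K.
Hypothesis PsiE : Psi *+ (2 ^ mtot * mtot`!) = iter mtot hop (tau del * Es).

Definition span (f : K) := exists s : seq ((nat * nat) * F),
  f = \sum_(t <- s) pc t.2 * Psi t.1.1 t.1.2.

Lemma Psi_decomp : exists Phi s, [/\ Psi * tau del = tau Phi * Es, QIall Phi, sw Phi = Phi,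
   Phi = pc del0 * del + s & forall i j, dlt mtot s`_j`_i].
Proof.
have [p [Phi [s [[p0 pS pE] [QPhi swPhi PhiE ds]]]]] :=
  BA_symmetric uPi cs0 sd0_reg kapE0 kapN0 BA0 nvK0 newt0.
exists Phi, s; split=> //.
have lapK := lap_del uPi (pcs1 cs0) (pkapE kapE0) (pkapN kapN0)
    (fun a aP ma => pBA BA0 aP (k := 0) ma).
have H k : iter k hop (tau del * Es) * tau del = tau (p k) * Es.
  elim: k => [|k IH]; first by rewrite p0 expr2 tauM mulrAC.
  apply: (schroedinger_step (pnvK nvK0) uPi lapK invK IH (pS k)).
have c0 : (0 < 2 ^ mtot * mtot`!)%N by rewrite muln_gt0 expn_gt0 fact_gt0.
have := H mtot; rewrite -PsiE pE tauMn !mulrnAl => e.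
apply: serP => i j; have := congr1 (fun f : ser K => f i j) e.
by rewrite !scMn; case: (_ * _)%N c0 => // c _ /(natI (pnvK nvK0)).
Qed.

Lemma tau_delK : tau del * emb (\prod_(a <- Pi) linv a ^+ mu a) = 1.
Proof.
have -> : emb (\prod_(a <- Pi) linv a ^+ mu a) = dinv Pi mu inv.
  rewrite (rmorph_prod (@emb F)) /=.
  by apply: eq_bigr => a _; rewrite (rmorphXn (@emb F)).
by rewrite mulrC; apply: (dinvK mu (inv := inv) (@invK)).
Qed.

Lemma Psi_E Phi : Psi * tau del = tau Phi * Es ->
  Psi = tau Phi * Es * emb (\prod_(a <- Pi) linv a ^+ mu a).
Proof. by move=> <-; rewrite -mulrA tau_delK mulr1. Qed.

Lemma iter_cang_tauE k q : iter k (cang x1 x2) (tau (sw q) * Es) =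
  tau (sw (iter k (aD (pX1 F) (pX2 F)) q)) * Es.
Proof.
elim: k => [|k IH]; first reflexivity.
exact: (etrans (congr1 (cang x1 x2) IH) (cang_tauE x1 x2 nvK0 _)).
Qed.

(** Since [Phi] is symmetric, its odd angular derivatives in [z] are the exchanged ones in [x],
    where quasi-invariance produces a factor [L a]; the exchange turns it into the linear form in
    [z]. Division by [delta (x - xi)] only forms combinations of coefficients with constant
    scalars. *)
Lemma Psi_QI i j : QI0 (Psi i j).
Proof.
have [Phi [s [E QPhi swPhi _ _]]] := Psi_decomp.
rewrite (Psi_E E) scM => a aP.
apply: QI_sum => b _; apply: QI_sum => c _.
rewrite mulrC /emb /=; apply: QI_CM.
rewrite -[fps_mul _ _ _ _]/((tau Phi * Es) b c).
apply/(QI_angP nvK0 (cs0 a)) => k ok km.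
rewrite -iter_cang -[X in tau X]swPhi iter_cang_tauE.
have [h ->] := (QI_angP (pnvK nvK0) (pcs1 cs0 a) (pX1 F) (pX2 F) (mu a) Phi).1 (QPhi a aP) k ok km.
rewrite swM [X in tau (X * _)](sw_L co0 si0 a) tauM tauC -mulrA scCM.
by exists ((tau (sw h) * Es) b c).
Qed.

Lemma Psi_lead : exists R : ser K, gd mtot R /\
  forall i j, Psi i j = del0 * Es i j + R i j.
Proof.
have [Phi [s [E _ _ PhiE ds]]] := Psi_decomp.
exists (tau s * Es * emb (\prod_(a <- Pi) linv a ^+ mu a)); split.
  by apply: gdM; [apply: gdM; [apply: gd_tau | apply: gd_E] | apply: gd_emb].
move=> i j; rewrite -scCM -scD; congr (sc _ i j).
rewrite {1}(Psi_E E) PhiE tauD tauM tauC !mulrDl; congr (_ + _).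
have := tau_delK; move: (tau del) Es (emb _) (kc _) => t u v w tv.
by have -> : w * t * u * v = w * u * (t * v); [ring | rewrite tv mulr1].
Qed.

Lemma spanD f g : span f -> span g -> span (f + g).
Proof. by move=> [s ->] [t ->]; exists (s ++ t); rewrite big_cat. Qed.
Lemma span_gen c i j : span (pc c * Psi i j).
Proof. by exists [:: ((i, j), c)]; rewrite big_seq1. Qed.
Lemma span0 : span 0.
Proof. by exists [::]; rewrite big_nil. Qed.
Lemma span_sum J (r : seq J) (G : J -> K) : (forall k, span (G k)) -> span (\sum_(k <- r) G k).
Proof. by move=> H; elim/big_rec: _ => [|k x _]; [exact: span0 | apply: spanD]. Qed.

Lemma span_QI f : span f -> QI0 f.
Proof. by move=> [s ->] a aP; apply: QI_sum => t _; apply: QI_CM; apply: Psi_QI. Qed.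

(** The leading form of [f] is [del0 * h]. Replacing each monomial of [h] by the matching
    coefficient of [Psi], times [i! j!] to undo the exponential series, gives an element of the span
    with the same leading form. *)
Lemma QI_span f : QI0 f -> span f.
Proof.
have [n] := dlt_exists f; elim: n f => [|n IH] f df Qf; first by rewrite (dlt0 df); apply: span0.
have [R [gR PE]] := Psi_lead.
have [h hE] := QIall_top uPi cs0 sd0_reg nvK0 newt0 lin0_reg Qf df.
have dh : dlt (n.+1 - mtot) h.
  apply: (dlt_delI (co := co0) (si := si0) cs0 (Pi := Pi) (mu := mu)); rewrite -hE.
  by apply: dlt_leq (@dlt_hpart _ n f); lia.
pose G j i := pc (h`_j`_i *+ (i`! * j`!)) * Psi i j.
pose g := \sum_(j < size h) \sum_(i < size h`_j) G j i.
have sg : span g by apply: span_sum => j; apply: span_sum => i; apply: span_gen.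
rewrite -[f](subrK g); apply: spanD => //; apply: IH; last first.
  by move=> a aP; apply: QI_B; [apply: Qf | apply: span_QI].
have -> : f - g = f - hpart n f + (del0 * h - g) by rewrite hE addrA subrK.
apply: dltD; first exact: hpart_rest.
rewrite -[h in del0 * h]bev_id bevE mulr_sumr -sumrB; apply: dlt_sum => j _; rewrite mulr_sumr -sumrB; apply: dlt_sum => i _.
rewrite /G PE scE mulrDr opprD addrA.
have -> : del0 * (pc h`_j`_i * pX1 F ^+ i * pX2 F ^+ j) -
  pc (h`_j`_i *+ (i`! * j`!)) * (del0 * (pX1 F ^+ i * pX2 F ^+ j * pc (fv nv0 i * fv nv0 j))) = 0.
  have -> : pc h`_j`_i = pc (h`_j`_i *+ (i`! * j`!)) * pc (fv nv0 i * fv nv0 j).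
    rewrite -pcM mulrnAl -mulrnAr mulrnA -mulrnAl (fvE nvK0) mul1r (fvE nvK0) mulr1 //.
  ring.
rewrite add0r; apply: dltN.
case: (ltnP (i + j) (n.+1 - mtot)) => ij.
  by apply: dltCM; apply: dlt_leq (gR i j); lia.
by rewrite (dh _ _ ij) mul0rn pc0 mul0r; apply: dlt_0.
Qed.
End Spectral.

Section Inverse.
Variable F : fieldType.
Implicit Types f g v : ser F.

Lemma order_expr v n i j : v 0%N 0%N = 0 -> (i + j < n)%N -> (v ^+ n) i j = 0.
Proof.
move=> v0; elim: n i j => // n IH i j ij.
rewrite exprS scM big1 // => a _; rewrite big1 // => b _.
have [a0|a0] := posnP a; have [b0|b0] := posnP b; first by rewrite a0 b0 v0 mul0r.
all: by rewrite IH ?mulr0 //; have := leq_ord a; have := leq_ord b; lia.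
Qed.

(** The partial geometric sum [S N] inverts [f] up to a multiple of [v ^ N], which has order at
    least [N]; a coefficient of index [(i, j)] uses only the terms with [n <= i + j]. *)
Lemma fps_invP f : f 0%N 0%N != 0 -> Ser (fps_inv f) * f = 1.
Proof.
set c := f 0%N 0%N => c0; pose v := - (f + kc (- c)).
have v0 : v 0%N 0%N = 0 by rewrite scN scD /= /fps_c /= subrr oppr0.
have fE : f = kc c - v by rewrite /v opprK (rmorphN (@kc F)) addrC subrK.
pose S N := \sum_(n < N) kc (c ^- n.+1) * v ^+ n.
have SE N : S N * f = 1 - kc (c ^- N) * v ^+ N.
  elim: N => [|N IH]; first by rewrite /S big_ord0 mul0r expr0 invr1 (rmorph1 (@kc F)) mulr1 subrr.
  rewrite /S big_ord_recr mulrDl IH fE.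
  have -> : kc (c ^- N) = kc (c ^- N.+1) * kc c.
    by rewrite -(rmorphM (@kc F)) /= exprSr invfM mulfVK.
  by rewrite [v ^+ N.+1]exprSr; ring.
apply: serP => i j; set N := (i + j).+1.
have -> : (1 : ser F) i j = (S N * f) i j.
  by rewrite SE scB scCM order_expr // mulr0 subr0.
rewrite !scM; apply: eq_bigr => a _; apply: eq_bigr => b _; congr (_ * _).
have ai := leq_ord a; have bj := leq_ord b.
rewrite /S sc_sum (@sum_ord_trunc _ (fun n => (kc (c ^- n.+1) * v ^+ n) a b) (a + b).+1).
- apply: eq_bigr => n _; rewrite scCM mulrC -scX; congr (_ * _).
- by move=> n nl; rewrite scCM order_expr ?mulr0.
- by rewrite /N; lia.
Qed.
End Inverse.

(** * Complex trigonometry *)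

Local Open Scope complex_scope.

Section Trigonometry.
Variable R : realType.
Implicit Types (x y : R) (z w a b : R[i]).

Lemma sin_pi_int (k : int) : sin ((pi : R) * k%:~R) = 0.
Proof.
have H n : sin ((pi : R) * n%:R) = 0.
  elim: n => [|n IH]; first by rewrite mulr0 sin0.
  by rewrite -natr1 mulrDr mulr1 sinDpi IH oppr0.
case: k => n; first exact: H.
by rewrite NegzE mulrNz mulrN sinN H oppr0.
Qed.

Lemma sin_eq0_pi_int x : sin x = 0 -> exists k : int, x = pi * k%:~R.
Proof.
move=> sx; exists (Num.floor (x / pi)); set k := Num.floor _.
have pi0 : 0 < (pi : R) := pi_gt0 R.
have /andP[k1 k2] : k%:~R <= x / pi < (k + 1)%:~R by rewrite floor_le_tmp floorD1_gt.
have s0 : sin (x - pi * k%:~R) = 0 by rewrite sinB sx sin_pi_int mul0r mulr0 subrr.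
have l0 : 0 <= x - pi * k%:~R by rewrite subr_ge0 mulrC -ler_pdivlMr.
have l1 : x - pi * k%:~R < pi.
  by rewrite ltrBlDr mulrC -[X in _ < X + _]mul1r -mulrDl -ltr_pdivrMr // -[1]/(1%:~R) -intrD addrC.
move: l0; rewrite le_eqVlt => /orP[/eqP e|l0]; first by apply/eqP; rewrite -subr_eq0 -e.
by have := @sin_gt0_pi R (x - pi * k%:~R); rewrite l0 l1 s0 ltxx => /(_ isT).
Qed.

Lemma cexpD z w : cexp (z + w) = cexp z * cexp w.
Proof.
case: z => a b; case: w => c d; rewrite /cexp /= expRD cosD sinD; simpc.
by congr (_ +i* _); ring.
Qed.
Lemma cexp0 : cexp (0 : R[i]) = 1.
Proof. by rewrite /cexp /= expR0 cos0 sin0; simpc. Qed.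
Lemma cexpNK z : cexp z * cexp (- z) = 1.
Proof. by rewrite -cexpD subrr cexp0. Qed.

Lemma cexp_eq1 z : cexp z = 1 -> exists k : int, z = 2 * 'i * (pi * k%:~R)%:C.
Proof.
case: z => a b; rewrite /cexp /=; simpc => -[ec es].
have e0 : 0 < expR a by apply: expR_gt0.
have sb : sin b = 0 by move/eqP: es; rewrite mulf_eq0 gt_eqF //= => /eqP.
have cb : cos b = 1.
  have := cos2Dsin2 b; rewrite sb expr0n addr0 => /eqP.
  rewrite sqrf_eq1 => /orP[/eqP //|/eqP cN].
  by move: ec; rewrite cN mulrN1 => ec; have := e0; rewrite -[expR a]opprK ec oppr_gt0 ltr10.
have a0 : a = 0 by apply: expR_inj; rewrite expR0 -ec cb mulr1.
have : sin (b / 2) = 0.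
  have := cb; rewrite {1}[b]splitr cosD -!expr2 cos2sin2 => e.
  apply/eqP; rewrite -sqrf_eq0; apply/eqP; lra.
move=> /sin_eq0_pi_int[k bk]; exists k.
by rewrite a0 -bk; simpc; congr (_ +i* _); field.
Qed.

Lemma i2 : 'i * 'i = -1 :> R[i].
Proof. by simpc. Qed.
Lemma i_neq0 : 'i != 0 :> R[i].
Proof. by rewrite eq_complex /= oner_eq0 andbF. Qed.
Lemma two_neq0 : 2 != 0 :> R[i].
Proof. by rewrite pnatr_eq0. Qed.

Lemma ccos_csin a : ccos a ^+ 2 + csin a ^+ 2 = 1.
Proof.
have := cexpNK ('i * a); rewrite /ccos /csin.
move: (cexp ('i * a)) (cexp (- ('i * a))) => p q pq.
have -> : ((p + q) / 2) ^+ 2 + ((p - q) / (2 * 'i)) ^+ 2 =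
   p * q + (p - q) ^+ 2 / 4 * (('i * 'i)^-1 + 1) by field; rewrite i_neq0.
by rewrite pq i2 invrN1 addNr mulr0 addr0.
Qed.

Lemma csinB a b : csin (b - a) = ccos a * csin b - csin a * ccos b.
Proof.
rewrite /ccos /csin mulrBr opprB !cexpD.
have pa := cexpNK ('i * a); have pb := cexpNK ('i * b).
move: (cexp ('i * a)) (cexp (- ('i * a))) (cexp ('i * b)) (cexp (- ('i * b))) pa pb => p p' q q' pa pb.
by field; rewrite i_neq0.
Qed.

Lemma ccosB a b : ccos (b - a) = ccos a * ccos b + csin a * csin b.
Proof.
rewrite /ccos /csin mulrBr opprB !cexpD.
have pa := cexpNK ('i * a); have pb := cexpNK ('i * b).
move: (cexp ('i * a)) (cexp (- ('i * a))) (cexp ('i * b)) (cexp (- ('i * b))) pa pb => p p' q q' pa pb.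
have -> : (p + p') / 2 * ((q + q') / 2) + (p - p') / (2 * 'i) * ((q - q') / (2 * 'i)) =
  (q * p' + p * q') / 2 + (p - p') * (q - q') / 4 * (('i * 'i)^-1 + 1) by field; rewrite i_neq0.
by rewrite i2 invrN1 addNr mulr0 addr0.
Qed.

Lemma csinN a : csin (- a) = - csin a.
Proof. by rewrite /csin mulrN opprK -opprB mulNr. Qed.
Lemma ccosN a : ccos (- a) = ccos a.
Proof. by rewrite /ccos mulrN opprK addrC. Qed.
Lemma csin2 a : csin (2 * a) = 2 * csin a * ccos a.
Proof.
have -> : 2 * a = a - - a by rewrite opprK mulr_natl.
by rewrite csinB csinN ccosN; ring.
Qed.
Lemma ccos2 a : ccos (2 * a) = ccos a ^+ 2 - csin a ^+ 2.
Proof.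
have -> : 2 * a = a - - a by rewrite opprK mulr_natl.
by rewrite ccosB csinN ccosN; ring.
Qed.

Lemma csin_eq0 a : csin a = 0 -> exists k : int, a = (pi * k%:~R)%:C.
Proof.
move=> /eqP; rewrite /csin mulf_eq0 invr_eq0 mulf_eq0 (negPf two_neq0) (negPf i_neq0) !orbF.
rewrite subr_eq0 => /eqP e.
have /cexp_eq1[k kE] : cexp ('i * a + 'i * a) = 1 by rewrite cexpD [X in X * _]e mulrC cexpNK.
exists k; apply: (mulfI (mulf_neq0 two_neq0 i_neq0)); by rewrite -kE -mulrA mulr_natl mulr2n.
Qed.

Lemma line_arrangement_csin (Pi : seq R[i]) a b : line_arrangement Pi ->
  a \in Pi -> b \in Pi -> a != b -> csin (b - a) != 0.
Proof.
move=> [_ H] aP bP ab; apply/eqP => /csin_eq0[k e].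
by have := H b a bP aP; rewrite eq_sym ab => /(_ isT k); rewrite e eqxx.
Qed.

Definition ccot a b : R[i] := ccos (b - a) / csin (b - a).

Lemma ccotN a b : ccot a b = - ccot b a.
Proof. by rewrite /ccot -(opprB a b) ccosN csinN invrN mulrN. Qed.

(** Numerator and denominator are divided by [exp (i (a + b))]. This converts the Baker-Akhieser
    sums into sums of odd powers of cotangents. *)
Lemma ee_ratio a b : csin (b - a) != 0 -> (ee b + ee a) / (ee b - ee a) = - 'i * ccot a b.
Proof.
rewrite /ccot /ee /csin /ccos mulrBr opprB !cexpD.
have dbl c : 2 * 'i * c = 'i * c + 'i * c by ring.
rewrite !dbl !cexpD.
have pa := cexpNK ('i * a); have pb := cexpNK ('i * b).
move: (cexp ('i * a)) (cexp (- ('i * a))) (cexp ('i * b)) (cexp (- ('i * b))) pa pb => p p' q q' pa pb.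
rewrite mulf_eq0 invr_eq0 mulf_eq0 (negPf two_neq0) (negPf i_neq0) !orbF => H.
have p0 : p != 0 by apply: contra_eq_neq pa => ->; rewrite mul0r eq_sym oner_neq0.
have q0 : q != 0 by apply: contra_eq_neq pb => ->; rewrite mul0r eq_sym oner_neq0.
have pE : p' = p^-1 by apply: (mulfI p0); rewrite pa divff.
have qE : q' = q^-1 by apply: (mulfI q0); rewrite pb divff.
move: H; rewrite pE qE => H.
have N : q * q - p * p != 0.
  have -> : q * q - p * p = (q / p - p / q) * (p * q) by field; rewrite p0 q0.
  by rewrite !mulf_neq0.
have -> : - 'i * ((q / p + p / q) / 2 / ((q / p - p / q) / (2 * 'i))) =
   - ('i * 'i) * ((q / p + p / q) / (q / p - p / q)).
  by field; rewrite (mulNr p) i_neq0 p0 q0 N.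
by rewrite i2 opprK mul1r; field; rewrite (mulNr p) p0 q0 N.
Qed.
End Trigonometry.

(** * Translation of the definitions into the algebraic setting *)

Section Bridge.
Variable R : realType.
Implicit Types (f : bpoly R) (a b : R[i]).
Variables (Pi : seq R[i]) (mu : R[i] -> nat).

Definition nvc n : R[i] := n.+1%:R^-1.
Lemma nvcK n : nvc n * n.+1%:R = 1.
Proof. by rewrite /nvc mulVf // pnatr_eq0. Qed.
Lemma fvc n : fv nvc n = (n`!)%:R^-1.
Proof.
have n0 : (n`!)%:R != 0 :> R[i] by rewrite pnatr_eq0 -lt0n fact_gt0.
by apply: (mulIf n0); rewrite mulVf // mulr_natr (fvE nvcK).
Qed.
Lemma newtc : newton_odd R[i].
Proof. by apply: newton_oddP => n; rewrite pnatr_eq0. Qed.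

Local Notation QIc := (QIall Pi mu (@ccos R) (@csin R) nvc).

Lemma Ser_exp (e1 e2 : R[i]) : Ser (fps_exp e1 e2) = Eser nvc e1 e2.
Proof. by apply: serP => i j; rewrite /= /fps_exp !fvc natrM invfM. Qed.

Lemma iter_fps_ang k (g : fps R[i]) : iter k fps_ang g = sc (iter k (@ang _) (Ser g)).
Proof. by elim: k => // k IH; rewrite !iterS IH. Qed.

(** The orders [2 l - 1] with [1 <= l <= mu a] are the odd numbers below [2 mu a]. *)
Lemma PmodE (xi1 xi2 : R[i]) f : Pmod Pi mu xi1 xi2 f <-> QIc (- xi1) (- xi2) f.
Proof.
have E k a n : (\sum_(i < n.+1) iter k fps_ang (fps_mul (fps_exp (- xi1) (- xi2)) (fps_of_bpoly f))
    i (n - i)%N * ccos a ^+ i * csin a ^+ (n - i)) =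
    evs (ccos a) (csin a) (iter k (@ang _) (Eser nvc (- xi1) (- xi2) * pin f)) n.
  by rewrite iter_fps_ang /evs -Ser_exp.
split=> H a aP.
  apply/(QI_evs (ccos_csin a) nvcK) => k ok km n; rewrite -E.
  have -> : k = (2 * (k.+1)./2 - 1)%N by rewrite mul2n; have := odd_double_half k.+1; rewrite /= ok; lia.
  apply: H => //; have := odd_double_half k; rewrite /= ok; lia.
move=> l /andP[l1 lm] n; rewrite E.
apply: (QI_evs (ccos_csin a) nvcK _ _ _ _).1; first exact: H.
  by rewrite mul2n -[l]prednK // doubleS subn1 /= odd_double.
by rewrite mul2n; lia.
Qed.

Lemma inAE f : inA Pi mu f <-> QIc 0 0 f.
Proof.
have E a : bdvd (lform a ^+ (2 * mu a).+1) (f - srefl a f) <->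
    QI nvc (ccos a) (csin a) 0 0 (mu a) f.
  have cs1 := ccos_csin a.
  have CS1 : ccos (2 * a) * ccos a + csin (2 * a) * csin a = ccos a.
    by rewrite csin2 ccos2 -[RHS]mulr1 -[X in _ = _ * X]cs1; ring.
  have CS2 : csin (2 * a) * ccos a - ccos (2 * a) * csin a = csin a.
    by rewrite csin2 ccos2 -[RHS]mulr1 -[X in _ = _ * X]cs1; ring.
  have <- := refl_QI cs1 CS1 CS2 nvcK (mu a) f.
  have -> : lform a = lf (ccos a) (csin a) by rewrite /lform addrC.
  have -> : srefl a f = refl (ccos (2 * a)) (csin (2 * a)) f.
    by rewrite /refl bevE.
  by rewrite mul2n.
by split=> H a /H/E.
Qed.

Lemma iter_fps_d1 k (g : fps (bpoly R)) i j : iter k fps_d1 g i j = g (i + k)%N j *+ (i + k) ^_ k.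
Proof.
elim: k g i => [|k IH] g i; first by rewrite addn0 mulr1n.
by rewrite iterSr IH /fps_d1 -mulrnA addnS ffactSS.
Qed.
Lemma iter_fps_d2 k (g : fps (bpoly R)) i j : iter k fps_d2 g i j = g i (j + k)%N *+ (j + k) ^_ k.
Proof.
elim: k g j => [|k IH] g j; first by rewrite addn0 mulr1n.
by rewrite iterSr IH /fps_d2 -mulrnA addnS ffactSS.
Qed.

Variables xi1 xi2 : R[i].
Local Notation lin a := (kc (csin a * xi1 - ccos a * xi2) + (kc (- csin a) * Y1 R[i] + kc (ccos a) * Y2 R[i])).
Local Notation linv := (fun a => Ser (fps_inv (lin_shift a xi1 xi2))).
Local Notation Psi := (Ser (Psi_ser Pi mu xi1 xi2)).
Local Notation mtot := (mtot Pi mu).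
Local Notation K := {poly {poly R[i]}}.
Local Notation Es := (Eser (pnv nvc) (pX1 R[i]) (pX2 R[i])).
Local Notation del := (del Pi mu (pco (@ccos R)) (psi' (@csin R))).
Local Notation tau := (tau (pc xi1) (pc xi2)).
Local Notation hop := (schroedinger (pX1 R[i]) (pX2 R[i]) Pi mu (fun a => emb (linv a))).

Lemma wgenE p1 p2 : wgen Pi mu xi1 xi2 p1 p2 = Psi p1 p2 *+ (p1`! * p2`!).
Proof. by rewrite /wgen iter_fps_d1 iter_fps_d2 !add0n !ffactnn mulrnAC -mulrnA. Qed.

Lemma Ser_scal (T : comNzRingType) (c : T) (g : fps T) : Ser (fps_scal c g) = kc c * Ser g.
Proof. by apply: serP => i j; rewrite scCM. Qed.

Lemma Ser_lin a : Ser (lin_shift a xi1 xi2) = lin a.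
Proof. by apply: serP => i j; rewrite !scD !scCM. Qed.

Lemma Ser_delta : Ser (delta_ser Pi mu xi1 xi2) = \prod_(a <- Pi) lin a ^+ mu a.
Proof.
rewrite /delta_ser; elim: Pi => [|a r IH]; first by rewrite big_nil.
by rewrite big_cons /= -IH -Ser_lin -scX.
Qed.

Lemma Ser_pot : Ser (pot_ser Pi mu xi1 xi2) = \sum_(a <- Pi) linv a ^+ 2 *+ (mu a * (mu a).+1).
Proof.
rewrite /pot_ser; elim: Pi => [|a r IH]; first by rewrite big_nil.
rewrite big_cons /= -IH -[LHS]/(Ser (fps_scal _ (fps_pow _ 2)) + Ser _) Ser_scal.
by rewrite (rmorph_nat (@kc _)) mulr_natl -scX.
Qed.

Lemma Ser_Hop (g : fps K) : Ser (Hop Pi mu xi1 xi2 g) = hop (Ser g).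
Proof.
rewrite /schroedinger.
have -> : pot Pi mu (fun a => emb (linv a)) = emb (Ser (pot_ser Pi mu xi1 xi2)).
  rewrite Ser_pot (rmorph_sum (@emb _)); apply: eq_bigr => a _.
  by rewrite (rmorphMn (@emb _)) (rmorphXn (@emb _)).
by rewrite -Ser_scal.
Qed.

Lemma Ser_exp_xz : Ser (exp_xz R) = Es.
Proof.
apply: serP => i j; rewrite scE !fvc -invfM -natrM [RHS]mulrC.
by rewrite /= /exp_xz mulrA.
Qed.

Lemma PsiE : Psi *+ (2 ^ mtot * mtot`!) = iter mtot hop (tau del * Es).
Proof.
have iterE k (g : fps K) : Ser (iter k (Hop Pi mu xi1 xi2) g) = iter k hop (Ser g).
  by elim: k => // k IH; rewrite !iterS Ser_Hop IH.
have -> : tau del * Es = Ser (fps_mul (fps_embed (delta_ser Pi mu xi1 xi2)) (exp_xz R)).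
  rewrite -Ser_exp_xz.
  have -> : tau del = emb (Ser (delta_ser Pi mu xi1 xi2)); last by [].
  rewrite Ser_delta (rmorph_prod (@emb _)) /del -lock (rmorph_prod tau); apply: eq_bigr => a _.
  by rewrite /= (rmorphXn tau) (rmorphXn (@emb _)) /= tau_L.
rewrite -iterE Ser_scal -mulrnAl -(rmorphMn (@kc _)) -(rmorphMn (@pc _)) /=.
rewrite -[X in kc (pc X)]mulr_natr mulVf; last by rewrite pnatr_eq0 -lt0n muln_gt0 expn_gt0 fact_gt0.
by rewrite pc1 (rmorph1 (@kc _)) mul1r.
Qed.

Lemma inWE f : inW Pi mu xi1 xi2 f <-> span Psi f.
Proof.
split=> -[s ->].
  exists [seq (t.1, t.2 *+ (t.1.1`! * t.1.2`!)) | t <- s]; rewrite big_map; apply: eq_bigr => t _ /=.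
  by rewrite wgenE mulrnAr (rmorphMn (@pc _)) mulrnAl.
exists [seq (t.1, t.2 / (t.1.1`! * t.1.2`!)%:R) | t <- s]; rewrite big_map; apply: eq_bigr => t _ /=.
rewrite wgenE mulrnAr -mulrnAl -(rmorphMn (@pc _)); congr (pc _ * _).
by rewrite /= -[RHS]mulr_natr mulfVK // pnatr_eq0 -lt0n muln_gt0 !fact_gt0.
Qed.

Hypothesis la : line_arrangement Pi.
Hypothesis ba : baker_akhieser Pi mu.
Hypothesis l0 : forall a, a \in Pi -> csin a * xi1 - ccos a * xi2 != 0.

Let uPi : uniq Pi := la.1.
Local Notation sd := (sd (@ccos R) (@csin R)).

Lemma sdE a b : sd a b = csin (b - a).
Proof. by rewrite csinB. Qed.

Lemma sd_neq0 a b : a \in Pi -> b \in Pi -> a != b -> sd a b != 0.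
Proof. by rewrite sdE; apply: line_arrangement_csin. Qed.

Lemma sdc_reg a b : a \in Pi -> b \in Pi -> a != b -> forall x, sd a b * x = 0 -> x = 0.
Proof.
by move=> aP bP ab x /eqP; rewrite mulf_eq0 (negPf (sd_neq0 aP bP ab)) => /eqP.
Qed.

Lemma ccotE a b : a \in Pi -> b \in Pi -> a != b -> cd (@ccos R) (@csin R) a b = ccot a b * sd a b.
Proof.
by move=> aP bP ab; rewrite /ccot -sdE mulfVK ?sd_neq0 // -[RHS]/(ccos (b - a)) ccosB.
Qed.

Lemma ba_ccot a : a \in Pi -> forall k, (k < mu a)%N ->
  \sum_(b <- Pi | b != a) ccot a b ^+ k.*2.+1 *+ mu b = 0.
Proof.
move=> aP k km; have [+ _] := ba aP (k := k.+1) km.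
have -> : (2 * k.+1 - 1 = k.*2.+1)%N by rewrite mul2n doubleS subn1.
move=> H; have i0 : (- 'i : R[i]) ^+ k.*2.+1 != 0 by rewrite expf_neq0 // oppr_eq0 i_neq0.
apply: (mulfI i0); rewrite mulr0 -[RHS]H mulr_sumr big_seq_cond [RHS]big_seq_cond.
apply: eq_bigr => b /andP[bP ba']; rewrite -mulrA -expr_div_n ee_ratio.
  by rewrite [in RHS]exprMn mulrnAr mulr_natl.
by rewrite (line_arrangement_csin la) // eq_sym.
Qed.

Lemma linvcK a : a \in Pi -> linv a * lin a = 1.
Proof.
move=> aP; rewrite -Ser_lin; apply: (@fps_invP _ (Ser (lin_shift a xi1 xi2))).
by rewrite /= /lin_shift /fps_add /fps_scal /fps_c /fps_X1 /fps_X2 /= !mulr0 !addr0 l0.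
Qed.

Lemma inW_Pmod f : inW Pi mu xi1 xi2 f <-> Pmod Pi mu xi1 xi2 f.
Proof.
rewrite inWE PmodE; split.
  by apply: (span_QI uPi (@ccos_csin R) sdc_reg ccotE (@ccotN R) ba_ccot nvcK newtc linvcK PsiE).
by apply: (QI_span uPi (@ccos_csin R) sdc_reg ccotE (@ccotN R) ba_ccot nvcK newtc linvcK PsiE).
Qed.

Lemma inA_Pmod h f : inA Pi mu h -> Pmod Pi mu xi1 xi2 f -> Pmod Pi mu xi1 xi2 (h * f).
Proof. by rewrite inAE !PmodE; apply: (QIall0_mul nvcK). Qed.
Lemma PmodD f g : Pmod Pi mu xi1 xi2 f -> Pmod Pi mu xi1 xi2 g -> Pmod Pi mu xi1 xi2 (f + g).
Proof. by rewrite !PmodE => Qf Qg a aP; apply: QI_D; [apply: Qf | apply: Qg]. Qed.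
Lemma Pmod0 : Pmod Pi mu xi1 xi2 0.
Proof. by rewrite PmodE => a aP; apply: QI_0. Qed.

Lemma Pmod_projective : A_projective (inA Pi mu) (Pmod Pi mu xi1 xi2).
Proof.
have sdK a b : a \in Pi -> b \in Pi -> a != b -> (sd a b)^-1 * sd a b = 1.
  by move=> aP bP ab; rewrite mulVf // sd_neq0.
have [r [rP E]] := QIall_invertible mu (- xi1) (- xi2) uPi (@ccos_csin R) sdK nvcK.
(* Beyond the end of the list the default pair is zero, which gives coordinates of finite
   support. *)
have nthP k : QIc (- xi1) (- xi2) (nth 0 r k).1 /\ QIc xi1 xi2 (nth 0 r k).2.
  case: (ltnP k (size r)) => kr; last by rewrite nth_default //; split=> a aP; apply: QI_0.
  by have := rP _ (mem_nth 0 kr); rewrite !opprK.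
exists (fun f k => f * (nth 0 r k).2), (fun s => \sum_(k < size r) s k * (nth 0 r k).1).
split.
  move=> f Pf; split=> [k|]; last by exists (size r) => k kr; rewrite nth_default //= mulr0.
  apply/inAE; have [_ Q2] := nthP k; move/PmodE: Pf => Q1.
  by have := QIall_mul nvcK Q1 Q2; rewrite !addNr.
split; first by move=> f g _ _; apply/funext => k; rewrite mulrDl.
split; first by move=> a f _ _; apply/funext => k; rewrite mulrA.
split.
  move=> s [sA _]; elim/big_rec: _ => [|k x _ Px]; first exact: Pmod0.
  by apply: PmodD => //; apply: inA_Pmod => //; apply/PmodE; have [] := nthP k.
split.
  by move=> s t _ _; rewrite -big_split; apply: eq_bigr => k _; rewrite mulrDl.
split; first by move=> a s _ _; rewrite mulr_sumr; apply: eq_bigr => k _; rewrite mulrA.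
move=> f _; rewrite -[RHS]mulr1 E (big_nth 0) big_mkord mulr_sumr.
by apply: eq_bigr => k _; rewrite -mulrA [_.2 * _]mulrC.
Qed.
End Bridge.

Theorem theorem4p13 (R : realType) (Pi : seq R[i]) (mu : R[i] -> nat)
    (rho0 phi0 : R[i]) :
  line_arrangement Pi ->
  baker_akhieser Pi mu ->
  rho0 != 0 ->
  (forall a, a \in Pi -> csin (2 * (a - phi0)) != 0) ->
  let xi1 := rho0 * ccos phi0 in
  let xi2 := rho0 * csin phi0 in
  let A := inA Pi mu in
  let W := inW Pi mu xi1 xi2 in
  let P := Pmod Pi mu xi1 xi2 in
  A_submodule A W /\ A_iso A W P /\ A_projective A W.
Proof.
move=> la ba rho_neq0 phi_neq xi1 xi2 A W P.
(* Up to sign this is [l_a (xi)], equal to [rho0 sin (a - phi0)], and [sin (a - phi0)] divides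
   [sin (2 (a - phi0))]. So [xi] lies on none of the lines. *)
have l0 a : a \in Pi -> csin a * xi1 - ccos a * xi2 != 0.
  move=> aP; have := phi_neq a aP; rewrite csin2 -mulrA mulf_eq0 negb_or => /andP[_].
  rewrite mulf_eq0 negb_or => /andP[s0 _].
  have -> : csin a * xi1 - ccos a * xi2 = rho0 * csin (a - phi0).
    by rewrite csinB /xi1 /xi2; ring.
  exact: mulf_neq0.
have -> : W = P.
  by apply/funext => f; apply/propext; apply: (inW_Pmod la ba l0).
split; first by split; [exact: Pmod0 | split; [exact: PmodD | exact: inA_Pmod]].
split; last exact: Pmod_projective.
by exists id; do !split=> //; move=> g Pg; exists g.
Qed.
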